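(* Let $\omega_1,\dots,\omega_\ell$ be skew Young diagrams. Then the $\mathrm{X}(\mathfrak g_N)$-module $$V_{\omega_1}(z_1)\,\tilde\otimes\,\cdots\,\tilde\otimes\, V_{\omega_\ell}(z_\ell)$$ is irreducible for generic $(z_1,\dots,z_\ell)\in\mathbb C^\ell$; that is, there is a proper algebraic subset $D\subsetneq\mathbb C^\ell$ such that the module is irreducible for every $(z_1,\dots,z_\ell)\in\mathbb C^\ell\setminus D$.
   Context: **Algebras.** Everything is over $\mathbb C$. Fix an integer $N>1$, and let $e_{ij}$ be the standard matrix units of $\mathrm{End}(\mathbb C^N)$. Fix an involutive anti-automorphism $A\mapsto A^t$ of $\mathrm{End}(\mathbb C^N)$ of the form $A^t=gA^{T}g^{-1}$, where $A^T$ is the ordinary matrix transpose and $g$ is a non-degenerate matrix that is either symmetric or skew-symmetric. Let $\mathfrak g_N=\{A: A^t=-A\}\subset\mathfrak{gl}_N$. Put $P=\sum_{i,j}e_{ij}\otimes e_{ji}$ (the flip), $Q=\sum_{i,j}e_{ij}^t\otimes e_{ji}$, $R(u,v)=u-v-P$, $R'(u,v)=-(u+v+Q)$, $\breve R(u,v)=1-\frac{P}{u-v}$. The Yangian $\mathrm Y(\mathfrak{gl}_N)$ is the unital associative algebra with generators $T_{ij}^{(k)}$ ($1\le i,j\le N$, $k\ge1$) and relations $R_{12}(u,v)T_1(u)T_2(v)=T_2(v)T_1(u)R_{12}(u,v)$, where $T(u)=\sum_{i,j}e_{ij}\otimes T_{ij}(u)$, $T_{ij}(u)=\sum_{k\ge0}T_{ij}^{(k)}u^{-k}$,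 $T_{ij}^{(0)}=\delta_{ij}$. The extended twisted Yangian $\mathrm X(\mathfrak g_N)$ is the unital associative algebra with generators $S_{ij}^{(k)}$ ($1\le i,j\le N$, $k\ge1$) and relations $R_{12}(u,v)S_1(u)R'_{12}(u,v)S_2(v)=S_2(v)R'_{12}(u,v)S_1(u)R_{12}(u,v)$, where $S(u)=\sum_{i,j}e_{ij}\otimes S_{ij}(u)$, $S_{ij}(u)=\sum_{k\ge0}S_{ij}^{(k)}u^{-k}$, $S_{ij}^{(0)}=\delta_{ij}$. The assignment $S(u)\mapsto T^t(-u)T(u)$ (with $t$ applied to the matrix factor $\mathrm{End}(\mathbb C^N)$) defines a homomorphism $\mathrm X(\mathfrak g_N)\to\mathrm Y(\mathfrak{gl}_N)$, whose image is the twisted Yangian $\mathrm Y(\mathfrak g_N)$. Every $\mathrm Y(\mathfrak{gl}_N)$-module is regarded as an $\mathrm X(\mathfrak g_N)$-module via this homomorphism. **Skew diagrams.** A Young diagram $\lambda=(\lambda_1\ge\lambda_2\ge\dots\ge0)$ (finitely many nonzero terms) is the set $\{(i,j)\in\mathbb Z^2: 0<i,\ 0<j\le\lambda_i\}$, with $i$ the row number (increasing downwards) and $j$ the column number (increasing to the right). Only diagrams whose columns have length at most $N$ are considered. For Young diagrams $\lambda,\mu$ with $\lambda_i\ge\mu_i$ for all $i$, the skew Young diagram $\omega=\lambda/\mu$ is the set difference $\lambda\setminus\mu$; $|\omega|$ is its number of boxes. Its boxes are numbered $1,\dots,|\omega|$ going down each column, columns taken from left to right (column standard tableau). If box $p$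 is in row $i_p$ and column $j_p$, its content is $c_p=c_p^\omega=j_p-i_p$. **The space $V_\omega$.** Put $n=|\omega|$ and $$\breve R^{(n)}(v_1,\dots,v_n)=\prod_{1\le p<q\le n}\Bigl(1-\frac{P_{pq}}{v_p-v_q}\Bigr)\in\mathrm{End}(\mathbb C^N)^{\otimes n},$$ with factors ordered from left to right lexicographically in $(p,q)$, and $P_{pq}$ the flip of the $p$-th and $q$-th tensor factors. Let $\mathcal D_\omega\subset\mathbb C^n$ be the affine subspace of points with $v_p-c_p=v_q-c_q$ whenever $p,q$ lie in the same column of $\omega$. The restriction of $\breve R^{(n)}$ to $\mathcal D_\omega$ is regular at $(c_1,\dots,c_n)$ (known fact); $F_\omega\in\mathrm{End}(\mathbb C^N)^{\otimes n}$ denotes its value there, and $V_\omega=\mathrm{im}\,F_\omega\subset(\mathbb C^N)^{\otimes n}$. **Fusion modules.** For $z_1,\dots,z_\ell\in\mathbb C$ and skew diagrams $\omega_1,\dots,\omega_\ell$ with $n_j=|\omega_j|$, the module $V_{\omega_1}(z_1)\tilde\otimes\cdots\tilde\otimes V_{\omega_\ell}(z_\ell)$ has underlying space $V_{\omega_1}\otimes\cdots\otimes V_{\omega_\ell}\subset(\mathbb C^N)^{\otimes n_1}\otimes\cdots\otimes(\mathbb C^N)^{\otimes n_\ell}$, and $\mathrm Y(\mathfrak{gl}_N)$ acts on it by $$T(u)\mapsto\prod_{j=1}^{\ell}\ \prod_{p=1}^{n_j}\breve R_{0,(j,p)}\bigl(u,\,z_j+c_p^{\omega_j}\bigr)$$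 (expanded in powers of $u^{-1}$, factors ordered from left to right with increasing $j$, and for each $j$ increasing $p$), restricted to this subspace, which is invariant. Here $0$ labels the matrix factor $\mathrm{End}(\mathbb C^N)$ of $T(u)$ and $(j,p)$ labels the $p$-th tensor factor of $(\mathbb C^N)^{\otimes n_j}$. (This is the tensor product of the $\mathrm Y(\mathfrak{gl}_N)$-modules $V_{\omega_j}(z_j)$ with respect to the coproduct $T_{ij}(u)\mapsto\sum_k T_{ik}(u)\otimes T_{kj}(u)$.) *)

(* Defs.v *)
From HB Require Import structures.
From mathcomp Require Import all_boot all_order all_fingroup all_algebra.
From mathcomp.multinomials Require Import mpoly.

Set Implicit Arguments.
Unset Strict Implicit.
Unset Printing Implicit Defensive.

Import GRing.Theory.
Local Open Scope ring_scope.

(* lambda_i for i >= 1; a partition is a nonincreasing sequence, padded by 0. *)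
Definition part (la : seq nat) (i : nat) : nat := nth 0%N la i.-1.

Record skew_diagram := SkewDiagram {
  outer : seq nat;
  inner : seq nat;
  outer_sorted : sorted geq outer;
  inner_sorted : sorted geq inner;
  inner_le_outer : forall i, (part inner i <= part outer i)%N }.

(* The boxes (row, column), both counted from 1, in column standard order.    *)
Definition boxes (w : skew_diagram) : seq (nat * nat) :=
  [seq (i, j) | j <- iota 1 (part (outer w) 1),
                i <- [seq i <- iota 1 (size (outer w)) |
                        (part (inner w) i < j <= part (outer w) i)%N]].

Definition nbox (w : skew_diagram) : nat := size (boxes w).

Definition box (w : skew_diagram) (p : 'I_(nbox w)) : nat * nat :=
  tnth (in_tuple (boxes w)) p.

Definition column_length (w : skew_diagram) (j : nat) : nat :=
  count (fun b => b.2 == j) (boxes w).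

(* The endomorphism ring of W, the product f * g being the composition f o g. *)
(* (The library's ring structures on 'End(W) use the opposite product.)       *)
Definition endo (C : fieldType) (W : vectType C) : Type := 'End(W).

HB.instance Definition _ (C : fieldType) (W : vectType C) :=
  GRing.Lmodule.copy (endo W) 'End(W).
HB.instance Definition _ (C : fieldType) (W : vectType C) :=
  GRing.Zmodule_isPzRing.Build (endo W)
    (@comp_lfunA _ _ _ _ _) (@comp_lfun1l _ _ _) (@comp_lfun1r _ _ _)
    (@comp_lfunDl _ _ _ _) (@comp_lfunDr _ _ _ _).

Section TensorPower.
Variables (C : fieldType) (N : nat) (J : finType).

(* The tensor product of copies of C^N indexed by J, in coordinates: phi f is *)
(* the coefficient of the tensor of the basis vectors e_(f p), p in J.        *)
Definition tpow : vectType C := {ffun {ffun J -> 'I_N} -> C^o}.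

Definition tbasis (f : {ffun J -> 'I_N}) : tpow := [ffun f' => (f' == f)%:R].

Definition upd (f : {ffun J -> 'I_N}) (p : J) (k : 'I_N) : {ffun J -> 'I_N} :=
  [ffun q => if q == p then k else f q].

(* 1 (x) ... (x) A (x) ... (x) 1, with A in the p-th factor                   *)
Definition site (p : J) (A : 'M[C]_N) : endo tpow :=
  linfun (fun phi : {ffun {ffun J -> 'I_N} -> C^o} =>
    [ffun f : {ffun J -> 'I_N} => \sum_k A (f p) k * phi (upd f p k)] : tpow).

(* P_pq *)
Definition flip (p q : J) : endo tpow :=
  linfun (fun phi : {ffun {ffun J -> 'I_N} -> C^o} =>
    [ffun f : {ffun J -> 'I_N} => phi [ffun r => f (tperm p q r)]] : tpow).

End TensorPower.

Section Fusion.
Variables (C : fieldType) (N : nat).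

Definition content (w : skew_diagram) (p : 'I_(nbox w)) : C :=
  (box p).2%:R - (box p).1%:R.

Definition Rfus (n : nat) (v : 'I_n -> C) : endo (tpow C N 'I_n) :=
  \prod_(p < n) \prod_(q < n | (p < q)%N) (1 - (v p - v q)^-1 *: flip C N p q).

Definition Domega (w : skew_diagram) (v : 'I_(nbox w) -> C) : Prop :=
  forall p q, (box p).2 = (box q).2 -> v p - content p = v q - content q.

(* F is the value at the point of contents of the restriction of Rfus to      *)
(* Domega: each matrix coefficient of this restriction, a rational function   *)
(* defined where the v_p are pairwise distinct, is a quotient of polynomials  *)
(* whose denominator does not vanish at the point.  As such points v are      *)
(* dense in Domega, this determines F.                                        *)
Definition fusion_value (w : skew_diagram)
    (F : endo (tpow C N 'I_(nbox w))) : Prop :=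
  forall a b : {ffun 'I_(nbox w) -> 'I_N},
  exists num den : {mpoly C[nbox w]},
  [/\ den.@[@content w] != 0,
      forall v, Domega v -> injective v -> den.@[v] != 0 ->
        Rfus v (tbasis C b) a = num.@[v] / den.@[v]
    & F (tbasis C b) a = num.@[@content w] / den.@[@content w]].

Variables (l : nat) (n : 'I_l -> nat).

Notation factors := {j : 'I_l & 'I_(n j)}.

Definition ptensor (x : forall j, tpow C N 'I_(n j)) : tpow C N factors :=
  [ffun f : {ffun factors -> 'I_N} =>
     \prod_j x j [ffun p => f (Tagged (fun j => 'I_(n j)) p)]].

(* The tensor product of subspaces, spanned by pure tensors of basis vectors. *)
Definition vtensor (V : forall j, {vspace tpow C N 'I_(n j)}) :
    {vspace tpow C N factors} :=
  (\sum_(s : {dffun forall j, 'I_(\dim (V j))})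
     <[ptensor (fun j => (vbasis (V j))`_(s j))]>)%VS.

End Fusion.

(* A formal series in u^-1 with values in a ring A is the sequence of its     *)
(* coefficients.  With A = End(W), elements of End(C^N) (x) A are matrices    *)
(* over A, and elements of End(C^N) (x) End(C^N) (x) A are matrices of such   *)
(* matrices, the outer one being the first tensor factor.                     *)

Section Series.
Variable A : pzRingType.

Definition smul (f g : nat -> A) : nat -> A :=
  fun k => \sum_(i < k.+1) f i * g (k - i)%N.
Definition sone : nat -> A := fun k => (k == 0%N)%:R.

(* f r s is the coefficient of u^-r v^-s *)
Definition smul2 (f g : nat -> nat -> A) : nat -> nat -> A :=
  fun r s => \sum_(i < r.+1) \sum_(j < s.+1) f i j * g (r - i)%N (s - j)%N.

End Series.

Section Yangian.
Variables (C : fieldType) (N : nat) (g : 'M[C]_N) (W : vectType C).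

Notation A := (endo W).
Notation M1 := 'M[endo W]_N.
Notation M2 := 'M['M[endo W]_N]_N.

Definition tr_t (X : 'M[C]_N) : 'M[C]_N := g *m X^T *m invmx g.

(* X (x) Y (x) 1 *)
Definition tens2 (X Y : 'M[C]_N) : M2 :=
  \matrix_(a, b) \matrix_(c, d) ((X a b * Y c d) *: (1 : A)).

Definition Pmx : M2 := \sum_i \sum_j tens2 (delta_mx i j) (delta_mx j i).
Definition Qmx : M2 := \sum_i \sum_j tens2 (tr_t (delta_mx i j)) (delta_mx j i).

(* u^-1 v^-1 R(u,v) = v^-1 - u^-1 - u^-1 v^-1 P                               *)
(* u^-1 v^-1 R'(u,v) = - v^-1 - u^-1 - u^-1 v^-1 Q                            *)
(* The defining relations are homogeneous in R and R', so that the scalar     *)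
(* factor u^-1 v^-1, which clears the positive powers of u and v, is harmless.*)
Definition Rser (r s : nat) : M2 :=
  match r, s with 0, 1 => 1 | 1, 0 => -1 | 1, 1 => - Pmx | _, _ => 0 end.
Definition R'ser (r s : nat) : M2 :=
  match r, s with 0, 1 => -1 | 1, 0 => -1 | 1, 1 => - Qmx | _, _ => 0 end.

(* T_1(u) and T_2(v) *)
Definition in1 (T : nat -> M1) (r s : nat) : M2 :=
  if s is 0 then map_mx (fun x : A => x%:M) (T r) else 0.
Definition in2 (T : nat -> M1) (r s : nat) : M2 :=
  if r is 0 then (T s)%:M else 0.

(* A module over an algebra given by generators and relations: operators      *)
(* T k i j for the generators T_ij^(k), subject to the defining relations     *)
(* (k = 0 is the normalization T_ij^(0) = delta_ij).                          *)
Definition Yangian_rep (T : nat -> M1) : Prop :=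
  T 0%N = 1 /\
  smul2 Rser (smul2 (in1 T) (in2 T)) =2 smul2 (smul2 (in2 T) (in1 T)) Rser.

Definition XYangian_rep (S : nat -> M1) : Prop :=
  S 0%N = 1 /\
  smul2 Rser (smul2 (in1 S) (smul2 R'ser (in2 S))) =2
  smul2 (in2 S) (smul2 R'ser (smul2 (in1 S) Rser)).

(* t applied to the matrix factor: sum of e_ij^t (x) X_ij *)
Definition tr_t1 (X : M1) : M1 :=
  \sum_i \sum_j map_mx (fun c : C => c *: X i j) (tr_t (delta_mx i j)).

(* T^t(-u) T(u) *)
Definition X_of_Y (T : nat -> M1) : nat -> M1 :=
  smul (fun k => (-1) ^+ k * tr_t1 (T k)) T.

Definition stable (T : nat -> M1) (U : {vspace W}) : Prop :=
  forall k i j, (T k i j @: U <= U)%VS.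

(* V, with the restricted action, is an irreducible X(g_N)-module.            *)
Definition X_irreducible (S : nat -> M1) (V : {vspace W}) : Prop :=
  [/\ XYangian_rep S, stable S V, V != 0%VS &
      forall U : {vspace W}, (U <= V)%VS -> stable S U -> U = 0%VS \/ U = V].

End Yangian.

Section FusionModule.
Variables (C : fieldType) (N : nat).

(* 1 - P_0p / (u - a) = 1 - sum_(k >= 1) a^(k-1) u^-k P_0p *)
Definition Rcheck0 (J : finType) (p : J) (a : C) (k : nat) :
    'M[endo (tpow C N J)]_N :=
  if k is k'.+1 then \matrix_(i, j) (- a ^+ k' *: site p (delta_mx j i)) else 1.

Definition fusion_T (l : nat) (w : 'I_l -> skew_diagram) (z : 'I_l -> C) :
    nat -> 'M[endo (tpow C N {j : 'I_l & 'I_(nbox (w j))})]_N :=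
  \big[@smul _/@sone _]_(j < l) \big[@smul _/@sone _]_(p < nbox (w j))
    Rcheck0 (Tagged (fun j => 'I_(nbox (w j))) p) (z j + content C p).

End FusionModule.

Definition algebraic_set (C : fieldType) (l : nat) (D : ('I_l -> C) -> Prop) :
    Prop :=
  exists I : {mpoly C[l]} -> Prop,
  forall z, D z <-> (forall f, I f -> f.@[z] = 0).

(* Main.v *)
(* The operator F onto the tensor product V of the V_(omega_j) satisfies T(u) F = F T'(u), so
   that V is stable. Say that an algebra B of operators is full if every F X F is of the form
   b F with b in B; then V is irreducible under B. For one skew diagram and the algebra
   generated by T(u), fullness is proved by induction on the boxes: taking the residue of T(u)
   at the content of a new box, whose R-matrix degenerates there to a flip, gives the box its
   own copy of End(C^N). For S(u) = T^t(-u) T(u) put z_j = zeta_j / e with distinct zeta_j > 0.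
   After scaling, the coefficients of S(w + zeta_j / e) are polynomials in e, and at e = 0 only
   the R-matrices of T(w) on the block j survive; so the limit algebra is full. Fullness is an
   open condition, given by the nonvanishing of a determinant which is polynomial in e, and
   then in z. So it holds for some e <> 0, and then off a proper algebraic set. *)
From HB Require Import structures.
Require Import Defs.
From mathcomp Require Import all_boot all_order all_fingroup all_algebra.
From mathcomp Require Import reals complex.
From mathcomp Require Import ring zify boolp.
From mathcomp.multinomials Require Import mpoly.

Set Implicit Arguments.
Unset Strict Implicit.
Unset Printing Implicit Defensive.

Import GRing.Theory Num.Theory.
Local Open Scope ring_scope.

(** Contents repeat along diagonals, so at the point of contents the R-matrices that define F have
    poles, and so does T(u) on the remaining boxes at the content of a new one. On operators
    antisymmetric in a column, the factors of that column combine into a single factor whose only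
    pole is at the content of its top box, and this content exceeds those of all boxes in earlier
    columns by a positive integer. Hence F is a product of regular factors, the residue isolating a
    new box exists, and the same positivity gives F <> 0. Identities are proved for pairwise
    distinct parameters, on a line through the contents inside the affine subspace of the fusion
    procedure, and are carried to the contents by polynomial interpolation; no limit is taken.
    Fullness is stated with F X F because F is not a projection: the relation b F = F X F passes
    through the induction on boxes and through products of blocks without any splitting of V. The
    zeta_j are positive because T^t(-u) contributes the scalars zeta_j + zeta_k to the limit, k = j
    included; these must not vanish. *)

Lemma comm_prod (A : pzRingType) (I : eqType) (r : seq I) (f : I -> A) x :
  (forall i, i \in r -> x * f i = f i * x) -> x * \prod_(i <- r) f i = \prod_(i <- r) f i * x.
Proof.
move=> H; rewrite big_seq; apply: (big_ind (fun z => x * z = z * x)) => //.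
  by rewrite mulr1 mul1r.
by move=> z1 z2 H1 H2; rewrite mulrA H1 -!mulrA H2.
Qed.

(** * Exchange relations for products of linear forms *)

Section Exchange.
Variables (K : comNzRingType) (E : pzRingType) (ka : {rmorphism K -> E}).
Hypothesis kaC : forall c x, ka c * x = x * ka c.

Let kaM c d x y : (ka c * x) * (ka d * y) = ka (c * d) * (x * y).
Proof. by rewrite -mulrA [x * (_ * _)]mulrA -(kaC d x) rmorphM !mulrA. Qed.

(** The relations of Yang-Baxter type used below take this shape once denominators are cleared. In
    the two expansions the terms of degree at most one agree, the quadratic terms agree by the first
    hypothesis and the cubic ones by the second. *)
Lemma exchange3 (a a' b b' d d' : K) (A B D : E) :
  ka (a' * b' * d) * (A * B - B * A) + ka (a' * b * d') * (A * D - D * A)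
    + ka (a * b' * d') * (B * D - D * B) = 0 ->
  A * B * D = D * B * A ->
  (ka a + ka a' * A) * ((ka b + ka b' * B) * (ka d + ka d' * D)) =
  (ka d + ka d' * D) * ((ka b + ka b' * B) * (ka a + ka a' * A)).
Proof.
move=> H1 H3.
have exp3 (x x' y y' z z' : K) (X Y Z : E) :
  (ka x + ka x' * X) * ((ka y + ka y' * Y) * (ka z + ka z' * Z)) =
  (ka (x * (y * z)) + ka (x' * (y * z)) * X + ka (x * (y' * z)) * Y
    + ka (x * (y * z')) * Z) + (ka (x' * (y' * z)) * (X * Y)
    + ka (x' * (y * z')) * (X * Z) + ka (x * (y' * z')) * (Y * Z))
    + ka (x' * (y' * z')) * (X * Y * Z).
  rewrite -[ka x]mulr1 -[ka y]mulr1 -[ka z]mulr1 -[X in X + _ * _ + _ * Y]mulr1.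
  rewrite !mulrDl !mulrDr !kaM ?mulr1 ?mul1r ?mulrA ?addrA.
  by rewrite [LHS](ACl (1*5*3*2*7*6*4*8)).
have H2 : ka (a' * (b' * d)) * (A * B) + ka (a' * (b * d')) * (A * D)
    + ka (a * (b' * d')) * (B * D) = ka (a' * (b' * d)) * (B * A)
    + ka (a' * (b * d')) * (D * A) + ka (a * (b' * d')) * (D * B).
  rewrite !mulrA; apply/eqP; rewrite -subr_eq0; apply/eqP; rewrite -[RHS]H1.
  by rewrite !mulrBr !mulrA !opprD !addrA [LHS](ACl (1*4*2*5*3*6)).
rewrite !exp3 H2 H3; congr (_ + _ + _).
  rewrite -!addrA; congr (ka _ + _); first by ring.
  rewrite !addrA [RHS](ACl (3*2*1)) /=.
  by congr (ka _ * _ + ka _ * _ + ka _ * _); ring.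
  rewrite [RHS](ACl (3*2*1)) /=.
  by congr (ka _ * _ + ka _ * _ + ka _ * _); ring.
by congr (ka _ * _); ring.
Qed.

(* The three relations between transpositions P12, P13, P23 in the braid form, *)
(* and the two forms that they take after partial transposition.               *)
Lemma exchange_braid (a a' b b' d d' : K) (A B D : E) :
  A * B = D * A -> B * D = D * A -> B * A = A * D -> D * B = A * D ->
  D * D = 1 -> a * b' * d' + a' * b' * d = a' * b * d' ->
  (ka a + ka a' * A) * ((ka b + ka b' * B) * (ka d + ka d' * D)) =
  (ka d + ka d' * D) * ((ka b + ka b' * B) * (ka a + ka a' * A)).
Proof.
move=> AB BD BA DB DD H; apply: exchange3; last first.
  by rewrite AB -BD -!mulrA DD mulr1 BA -DB mulrA DD mul1r.
rewrite -H AB BD BA DB -[A * D - D * A]opprB.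
by rewrite rmorphD mulrN mulrDl opprD addrA [LHS](ACl (1*3*2*4)) /= subrr add0r addNr.
Qed.

(** This is the intertwining of two L-operators by an R-matrix: x and y are u minus the two
    parameters, and c is the inverse of the difference of the parameters. *)
Lemma exchange_lop (x y c : K) (A B D : E) :
  A * B = D * A -> B * D = D * A -> B * A = A * D -> D * B = A * D ->
  D * D = 1 -> (y - x) * c = 1 ->
  (ka x - A) * ((ka y - B) * (1 - ka c * D)) = (1 - ka c * D) * ((ka y - B) * (ka x - A)).
Proof.
move=> AB BD BA DB DD H.
rewrite -(mulN1r A) -(mulN1r B) -mulNr -!(rmorphN1 ka) -(rmorphN ka) -(rmorph1 ka).
have H' : y * c = x * c + 1 by rewrite -H; ring.
apply: exchange_braid => //; transitivity (y * c); last by ring.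
by rewrite H'; ring.
Qed.

Lemma exchange_left (a a' b b' d d' : K) (A B D : E) :
  A * B = A * D -> D * B = A * D -> B * A = D * A -> B * D = D * A ->
  D * D = 1 -> a' * b' * d + a' * b * d' = a * b' * d' ->
  (ka a + ka a' * A) * ((ka b + ka b' * B) * (ka d + ka d' * D)) =
  (ka d + ka d' * D) * ((ka b + ka b' * B) * (ka a + ka a' * A)).
Proof.
move=> AB DB BA BD DD H; apply: exchange3; last first.
  by rewrite AB -!mulrA DD mulr1 BA mulrA DD mul1r.
rewrite -H AB BD BA DB -[D * A - A * D]opprB mulrN rmorphD mulrDl.
by rewrite subrr.
Qed.

Lemma exchange_right (a a' b b' d d' : K) (A B D : E) :
  A * B = D * A -> D * B = D * A -> B * A = A * D -> B * D = A * D ->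
  A * A = 1 -> a * b' * d' + a' * b * d' = a' * b' * d ->
  (ka a + ka a' * A) * ((ka b + ka b' * B) * (ka d + ka d' * D)) =
  (ka d + ka d' * D) * ((ka b + ka b' * B) * (ka a + ka a' * A)).
Proof.
move=> AB DB BA BD AA H; apply: exchange3; last first.
  by rewrite -[LHS]mulrA BD mulrA AA mul1r DB -mulrA AA mulr1.
rewrite -H AB BD BA DB -[A * D - D * A]opprB !mulrN rmorphD mulrDl.
by rewrite addrK subrr.
Qed.

End Exchange.

Section ProductExchange.
Variables (E : pzRingType) (I : eqType) (a b : I -> E) (z : E).

(** Since a_q commutes with b_q' for distinct indices, each a_q can be brought next to its own b_q,
    and z passes one pair at a time. *)
Lemma prod_exchange (s : seq I) : uniq s ->
  (forall q, q \in s -> z * (a q * b q) = b q * (a q * z)) ->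
  (forall q q', q \in s -> q' \in s -> q != q' -> a q * b q' = b q' * a q) ->
  z * (\prod_(q <- s) a q * \prod_(q <- s) b q) =
  \prod_(q <- s) b q * (\prod_(q <- s) a q * z).
Proof.
elim: s => [_ _ _|q s IHs /= /andP[qs us] H1 H2]; first by rewrite !big_nil !mul1r mulr1.
have IH : z * (\prod_(q <- s) a q * \prod_(q <- s) b q) =
  \prod_(q <- s) b q * (\prod_(q <- s) a q * z).
  apply: IHs => // [q1 h1|q1 q2 h1 h2]; first by apply: H1; rewrite in_cons h1 orbT.
  by apply: H2; rewrite in_cons ?h1 ?h2 orbT.
have Ca : \prod_(q <- s) a q * b q = b q * \prod_(q <- s) a q.
  symmetry; apply: comm_prod => q' q's; symmetry; apply: H2; rewrite ?mem_head ?in_cons ?q's ?orbT//.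
  by apply: contraNneq qs => <-.
have Cb : a q * \prod_(q <- s) b q = \prod_(q <- s) b q * a q.
  apply: comm_prod => q' q's; apply: H2; rewrite ?mem_head ?in_cons ?q's ?orbT//.
  by apply: contraNneq qs => ->.
rewrite !big_cons -!mulrA (mulrA _ (b q)) Ca -!mulrA.
rewrite (mulrA (a q)) mulrA H1 ?mem_head// -!mulrA IH; congr (_ * _).
by rewrite !mulrA Cb.
Qed.

(** With the a's in reverse order, the pair of the first index encloses z. Once exchanged, b_q moves
    to the far left and a_q to the far right, and the next pair encloses z. *)
Lemma prod_exchange_rev (s : seq I) : uniq s ->
  (forall q, q \in s -> a q * (z * b q) = b q * (z * a q)) ->
  (forall q q', q \in s -> q' \in s -> q != q' -> a q * b q' = b q' * a q) ->
  \prod_(q <- rev s) a q * (z * \prod_(q <- s) b q) =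
  \prod_(q <- s) b q * (z * \prod_(q <- rev s) a q).
Proof.
elim: s => [_ _ _|q s IHs /= /andP[qs us] H1 H2].
  by rewrite !big_nil !mul1r.
have IH : \prod_(q <- rev s) a q * (z * \prod_(q <- s) b q) =
  \prod_(q <- s) b q * (z * \prod_(q <- rev s) a q).
  apply: IHs => // [q1 h1|q1 q2 h1 h2]; first by apply: H1; rewrite in_cons h1 orbT.
  by apply: H2; rewrite in_cons ?h1 ?h2 orbT.
have Ca : \prod_(q <- rev s) a q * b q = b q * \prod_(q <- rev s) a q.
  symmetry; apply: comm_prod => q'; rewrite mem_rev => q's; symmetry.
  apply: H2; rewrite ?mem_head ?in_cons ?q's ?orbT//.
  by apply: contraNneq qs => <-.
have Cb : a q * \prod_(q <- s) b q = \prod_(q <- s) b q * a q.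
  apply: comm_prod => q' q's; apply: H2; rewrite ?mem_head ?in_cons ?q's ?orbT//.
  by apply: contraNneq qs => ->.
rewrite rev_cons -cats1 !big_cat !big_cons !big_nil /= !mulr1 -!mulrA.
rewrite (mulrA z) (mulrA (a q)) H1 ?mem_head// -!mulrA Cb (mulrA _ (b q)) Ca.
rewrite -!mulrA; congr (_ * _); rewrite -[RHS]/(_) !mulrA.
by rewrite -(mulrA _ z) IH !mulrA.
Qed.

End ProductExchange.

(** * Operators on tensor powers *)

Section Endo.
Variables (C : fieldType) (W : vectType C).
Implicit Types (x y : endo W) (c : C).

Lemma endoM x y w : (x * y : 'End(W)) w = x (y w).
Proof. exact: comp_lfunE. Qed.

Lemma endo1 w : (1 : endo W) w = w.
Proof. exact: id_lfunE. Qed.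

Lemma endoZl c x y : (c *: x) * y = c *: (x * y).
Proof. by apply/lfunP => w; rewrite endoM !scale_lfunE endoM. Qed.

Lemma endoZr c x y : x * (c *: y) = c *: (x * y).
Proof. by apply/lfunP => w; rewrite endoM !scale_lfunE linearZ endoM. Qed.

(** Scalars enter the general lemmas through a central ring morphism [ka]. One statement then serves
    End(W), matrices over it, matrices of such matrices, and series. *)
Definition escal_fun c : endo W := c *: (1 : endo W).

Lemma escal_additive : zmod_morphism escal_fun.
Proof. by move=> a b; rewrite /escal_fun scalerBl. Qed.

Lemma escal_multiplicative : monoid_morphism escal_fun.
Proof. by split=> [|a b]; rewrite /escal_fun ?scale1r// endoZl mul1r scalerA. Qed.

HB.instance Definition _ := GRing.isZmodMorphism.Build C (endo W) escal_fun escal_additive.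
HB.instance Definition _ :=
  GRing.isMonoidMorphism.Build C (endo W) escal_fun escal_multiplicative.

Definition escal : {rmorphism C -> endo W} := escal_fun.

Lemma escalE c x : escal c * x = c *: x.
Proof. by rewrite /= /escal_fun endoZl mul1r. Qed.

Lemma escalC c x : escal c * x = x * escal c.
Proof. by rewrite escalE /= /escal_fun endoZr mulr1. Qed.

Variable N : nat.

Definition mscal_fun c : 'M[endo W]_N := (escal c)%:M.

Lemma mscal_additive : zmod_morphism mscal_fun.
Proof. by move=> a b; rewrite /mscal_fun rmorphB raddfB. Qed.

Lemma mscal_multiplicative : monoid_morphism mscal_fun.
Proof. by split=> [|a b]; rewrite /mscal_fun ?rmorph1// rmorphM /= scalar_mxM. Qed.

HB.instance Definition _ := GRing.isZmodMorphism.Build C 'M[endo W]_N mscal_fun mscal_additive.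
HB.instance Definition _ :=
  GRing.isMonoidMorphism.Build C 'M[endo W]_N mscal_fun mscal_multiplicative.

Definition mscal : {rmorphism C -> 'M[endo W]_N} := mscal_fun.

Lemma mscal_def c : mscal c = (escal c)%:M.
Proof. by []. Qed.

Lemma mscalE c (X : 'M[endo W]_N) i j : (mscal c * X) i j = c *: X i j.
Proof. by rewrite mscal_def -mulmxE mul_scalar_mx mxE escalE. Qed.

Lemma smxM (x y : endo W) : (x * y)%:M = x%:M * y%:M :> 'M[endo W]_N.
Proof. by rewrite scalar_mxM. Qed.

Lemma mul_mx_scalarE (X : 'M[endo W]_N) x i j : (X * x%:M) i j = X i j * x.
Proof.
rewrite -mulmxE mxE (bigD1 j)//= big1 ?addr0 => [|k kj]; rewrite !mxE ?eqxx//.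
by rewrite (negPf kj) mulr0.
Qed.

Lemma mul_scalar_mxE (X : 'M[endo W]_N) x i j : (x%:M * X) i j = x * X i j.
Proof. by rewrite -mulmxE mul_scalar_mx mxE. Qed.

Lemma mscalC c (X : 'M[endo W]_N) : mscal c * X = X * mscal c.
Proof.
by apply/matrixP => i j; rewrite mscal_def mul_scalar_mxE mul_mx_scalarE escalC.
Qed.

Lemma mulM1E (X Y : 'M[endo W]_N) i j : (X * Y) i j = \sum_k X i k * Y k j.
Proof. by rewrite -mulmxE mxE. Qed.

End Endo.

Section Sites.
Variables (C : fieldType) (N : nat) (J : finType).
Notation W := (tpow C N J).
Notation site := (@site C N J).
Notation flip := (@flip C N J).
Implicit Types (p q r : J) (A B : 'M[C]_N) (f : {ffun J -> 'I_N}).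

Lemma siteE p A (phi : W) f :
  (site p A phi : {ffun _ -> C^o}) f = \sum_k A (f p) k * phi (upd f p k).
Proof.
pose F (phi : {ffun {ffun J -> 'I_N} -> C^o}) : W :=
  [ffun f : {ffun J -> 'I_N} => \sum_k A (f p) k * phi (upd f p k)].
have lF : linear F.
  move=> c x y; apply/ffunP => g; rewrite !ffunE /GRing.scale /= mulr_sumr -big_split /=.
  by apply: eq_bigr => k _; rewrite !ffunE mulrDr; congr (_ + _); rewrite /GRing.scale /=; ring.
pose FL := GRing.isLinear.Build _ _ _ _ _ lF.
pose FF : {linear W -> W} := HB.pack F FL.
by have /ffunP/(_ f) := lfunE FF phi; rewrite [RHS]ffunE.
Qed.

Lemma flipE p q (phi : W) f :
  (flip p q phi : {ffun _ -> C^o}) f = phi [ffun r => f (tperm p q r)].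
Proof.
pose F (phi : {ffun {ffun J -> 'I_N} -> C^o}) : W :=
  [ffun f : {ffun J -> 'I_N} => phi [ffun r => f (tperm p q r)]].
have lF : linear F.
  by move=> c x y; apply/ffunP => g; rewrite !ffunE.
pose FL := GRing.isLinear.Build _ _ _ _ _ lF.
pose FF : {linear W -> W} := HB.pack F FL.
by have /ffunP/(_ f) := lfunE FF phi; rewrite [RHS]ffunE.
Qed.

Lemma endoP (x y : endo W) :
  (forall (phi : W) f, (x phi : {ffun _ -> C^o}) f = (y phi : {ffun _ -> C^o}) f) -> x = y.
Proof. by move=> H; apply/lfunP => phi; apply/ffunP => f; apply: H. Qed.

Lemma flip2 p q : flip p q * flip p q = 1.
Proof.
apply: endoP => phi f; rewrite endoM endo1 !flipE; congr (phi _).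
by apply/ffunP => r; rewrite !ffunE tpermK.
Qed.

Lemma flipC p q : flip p q = flip q p.
Proof.
by apply: endoP => phi f; rewrite !flipE; congr (phi _); apply/ffunP=> r; rewrite !ffunE tpermC.
Qed.

(* Precomposition with permutations reverses products, which exchanges the two sides. *)
Lemma flipJ p q r : p != q -> r != q -> p != r ->
  flip p q * flip p r = flip p r * flip q r.
Proof.
move=> pq rq pr; apply: endoP => phi f; rewrite !endoM !flipE; congr (phi _).
apply/ffunP => k; rewrite !ffunE; congr (f _).
rewrite -!permM; congr ((_ : {perm J}) _).
by rewrite conjgCV tpermV tpermJ tpermL tpermD 1?eq_sym// 1?eq_sym// tpermC.
Qed.

Lemma flip_comm p q r s : p != r -> p != s -> q != r -> q != s ->
  flip p q * flip r s = flip r s * flip p q.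
Proof.
move=> pr ps qr qs; apply: endoP => phi f; rewrite !endoM !flipE; congr (phi _).
apply/ffunP => k; rewrite !ffunE; congr (f _).
rewrite -!permM; congr ((_ : {perm J}) _); apply: commute_sym; apply/commgP/conjg_fixP.
by rewrite tpermJ !tpermD // eq_sym.
Qed.

Lemma siteM p A B : site p A * site p B = site p (A *m B).
Proof.
apply: endoP => phi f; rewrite !endoM !siteE.
under eq_bigr do rewrite siteE mulr_sumr.
rewrite exchange_big /=; apply: eq_bigr => k _.
rewrite mxE mulr_suml; apply: eq_bigr => k' _; rewrite ffunE eqxx mulrA.
by congr (_ * phi _); apply/ffunP => r; rewrite !ffunE; case: eqP.
Qed.

Lemma site1 p : site p 1%:M = 1.
Proof.
apply: endoP => phi f; rewrite siteE endo1 (bigD1 (f p)) //= big1 ?addr0.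
  by rewrite mxE eqxx mul1r; congr (phi _); apply/ffunP => r; rewrite ffunE; case: eqP => // ->.
by move=> k kf; rewrite mxE eq_sym (negPf kf) mul0r.
Qed.

Lemma siteC p q A B : p != q -> site p A * site q B = site q B * site p A.
Proof.
move=> pq; apply: endoP => phi f; rewrite !endoM !siteE.
under eq_bigr do rewrite siteE mulr_sumr.
under [RHS]eq_bigr do rewrite siteE mulr_sumr.
rewrite exchange_big /=; apply: eq_bigr => k _; apply: eq_bigr => k' _.
rewrite !ffunE [q == p]eq_sym (negPf pq) !mulrA [A _ _ * _]mulrC.
congr (_ * phi _); apply/ffunP => r; rewrite !ffunE.
by case: eqP => // ->; rewrite eq_sym (negPf pq).
Qed.

Lemma site_linear p : linear (site p).
Proof.
move=> c A B; apply: endoP => phi f; rewrite add_lfunE scale_lfunE siteE !ffunE !siteE.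
rewrite /GRing.scale /= mulr_sumr -big_split /=; apply: eq_bigr => k _.
by rewrite !mxE; ring.
Qed.

HB.instance Definition _ p :=
  GRing.isLinear.Build C 'M[C]_N (endo W) _ (site p) (site_linear p).

Lemma flip_site p q A : flip p q * site p A = site q A * flip p q.
Proof.
apply: endoP => phi f; rewrite !endoM flipE !siteE; apply: eq_bigr => k _.
rewrite flipE ffunE tpermL; congr (_ * phi _); apply/ffunP => r; rewrite !ffunE.
by rewrite -[r == p](inj_eq (@perm_inj _ (tperm p q))) tpermL.
Qed.

Lemma flip_siteC p q r A : r != p -> r != q -> flip p q * site r A = site r A * flip p q.
Proof.
move=> rp rq; apply: endoP => phi f; rewrite !endoM flipE !siteE; apply: eq_bigr => k _.
rewrite flipE ffunE tpermD 1?eq_sym//; congr (_ * phi _); apply/ffunP => s; rewrite !ffunE.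
by rewrite -[s == r](inj_eq (@perm_inj _ (tperm p q))) [tperm p q r]tpermD 1?eq_sym.
Qed.

Lemma endo_sumE I (r : seq I) (P : pred I) (x : I -> endo W) (phi : W) f :
  ((\sum_(i <- r | P i) x i) phi : {ffun _ -> C^o}) f =
  \sum_(i <- r | P i) (x i phi : {ffun _ -> C^o}) f.
Proof. by rewrite sum_lfunE sum_ffunE. Qed.

Lemma site_deltaE p k l (phi : W) f :
  (site p (delta_mx k l) phi : {ffun _ -> C^o}) f = (f p == k)%:R * phi (upd f p l).
Proof.
rewrite siteE (bigD1 l) //= big1 ?addr0 => [|m ml]; first by rewrite mxE eqxx andbT.
by rewrite mxE (negPf ml) andbF mul0r.
Qed.

Lemma flip_sum p q : p != q ->
  flip p q = \sum_k \sum_l site p (delta_mx k l) * site q (delta_mx l k).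
Proof.
move=> pq; apply: endoP => phi f; rewrite flipE endo_sumE.
have term k l : (site p (delta_mx k l) * site q (delta_mx l k) : endo W) phi f =
    ((f p == k) && (f q == l))%:R * phi (upd (upd f p l) q k).
  by rewrite endoM !site_deltaE ffunE [q == p]eq_sym (negPf pq) mulrA -natrM mulnb.
under eq_bigr do (rewrite endo_sumE; under eq_bigr do rewrite term).
rewrite (bigD1 (f p)) //= [X in _ + X]big1 ?addr0 => [|k kf]; last first.
  by rewrite big1// => l _; rewrite eq_sym (negPf kf) mul0r.
rewrite (bigD1 (f q)) //= [X in _ + X]big1 ?addr0 => [|l lf]; last first.
  by rewrite [f q == l]eq_sym (negPf lf) andbF mul0r.
rewrite !eqxx mul1r; congr (phi _); apply/ffunP => r.
by rewrite !ffunE; case: tpermP => [->|->|/eqP/negPf-> /eqP/negPf->//];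
  rewrite ?eqxx// (negPf pq).
Qed.

Notation E1 := 'M[endo W]_N.

(** The flip P_{0p} of the auxiliary factor with the site p, that is, the sum of the e_ij (x) e_ji
    with e_ji acting at p. *)
Definition P0 p : E1 := \matrix_(i, j) site p (delta_mx j i).

Lemma P0P0 p : P0 p * P0 p = 1.
Proof.
apply/matrixP => i j; rewrite mulM1E !mxE.
under eq_bigr do rewrite !mxE siteM.
rewrite -linear_sum /=; case: eqP => [<-|/eqP ij]; last first.
  rewrite big1 ?linear0// => k _; rewrite mul_delta_mx_cond.
  by rewrite (negPf ij).
rewrite -(site1 p); congr (site p _); rewrite [RHS]mx1_sum_delta; apply: eq_bigr => k _.
by rewrite mul_delta_mx.
Qed.

Lemma P0_flip p q : p != q -> P0 p * P0 q = P0 q * (flip p q)%:M.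
Proof.
move=> pq; apply/matrixP => i j; rewrite mul_mx_scalarE mulM1E !mxE flip_sum // mulr_sumr.
apply: eq_bigr => k _; rewrite !mxE mulr_sumr (bigD1 i) //= big1 ?addr0 => [|l li].
  by rewrite [RHS]mulrA -(siteC _ (delta_mx j i) pq) -mulrA siteM mul_delta_mx.
rewrite mulrA -(siteC _ (delta_mx j i) pq) -mulrA siteM mul_delta_mx_cond eq_sym (negPf li).
by rewrite mulr0n linear0 mulr0.
Qed.

Lemma flip_P0 p q : (flip p q)%:M * P0 p = P0 q * (flip p q)%:M.
Proof.
by apply/matrixP => i j; rewrite mul_mx_scalarE mul_scalar_mxE !mxE flip_site.
Qed.

Lemma flip_P0C p q r : r != p -> r != q -> (flip p q)%:M * P0 r = P0 r * (flip p q)%:M.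
Proof.
move=> rp rq.
by apply/matrixP => i j; rewrite mul_mx_scalarE mul_scalar_mxE !mxE flip_siteC.
Qed.

End Sites.

(** * The fusion procedure *)

Section Columns.
Variables (C : fieldType) (I : eqType).
Implicit Types (v : I -> C) (b : seq I).

Definition top v b : C := if b is q :: _ then v q else 0.
Definition column v b := sorted (fun p q => v q == v p - 1) b.

End Columns.

Section Fuse.
Variables (C : fieldType) (E : pzRingType) (ka : {rmorphism C -> E}) (I : eqType).
Hypothesis kaC : forall c x, ka c * x = x * ka c.
Variables (v : I -> C) (S : {pred I}) (a : I -> E) (t : I -> I -> E).
Hypothesis aJ : forall q r, q \in S -> r \in S -> q != r -> a q * a r = a r * t q r.
Hypothesis aC : forall q r s, q \in S -> r \in S -> s \in S -> s != q -> s != r ->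
  t q r * a s = a s * t q r.
Implicit Types (b : seq I) (bs : seq (seq I)) (u : C) (z : E).

Definition antisym b z := forall q r, q \in b -> r \in b -> q != r -> t q r * z = - z.

(** Antisymmetry turns a_q a_r z into - a_r z, so that the sum A of the already fused tail satisfies
    a_q A z = - A z. Hence A z appears with coefficients 1/(u - v_r) and 1/((u - v_q)(u - v_r)),
    where r is the box below q. As v_r = v_q - 1, they add up to 1/(u - v_q): the pole moves up to
    the top box. *)
Lemma fuse b u z : {subset b <= S} -> uniq b -> column v b ->
  (forall q, q \in b -> u != v q) -> antisym b z ->
  \prod_(q <- b) (1 - ka (u - v q)^-1 * a q) * z =
  (1 - ka (u - top v b)^-1 * \sum_(q <- b) a q) * z.
Proof.
elim: b => [|q b IHb] bS; first by rewrite !big_nil mulr0 subr0.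
rewrite /= => /andP[qb ub] vb uv az.
have qS : q \in S by apply: bS; rewrite mem_head.
have {}IHb : \prod_(q <- b) (1 - ka (u - v q)^-1 * a q) * z =
             (1 - ka (u - top v b)^-1 * \sum_(q <- b) a q) * z.
  apply: IHb => //.
  - by move=> r rb; apply: bS; rewrite in_cons rb orbT.
  - by case: b vb {bS qb ub uv az} => //= r b /andP[].
  - by move=> r rb; apply: uv; rewrite in_cons rb orbT.
  - by move=> r s rb sb; apply: az; rewrite in_cons ?rb ?sb orbT.
rewrite !big_cons -mulrA IHb.
have anti : a q * ((\sum_(q <- b) a q) * z) = - ((\sum_(q <- b) a q) * z).
  rewrite mulrA mulr_sumr mulr_suml mulr_suml -sumrN big_seq [RHS]big_seq.
  apply: eq_bigr => r rb; have qr : q != r by apply: contraNneq qb => ->.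
  have rS : r \in S by apply: bS; rewrite in_cons rb orbT.
  by rewrite aJ // -mulrA az ?mem_head ?in_cons ?rb ?orbT// mulrN.
case: b => [|r b] in vb uv az anti qb ub {IHb bS} *.
  by rewrite !big_nil /= mulr0 subr0 mul1r addr0.
have /andP[/eqP vr _] := vb.
rewrite [top v _]/= [X in _ = (1 - ka (u - X)^-1 * _) * _]/= in anti *.
set A := \sum_(q <- r :: b) a q in anti *.
rewrite [(1 - _ * A) * z]mulrBl mul1r -(mulrA _ A z) [LHS]mulrBl mul1r -(mulrA _ (a q)).
rewrite (mulrBr (a q)) (mulrA (a q) (ka _)) -(kaC _ (a q)) -(mulrA _ (a q)) anti.
rewrite [RHS]mulrBl mul1r -(mulrA _ _ z) (mulrDl _ _ z) !mulrN opprK !mulrDr opprD.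
rewrite (mulrA (ka _) (ka _)) -rmorphM opprD !addrA [LHS](ACl (1*3*(2*4))) /=.
congr (_ + _); rewrite -opprD -mulrDl -rmorphD.
congr (- (ka _ * _)).
have xq := uv q (mem_head _ _).
have : u != v r by apply: uv; rewrite !in_cons eqxx orbT.
rewrite vr => xr; field; rewrite subr_eq0 xq /=.
by move: xr; rewrite -subr_eq0.
Qed.

Definition fused u b : E := 1 - ka (u - top v b)^-1 * \sum_(q <- b) a q.

Lemma fused_comm u b x : (forall q, q \in b -> x * a q = a q * x) ->
  x * fused u b = fused u b * x.
Proof.
move=> H; rewrite mulrBr mulrBl mul1r mulr1; congr (_ - _).
rewrite mulrA -kaC -!mulrA; congr (_ * _).
by rewrite mulr_sumr mulr_suml big_seq [RHS]big_seq; apply: eq_bigr.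
Qed.

(** Columns are fused from the last to the first. The fused factors of the later columns commute
    with the t q r of an earlier one, so what stands to the right of each column remains
    antisymmetric in it. *)
Lemma fuse_columns bs u z : {subset flatten bs <= S} -> uniq (flatten bs) ->
  {in bs, forall b, column v b} -> (forall q, q \in flatten bs -> u != v q) ->
  {in bs, forall b, antisym b z} ->
  \prod_(q <- flatten bs) (1 - ka (u - v q)^-1 * a q) * z =
  \prod_(b <- bs) fused u b * z.
Proof.
elim: bs z => [|b bs IHbs] z sS; first by rewrite !big_nil.
rewrite /= cat_uniq => /and3P[ub /hasPn bbs ubs] cb uv az.
rewrite big_cat big_cons /= -!mulrA.
have -> : \prod_(q <- flatten bs) (1 - ka (u - v q)^-1 * a q) * z =
          \prod_(b <- bs) fused u b * z.
  apply: IHbs => //.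
  - by move=> q qbs; apply: sS; rewrite /= mem_cat qbs orbT.
  - by move=> b' b'bs; apply: cb; rewrite in_cons b'bs orbT.
  - by move=> q qbs; apply: uv; rewrite mem_cat qbs orbT.
  - by move=> b' b'bs; apply: az; rewrite in_cons b'bs orbT.
apply: fuse => //.
- by move=> q qb; apply: sS; rewrite /= mem_cat qb.
- by apply: cb; rewrite mem_head.
- by move=> q qb; apply: uv; rewrite mem_cat qb.
move=> q r qb rb qr.
suff H : t q r * \prod_(j <- bs) fused u j = \prod_(j <- bs) fused u j * t q r.
  by rewrite mulrA H -mulrA (az b (mem_head _ _) q r) // mulrN.
have qS : q \in S by apply: sS; rewrite /= mem_cat qb.
have rS : r \in S by apply: sS; rewrite /= mem_cat rb.
have bS : {subset flatten bs <= S}.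
  by move=> s sb; apply: sS; rewrite /= mem_cat sb orbT.
elim: bs bbs bS {IHbs sS ubs cb uv az} => [|b' bs IH] bbs bS.
  by rewrite big_nil mulr1 mul1r.
rewrite big_cons mulrA fused_comm => [|s sb].
  rewrite -mulrA IH ?mulrA// => s sb; last by apply: bS; rewrite /= mem_cat sb orbT.
  by apply: bbs; rewrite /= mem_cat sb orbT.
apply: aC => //; first by apply: bS; rewrite /= mem_cat sb.
  by apply: contraTneq qb => <-; apply: bbs; rewrite /= mem_cat sb.
by apply: contraTneq rb => <-; apply: bbs; rewrite /= mem_cat sb.
Qed.

End Fuse.

Section FusionProcedure.
Variables (C : fieldType) (E : pzRingType) (ka : {rmorphism C -> E}) (J : eqType).
Hypothesis kaC : forall c x, ka c * x = x * ka c.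
Variable t : J -> J -> E.
Implicit Types (p q r : J) (v : J -> C) (s b : seq J) (bs : seq (seq J)).

Definition Rv v p q : E := 1 - ka (v p - v q)^-1 * t p q.

Fixpoint Rprod v s : E :=
  if s is p :: s' then \prod_(q <- s') Rv v p q * Rprod v s' else 1.

(* By antisymmetry in each later column b, its factors 1 - t p q / (v p - v q) combine into *)
(* a single one, whose pole is at v p = v (top b). The contents avoid these poles.          *)
Fixpoint Rfused_column v b bs (x : E) : E :=
  if b is p :: b' then
    \prod_(q <- b') Rv v p q * \prod_(b <- bs) fused ka v (t p) (v p) b * Rfused_column v b' bs x
  else x.

Fixpoint Rfused v bs : E := if bs is b :: bs' then Rfused_column v b bs' (Rfused v bs') else 1.

Hypothesis t2 : forall p q, p != q -> t p q * t p q = 1.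
Hypothesis tS : forall p q, t p q = t q p.
Hypothesis tJ : forall p q r, p != q -> p != r -> q != r -> t p q * t p r = t p r * t q r.
Hypothesis tC : forall p q r (s : J), p != r -> p != s -> q != r -> q != s ->
  t p q * t r s = t r s * t p q.

Section RTT.
Variable P : J -> E.
Hypothesis PJ : forall q r, q != r -> P q * P r = P r * t q r.
Hypothesis tP : forall q r, q != r -> t q r * P q = P r * t q r.
Hypothesis tPC : forall q r (s : J), s != q -> s != r -> t q r * P s = P s * t q r.

(** The factor 1 - P_{0q}/(u - v_q) of T(u) with its denominator cleared. *)
Definition lop v (u : C) q : E := ka (u - v q) - P q.

Lemma prod_lop v u s : (forall q, q \in s -> u != v q) ->
  \prod_(q <- s) (1 - ka (u - v q)^-1 * P q) =
  ka (\prod_(q <- s) (u - v q)^-1) * \prod_(q <- s) lop v u q.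
Proof.
elim: s => [|q s IHs] us; first by rewrite !big_nil rmorph1 mulr1.
rewrite !big_cons IHs => [|r rs]; last by apply: us; rewrite in_cons rs orbT.
have uq : u - v q != 0 by rewrite subr_eq0 us ?mem_head.
rewrite [LHS]mulrA -kaC -[LHS]mulrA rmorphM [ka _ * ka _]kaC -!mulrA; congr (_ * _).
by rewrite [RHS]mulrA; congr (_ * _); rewrite mulrBr -rmorphM mulVf // rmorph1.
Qed.

Lemma lop_exchange v u s p : uniq (p :: s) -> {in p :: s &, injective v} ->
  lop v u p * (\prod_(q <- s) lop v u q * \prod_(q <- s) Rv v p q) =
  \prod_(q <- s) Rv v p q * (\prod_(q <- s) lop v u q * lop v u p).
Proof.
rewrite /= => /andP[ps us] vi; apply: prod_exchange => // q.
  move=> qs; have pq : p != q by apply: contraNneq ps => ->.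
  have vpq : v p - v q != 0.
    rewrite subr_eq0; apply: contraNneq pq => /vi->//; rewrite ?mem_head//.
    by rewrite in_cons qs orbT.
  apply: (exchange_lop kaC).
  - by rewrite PJ // tP.
  - by rewrite tP.
  - by rewrite PJ 1?eq_sym// tS.
  - by rewrite [t p q]tS tP 1?eq_sym.
  - by rewrite t2.
  - by field.
move=> r qs rs qr; rewrite /lop /Rv mulrBr [RHS]mulrBl mulr1 mul1r; congr (_ - _).
have tc : P q * t p r = t p r * P q.
  by rewrite tPC // eq_sym; apply: contraNneq ps => ->.
have tcl : (ka (u - v q) - P q) * t p r = t p r * (ka (u - v q) - P q).
  by rewrite mulrBl mulrBr tc kaC.
by rewrite mulrA -kaC -mulrA tcl mulrA.
Qed.

(** The R-matrices that start at p carry the L-operator of p across those of all later boxes; it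
    then commutes with the R-matrices among the later boxes. Reversing the order in this way is what
    makes the image of [Rprod] stable under T(u). *)
Lemma rtt_Rprod v u s : uniq s -> {in s &, injective v} ->
  \prod_(q <- s) lop v u q * Rprod v s = Rprod v s * \prod_(q <- rev s) lop v u q.
Proof.
elim: s => [|p s IHs] us vi; first by rewrite !big_nil.
have /= /andP[ps us'] := us.
have {}IHs := IHs us' (sub_in2 (fun q => @mem_behead _ (p :: s) q) vi).
rewrite /= rev_cons -cats1 big_cat big_cons big_seq1 /=.
have Hc : lop v u p * Rprod v s = Rprod v s * lop v u p.
  have {}ps q : q \in s -> p != q by move=> qs; apply: contraNneq ps => ->.
  elim: s ps {us us' vi IHs} => [|q s IH] ps; first by rewrite mulr1 mul1r.
  rewrite /= mulrA -[RHS]mulrA -IH => [|r rs]; last by apply: ps; rewrite in_cons rs orbT.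
  rewrite [RHS]mulrA; congr (_ * _).
  rewrite big_seq; apply: (big_ind (fun x => lop v u p * x = x * lop v u p)).
  - by rewrite mulr1 mul1r.
  - by move=> x y Hx Hy; rewrite mulrA Hx -!mulrA Hy.
  move=> r rs; rewrite /lop /Rv mulrBr [RHS]mulrBl mulr1 mul1r; congr (_ - _).
  have tc : P p * t q r = t q r * P p.
    by rewrite tPC // ps // in_cons ?eqxx ?rs ?orbT.
  have tcl : (ka (u - v p) - P p) * t q r = t q r * (ka (u - v p) - P p).
    by rewrite mulrBl mulrBr tc kaC.
  by rewrite mulrA -kaC -mulrA tcl mulrA.
rewrite -!mulrA (mulrA (\prod_(q <- s) lop v u q)) mulrA (lop_exchange u us vi).
by rewrite -!mulrA Hc (mulrA (\prod_(q <- s) lop v u q)) IHs !mulrA.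
Qed.

End RTT.

(** For neighbours with v p - v q = 1 the factor of the pair is 1 - t, and t (1 - t) = - (1 - t)
    because t is an involution. A box r standing before p contributes its factors with p and q,
    which [fuse] applied to the column p, q replaces by one factor symmetric in p and q; this
    commutes with t p q, as do the factors of r with the other boxes. *)
Lemma antisym_Rprod v s1 s2 p q : p != q -> v p - v q = 1 ->
  uniq (s1 ++ [:: p, q & s2]) -> {in s1 ++ [:: p, q & s2] &, injective v} ->
  t p q * Rprod v (s1 ++ [:: p, q & s2]) = - Rprod v (s1 ++ [:: p, q & s2]).
Proof.
move=> pq vpq; have tRv : t p q * Rv v p q = - Rv v p q.
  by rewrite /Rv vpq invr1 rmorph1 mul1r mulrBr t2 // mulr1 opprB.
elim: s1 => [|r s1 IHs1] us vi.
  by rewrite /= big_cons -!mulrA mulrA tRv mulNr.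
have {}IHs1 : t p q * Rprod v (s1 ++ [:: p, q & s2]) = - Rprod v (s1 ++ [:: p, q & s2]).
  apply: IHs1; first by case/andP: us.
  by apply: sub_in2 vi => x xs; rewrite /= in_cons xs orbT.
rewrite /= big_cat !big_cons /=.
set Z := Rprod v _ in IHs1 *.
have rs x : x \in s1 ++ [:: p, q & s2] -> r != x.
  by move=> xs; case/andP: us => + _; apply: contraNneq => ->.
have rp : r != p by apply: rs; rewrite mem_cat mem_head orbT.
have rq : r != q by apply: rs; rewrite mem_cat !in_cons eqxx !orbT.
have s1pq x : x \in s1 -> (x != p) && (x != q).
  move=> xs1; move: us; rewrite /= cat_uniq => /and3P[_ _ /andP[/hasPn H _]].
  by apply/andP; split; apply: contraTneq xs1 => ->; apply: H; rewrite !in_cons eqxx ?orbT.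
have s2pq x : x \in s2 -> (x != p) && (x != q).
  move=> xs2; move: us; rewrite /= cat_uniq => /and4P[_ _ _ /=].
  rewrite in_cons negb_or => /andP[/andP[_ ps2] /andP[qs2 _]].
  by apply/andP; split; apply: contraTneq xs2 => ->.
have tprod s : {in s, forall x, (x != p) && (x != q)} ->
    t p q * \prod_(x <- s) Rv v r x = \prod_(x <- s) Rv v r x * t p q.
  move=> H; rewrite big_seq; apply: (big_ind (fun x => t p q * x = x * t p q)).
  - by rewrite mulr1 mul1r.
  - by move=> x y Hx Hy; rewrite mulrA Hx -!mulrA Hy.
  move=> x xs; have /andP[xp xq] := H x xs.
  rewrite mulrBr mulrBl mulr1 mul1r; congr (_ - _).
  by rewrite mulrA -kaC -!mulrA tC // eq_sym.
rewrite -!mulrA mulrA tprod // -!mulrA; rewrite -mulrN; congr (_ * _).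
set A := \prod_(x <- s2) Rv v r x.
have HA : t p q * (A * Z) = - (A * Z) by rewrite mulrA tprod // -mulrA IHs1 mulrN.
have vr x : x \in s1 ++ [:: p, q & s2] -> v r != v x.
  move=> xs; apply: contraNneq (rs x xs) => /vi->//; rewrite ?mem_head//.
  by rewrite in_cons xs orbT.
have FS : {subset [:: p; q] <= predC1 r}.
  by move=> x; rewrite !inE => /orP[] /eqP->; rewrite eq_sym.
have H := @fuse _ _ ka _ kaC v (predC1 r) (t r) t _ [:: p; q] (v r) (A * Z) FS _ _ _ _.
rewrite !big_cons !big_nil mulr1 addr0 /= -!mulrA in H; rewrite {}H //.
- rewrite mulrA; suff -> : t p q * (1 - ka (v r - v p)^-1 * (t r p + t r q)) =
    (1 - ka (v r - v p)^-1 * (t r p + t r q)) * t p q by rewrite -mulrA HA mulrN.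
  rewrite mulrBr mulrBl mulr1 mul1r; congr (_ - _).
  rewrite mulrA -kaC -!mulrA; congr (_ * _).
  rewrite mulrDr mulrDl addrC; congr (_ + _).
    by rewrite [t r p]tS tJ // eq_sym.
  by rewrite [t r q]tS [X in _ = _ * X]tS tJ 1?[t q p]tS // eq_sym.
- by move=> x y; rewrite !inE => xr yr xy; apply: tJ; rewrite // eq_sym.
- by rewrite /= inE pq.
- by rewrite /column /= andbT; apply/eqP; rewrite -vpq; ring.
- by move=> x; rewrite !inE => /orP[] /eqP->; apply: vr; rewrite mem_cat !in_cons eqxx ?orbT.
- move=> x y; rewrite !inE => /orP[] /eqP-> /orP[] /eqP->; rewrite ?eqxx// => _ //.
  by rewrite tS.
Qed.

Lemma column_tail v q b : column v (q :: b) -> column v b.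
Proof. by case: b => //= r b /andP[]. Qed.

Lemma antisym_column v s1 b s2 : column v b ->
  uniq (s1 ++ b ++ s2) -> {in s1 ++ b ++ s2 &, injective v} ->
  antisym t b (Rprod v (s1 ++ b ++ s2)).
Proof.
elim: b s1 => [|q b IHb] s1 // vb us vi.
set Z := Rprod v _.
have IH : antisym t b Z.
  rewrite /Z -cat_rcons; apply: IHb; rewrite ?cat_rcons//.
  exact: column_tail vb.
have qb : q \notin b.
  by move: us; rewrite cat_uniq => /and3P[_ _ /= /andP[]]; rewrite mem_cat negb_or => /andP[].
suff Hq r : r \in b -> t q r * Z = - Z.
  move=> x y; rewrite !in_cons => /orP[/eqP->|xb] /orP[/eqP->|yb] xy.
  - by rewrite eqxx in xy.
  - exact: Hq.
  - by rewrite tS; apply: Hq.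
  - exact: IH.
case: b vb us vi qb @Z IH {IHb} => // q' b vb us vi qb Z IH.
have qq' : q != q' by move: qb; rewrite in_cons negb_or => /andP[].
have Hq' : t q q' * Z = - Z.
  apply: antisym_Rprod => //; move: vb; rewrite /column /= => /andP[/eqP-> _].
  by ring.
have [->//|rq' rb] := eqVneq r q'.
have qr : q != r by apply: contraNneq qb => ->.
have rqt : t q' q * t q' r = t q' r * t q r by rewrite tJ // eq_sym.
(* The transposition (q r) is conjugate to the neighbour transposition (q' q) by (q' r), and (q' r)
   is covered by the induction on the column. *)
have -> : t q r = t q' r * (t q' q * t q' r) by rewrite rqt mulrA t2 ?mul1r // eq_sym.
have H1 : t q' r * Z = - Z by rewrite IH ?mem_head // eq_sym.
by rewrite -!mulrA H1 mulrN [t q' q]tS Hq' opprK H1.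
Qed.

(** For each p, the product over the remaining boxes is antisymmetric in every later column, so the
    factors of p with those columns can be fused. Distinct parameters are needed for the left side
    only as a product of R-matrices; the right side still makes sense at the contents. *)
Lemma Rprod_Rfused v bs : uniq (flatten bs) -> {in flatten bs &, injective v} ->
  {in bs, forall b, column v b} -> Rprod v (flatten bs) = Rfused v bs.
Proof.
elim: bs => // b bs IHbs /= us vi cb.
rewrite -{}IHbs; first last.
- by move=> b' b'bs; apply: cb; rewrite in_cons b'bs orbT.
- by apply: sub_in2 vi => x xs; rewrite mem_cat xs orbT.
- by move: us; rewrite cat_uniq => /and3P[].
elim: b us vi {cb}(fun b' b'bs => cb b' (@mem_behead _ (b :: bs) b' b'bs)) => //= p b IHb.
move=> /andP[pb us] vi cb; rewrite -IHb //; last first.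
  by apply: sub_in2 vi => x xs; rewrite in_cons xs orbT.
have pb' x : x \in b ++ flatten bs -> p != x by move=> xs; apply: contraNneq pb => ->.
rewrite big_cat /= -!mulrA; congr (_ * _).
apply: (@fuse_columns _ _ ka _ kaC v (predC1 p)) => //.
- by move=> x y; rewrite !inE => xp yp xy; apply: tJ; rewrite // eq_sym.
- move=> x y r; rewrite !inE => xp yp rp rx ry.
  by apply: tC; rewrite // eq_sym.
- by move=> x xs; rewrite inE eq_sym pb' // mem_cat xs orbT.
- by move: us; rewrite cat_uniq => /and3P[].
- move=> x xs; have xs' : x \in b ++ flatten bs by rewrite mem_cat xs orbT.
  by apply: contraNneq (pb' x xs') => /vi->//; rewrite ?mem_head// in_cons xs' orbT.
move=> b' b'bs; have [bs1 [bs2 def_bs]] : exists bs1 bs2, bs = bs1 ++ b' :: bs2.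
  by case/splitPr: b'bs => bs1 bs2; exists bs1, bs2.
have -> : b ++ flatten bs = (b ++ flatten bs1) ++ b' ++ flatten bs2.
  by rewrite def_bs flatten_cat /= !catA.
have e : (b ++ flatten bs1) ++ b' ++ flatten bs2 = b ++ flatten bs.
  by rewrite def_bs flatten_cat /= !catA.
apply: antisym_column; rewrite ?e; [exact: cb|by []|].
by apply: sub_in2 vi => x xs; rewrite in_cons xs orbT.
Qed.

End FusionProcedure.

(** * Polynomial and rational families *)

Lemma poly_nonroot (C : numFieldType) (d : {poly C}) : d != 0 -> exists w, d.[w] != 0.
Proof.
move=> d0; have := @max_poly_roots _ d [seq k%:R | k <- iota 0 (size d)] d0.
case: (altP (@allP _ (root d) [seq k%:R | k <- iota 0 (size d)])) => [H|/allPn[x _ xr] _].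
  move/(_ isT); rewrite map_inj_uniq ?iota_uniq => [/(_ isT)|]; last first.
    by move=> i j /eqP; rewrite eqr_nat => /eqP.
  by rewrite size_map size_iota ltnn.
by exists x; rewrite -rootE.
Qed.

Section PolynomialFamilies.
Variables (C : numFieldType) (E : pzRingType) (ka : {rmorphism C -> E}).
Hypothesis kaC : forall c x, ka c * x = x * ka c.
Implicit Types (f g : C -> E) (Q : E -> Prop) (d : {poly C}).

Lemma scal_mulCA x a z : x * (ka a * z) = ka a * (x * z).
Proof. by rewrite mulrA -kaC mulrA. Qed.

Lemma scal_elim a x z :
  ka a * (ka a * x - z) + (ka a * z - x) = ka (a ^+ 2 - 1) * x.
Proof. by rewrite mulrBr addrA subrK mulrA -rmorphM -expr2 rmorphB rmorph1 mulrBl mul1r. Qed.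

(** A linear subspace presented as a predicate, so that properties such as being a right multiple of
    F can be interpolated directly. *)
Definition lin_closed Q := Q 0 /\ forall a x y, Q x -> Q y -> Q (ka a * x + y).

Lemma lin_closed_rmul x : lin_closed (fun z => exists y, z = x * y).
Proof.
split; first by exists 0; rewrite mulr0.
move=> a z1 z2 [y1 ->] [y2 ->]; exists (ka a * y1 + y2).
by rewrite mulrDr mulrA kaC -!mulrA kaC.
Qed.

Lemma lin_closed_lmul (Q : E -> Prop) x :
  lin_closed Q -> lin_closed (fun z => exists2 y, Q y & y * x = z).
Proof.
move=> [Q0 QL]; split; first by exists 0; rewrite // mul0r.
move=> a z1 z2 [y1 Q1 <-] [y2 Q2 <-]; exists (ka a * y1 + y2); first exact: QL.
by rewrite mulrDl mulrA.
Qed.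

(** Polynomial functions of degree less than n with coefficients in E, in Horner form; the form
    makes division by u - w an induction. *)
Fixpoint polyn n f : Prop :=
  if n is n'.+1 then exists x g, polyn n' g /\ forall u, f u = x + ka u * g u
  else forall u, f u = 0.

Definition polyf f := exists n, polyn n f.

Lemma polynS n f : polyn n f -> polyn n.+1 f.
Proof.
elim: n f => [|n IHn] f; last by case=> x [g [pg fg]]; exists x, g; split => //; apply: IHn.
by move=> f0; exists 0, (fun=> 0); split=> // u; rewrite mulr0 addr0 f0.
Qed.

Lemma polyn_le m n f : (m <= n)%N -> polyn m f -> polyn n f.
Proof. by move=> /subnK <-; move=> pf; elim: (n - m)%N => // k IH; exact: polynS. Qed.

Lemma polyn_ext n f g : f =1 g -> polyn n f -> polyn n g.
Proof.
case: n => [|n] fg; first by move=> f0 u; rewrite -fg.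
by case=> x [h [ph fh]]; exists x, h; split=> // u; rewrite -fg.
Qed.

Lemma polyf_ext f g : f =1 g -> polyf f -> polyf g.
Proof. by move=> fg [n pf]; exists n; apply: polyn_ext pf. Qed.

Lemma polyn_add n f g : polyn n f -> polyn n g -> polyn n (fun u => f u + g u).
Proof.
elim: n f g => [|n IHn] f g; first by move=> f0 g0 u; rewrite f0 g0 addr0.
move=> [x [f' [pf' ff']]] [y [g' [pg' gg']]]; exists (x + y), (fun u => f' u + g' u).
by split=> [|u]; [apply: IHn | rewrite ff' gg' mulrDr addrACA].
Qed.

Lemma polyn_mull n x f : polyn n f -> polyn n (fun u => x * f u).
Proof.
elim: n f => [|n IHn] f; first by move=> f0 u; rewrite f0 mulr0.
move=> [y [f' [pf' ff']]]; exists (x * y), (fun u => x * f' u); split=> [|u]; first exact: IHn.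
by rewrite ff' mulrDr !mulrA kaC.
Qed.

Lemma polyf_const x : polyf (fun=> x).
Proof. by exists 1%N, x, (fun=> 0); split=> // u; rewrite mulr0 addr0. Qed.

Lemma polyf_add f g : polyf f -> polyf g -> polyf (fun u => f u + g u).
Proof.
move=> [m pf] [n pg]; exists (maxn m n).
by apply: polyn_add; [apply: polyn_le pf; rewrite leq_maxl | apply: polyn_le pg; rewrite leq_maxr].
Qed.

Lemma polyf_mull x f : polyf f -> polyf (fun u => x * f u).
Proof. by move=> [n pf]; exists n; apply: polyn_mull. Qed.

Lemma polyf_shift f : polyf f -> polyf (fun u => ka u * f u).
Proof. by move=> [n pf]; exists n.+1, 0, f; split => // u; rewrite add0r. Qed.

Lemma polyf_mul f g : polyf f -> polyf g -> polyf (fun u => f u * g u).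
Proof.
move=> [n pf] pg; elim: n f pf => [|n IHn] f.
  by move=> f0; exists 0%N => u; rewrite f0 mul0r.
case=> x [f' [pf' ff']].
apply: (@polyf_ext (fun u => x * g u + ka u * (f' u * g u))).
  by move=> u; rewrite ff' mulrDl mulrA.
by apply: polyf_add; [apply: polyf_mull | apply: polyf_shift; apply: IHn].
Qed.

Lemma polyf_prod (I : Type) (s : seq I) (F : I -> C -> E) :
  (forall i, polyf (F i)) -> polyf (fun u => \prod_(i <- s) F i u).
Proof.
move=> pF; elim: s => [|i s IHs].
  by apply: polyf_ext (polyf_const 1) => u; rewrite big_nil.
apply: (@polyf_ext (fun u => F i u * \prod_(i <- s) F i u)).
  by move=> u; rewrite big_cons.
exact: polyf_mul.
Qed.

Lemma polyf_scal (d : {poly C}) : polyf (fun u => ka d.[u]).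
Proof.
elim/poly_ind: d => [|d c IHd].
  by apply: polyf_ext (polyf_const 0) => u; rewrite horner0 rmorph0.
apply: (@polyf_ext (fun u => ka u * ka d.[u] + ka c)).
  by move=> u; rewrite !hornerE rmorphD rmorphM kaC.
by apply: polyf_add; [apply: polyf_shift | apply: polyf_const].
Qed.

Lemma polyf_id : polyf (fun u => ka u).
Proof. by apply: polyf_ext (polyf_scal 'X) => u; rewrite hornerX. Qed.

Lemma polyn_div n f w : polyn n.+1 f ->
  exists2 g, polyn n g & forall u, f u = f w + ka (u - w) * g u.
Proof.
elim: n f => [|n IHn] f [x [f' [pf' ff']]].
  by exists (fun=> 0) => // u; rewrite !ff' !pf' !mulr0 !addr0.
have [g pg fg] := IHn f' pf'.
exists (fun u => f' u + ka w * g u).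
  by apply: polyn_add => //; apply: polyn_mull; apply: polynS.
move=> u; rewrite !ff' -addrA; congr (_ + _).
have H : ka w * f' u = ka w * f' w + ka (u - w) * (ka w * g u).
  by rewrite [in LHS]fg mulrDr !mulrA [ka w * ka _]kaC.
by rewrite mulrDr (addrC (_ * f' u)) addrA -H rmorphB mulrBl addrC subrK.
Qed.

(** This is the substitute for a limit. At a point w with d(w) <> 0, write f(u) = f(w) + (u - w)
    g(u). The quotient g has lower degree and takes values in Q wherever d(u)(u - w) <> 0, hence
    everywhere by induction. *)
Lemma polyf_interp f Q d : lin_closed Q -> d != 0 -> polyf f ->
  (forall u, d.[u] != 0 -> Q (f u)) -> forall u, Q (f u).
Proof.
move=> [Q0 QL] d0 [n pf]; elim: n f d d0 pf => [|n IHn] f d d0 pf Qf u.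
  by rewrite pf.
have [w dw] := poly_nonroot d0.
have [g pg fg] := polyn_div w pf.
have Qg : forall u, Q (g u).
  apply: (IHn g (d * ('X - w%:P))) => [||x] //.
    by rewrite mulf_neq0 // polyXsubC_eq0.
  rewrite !hornerE mulf_eq0 negb_or => /andP[dx xw].
  have -> : g x = ka (x - w)^-1 * f x + (ka (- (x - w)^-1) * f w + 0).
    rewrite addr0 fg mulrDr mulrA -rmorphM mulVf // rmorph1 mul1r rmorphN mulNr.
    by rewrite addrAC subrr add0r.
  by apply: (QL); [apply: Qf | apply: (QL); [apply: Qf|]].
by rewrite fg addrC; apply: QL; [apply: Qg | apply: Qf].
Qed.

(* rational families without a pole at 0 *)
Definition regf f := exists (d : {poly C}) g,
  [/\ d.[0] != 0, polyf g & forall u, d.[u] != 0 -> ka d.[u] * f u = g u].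

Lemma regf_interp f Q d : lin_closed Q -> d != 0 -> regf f ->
  (forall u, d.[u] != 0 -> Q (f u)) -> Q (f 0).
Proof.
move=> QL d0 [e [g [e0 pg fg]]] Qf.
have QZ a x : Q x -> Q (ka a * x) by move=> Qx; rewrite -[_ * _]addr0; by case: QL => Q0; apply.
have -> : f 0 = ka e.[0]^-1 * g 0.
  by rewrite -fg // mulrA -rmorphM mulVf // rmorph1 mul1r.
apply: (QZ); apply: (@polyf_interp g Q (d * e)) => // [|u].
  by rewrite mulf_neq0 //; apply: contraNneq e0 => ->; rewrite horner0.
by rewrite hornerM mulf_eq0 negb_or => /andP[du eu]; rewrite -fg //; exact: QZ (Qf u du).
Qed.

Lemma regf_ext f g : f =1 g -> regf f -> regf g.
Proof. by move=> fg [d [h [d0 ph fh]]]; exists d, h; split=> // u du; rewrite -fg fh. Qed.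

Lemma polyf_reg f : polyf f -> regf f.
Proof.
move=> pf; exists 1, f; split=> // [|u _]; rewrite hornerC ?oner_neq0// rmorph1.
by rewrite mul1r.
Qed.

Lemma regf_add f g : regf f -> regf g -> regf (fun u => f u + g u).
Proof.
move=> [d [f' [d0 pf ff]]] [e [g' [e0 pg gg]]].
exists (d * e), (fun u => ka e.[u] * f' u + ka d.[u] * g' u); split=> [||u].
- by rewrite hornerM mulf_neq0.
- by apply: polyf_add; apply: polyf_mul => //; apply: polyf_scal.
rewrite hornerM mulf_eq0 negb_or => /andP[du eu].
rewrite -ff // -gg // mulrDr rmorphM; congr (_ + _); last by rewrite mulrA.
by rewrite mulrA (kaC e.[u] (ka d.[u])).
Qed.

Lemma regf_mul f g : regf f -> regf g -> regf (fun u => f u * g u).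
Proof.
move=> [d [f' [d0 pf ff]]] [e [g' [e0 pg gg]]].
exists (d * e), (fun u => f' u * g' u); split=> [||u].
- by rewrite hornerM mulf_neq0.
- exact: polyf_mul.
rewrite hornerM mulf_eq0 negb_or => /andP[du eu].
by rewrite -ff // -gg // rmorphM -!mulrA (mulrA (ka e.[u])) (kaC e.[u] (f u)) -!mulrA.
Qed.

Lemma regf_const x : regf (fun=> x).
Proof. exact/polyf_reg/polyf_const. Qed.

Lemma regf_prod (I : eqType) (s : seq I) (F : I -> C -> E) :
  (forall i, i \in s -> regf (F i)) -> regf (fun u => \prod_(i <- s) F i u).
Proof.
elim: s => [|i s IHs] pF.
  by apply: regf_ext (regf_const 1) => u; rewrite big_nil.
apply: (@regf_ext (fun u => F i u * \prod_(i <- s) F i u)).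
  by move=> u; rewrite big_cons.
apply: regf_mul; first by apply: pF; rewrite mem_head.
by apply: IHs => j js; apply: pF; rewrite in_cons js orbT.
Qed.

Lemma regf_inv (a b : C) : a != 0 -> regf (fun u => ka (a + u * b)^-1).
Proof.
move=> a0; exists (a%:P + b *: 'X), (fun=> 1); split=> [||u].
- by rewrite !hornerE ?mulr0 ?addr0.
- exact: polyf_const.
by rewrite !hornerE mulrC => ab; rewrite -rmorphM mulfV // rmorph1.
Qed.

End PolynomialFamilies.

Lemma polyf_map (C : numFieldType) (E F : pzRingType) (ka : {rmorphism C -> E})
    (kb : {rmorphism C -> F}) (phi : E -> F) (f : C -> E) :
  (forall a x y, phi (x + ka a * y) = phi x + kb a * phi y) -> phi 0 = 0 ->
  polyf ka f -> polyf kb (fun u => phi (f u)).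
Proof.
move=> phiL phi0 [n pf]; exists n; elim: n f pf => [|n IHn] f; first by move=> f0 u; rewrite f0.
by move=> [x [g [pg fg]]]; exists (phi x), (fun u => phi (g u)); split=> [|u]; [apply: IHn|rewrite fg].
Qed.

Lemma regf_map (C : numFieldType) (E F : pzRingType) (ka : {rmorphism C -> E})
    (kb : {rmorphism C -> F}) (phi : E -> F) (f : C -> E) :
  (forall a x y, phi (x + ka a * y) = phi x + kb a * phi y) -> phi 0 = 0 ->
  regf ka f -> regf kb (fun u => phi (f u)).
Proof.
move=> phiL phi0 [d [g [d0 pg fg]]]; exists d, (fun u => phi (g u)); split=> [||u du] //.
  exact: polyf_map pg.
by rewrite -fg // -[ka _ * _]add0r phiL phi0 add0r.
Qed.

(** * Fused products on a line through the contents *)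

Section GoodColumns.
Variables (C : numFieldType) (J : eqType) (c y : J -> C).
Implicit Types (p q r : J) (s b : seq J) (bs : seq (seq J)).

(** The positive integer m + 1 serves twice: it keeps c p away from the pole of the factor fused
    over b', and it gives that factor a positive diagonal coefficient in the proof that F does not
    vanish. *)
Fixpoint tops bs : Prop :=
  if bs is b :: bs' then
    (forall p b', p \in b -> b' \in bs' -> exists m : nat, top c b' = c p + m.+1%:R) /\ tops bs'
  else True.

(* c is the content and y the column index: along the line c + e y, the parameters in a *)
(* column keep their differences and those in distinct columns are separated.           *)
Record good bs : Prop := Good {
  good_uniq : uniq (flatten bs);
  good_column : {in bs, forall b, column c b};
  good_const : {in bs, forall b, {in b &, forall p q, y p = y q}};
  good_sep : {in flatten bs &, forall p q, p != q -> (c p != c q) || (y p != y q)};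
  good_tops : tops bs }.

Lemma good_pop bs : good ([::] :: bs) -> good bs.
Proof.
case=> u col const sep [_ top]; split => // b bbs; first by apply: col; rewrite in_cons bbs orbT.
by apply: const; rewrite in_cons bbs orbT.
Qed.

Lemma good_tail p b bs : good ((p :: b) :: bs) -> good (b :: bs).
Proof.
case=> u col const sep [tp top]; split => [||||].
- by case/andP: u.
- move=> b'; rewrite in_cons => /orP[/eqP->|b'bs].
    by apply: (column_tail (q := p)); apply: col; rewrite mem_head.
  by apply: col; rewrite in_cons b'bs orbT.
- move=> b'; rewrite in_cons => /orP[/eqP-> q r qb rb|b'bs].
    by apply: (const (p :: b)); rewrite ?mem_head // in_cons ?qb ?rb orbT.
  by apply: const; rewrite in_cons b'bs orbT.
- by move=> q r qs rs; apply: sep; rewrite /= in_cons ?qs ?rs orbT.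
- by split=> // q b' qb b'bs; apply: tp; rewrite // in_cons qb orbT.
Qed.

Lemma good_top_neq p b bs b' : good ((p :: b) :: bs) -> b' \in bs -> c p != top c b'.
Proof.
case=> _ _ _ _ [H _] b'bs; have [|m ->] := H p b' _ b'bs; first exact: mem_head.
by rewrite -subr_eq0 opprD addNKr oppr_eq0 pnatr_eq0.
Qed.

Lemma good_column_neq p b bs q : good ((p :: b) :: bs) -> q \in b -> c p != c q.
Proof.
case=> /= /andP[pb _] _ const sep _ qb.
have pq : p != q by apply: contraNneq pb => ->; rewrite mem_cat qb.
have yq : y p = y q by apply: (const (p :: b)); rewrite ?mem_head // in_cons qb orbT.
by have := sep p q; rewrite /= mem_head in_cons mem_cat qb orbT yq eqxx orbF; apply.
Qed.

Definition ray (e : C) p := c p + e * y p.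

Lemma ray0 : ray 0 = c.
Proof. by apply: funext => p; rewrite /ray mul0r addr0. Qed.

Lemma top_ray e b : top (ray e) b = top c b + e * top y b.
Proof. by case: b => [|q b] //=; rewrite mulr0 addr0. Qed.

Lemma column_ray e b : column c b -> {in b &, forall p q, y p = y q} -> column (ray e) b.
Proof.
elim: b => [//|q [//|r b] IHb] /andP[/eqP cr cb] yb; apply/andP; split.
  have yqr : y q = y r by apply: yb; rewrite ?mem_head ?in_cons ?eqxx ?orbT.
  by rewrite /ray cr yqr; apply/eqP; ring.
apply: IHb => // p p' pb p'b; apply: yb; by rewrite in_cons ?pb ?p'b orbT.
Qed.

Definition sep_poly s : {poly C} :=
  \prod_(p <- s) \prod_(q <- s | p != q) ((c p - c q)%:P + (y p - y q) *: 'X).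

Lemma sep_polyP s : {in s &, forall p q, p != q -> (c p != c q) || (y p != y q)} ->
  sep_poly s != 0 /\ forall e, (sep_poly s).[e] != 0 -> {in s &, injective (ray e)}.
Proof.
move=> sep; split.
  rewrite prodf_seq_neq0; apply/allP => p ps /=; rewrite prodf_seq_neq0; apply/allP => q qs /=.
  apply/implyP => pq; have := sep p q ps qs pq; rewrite -(subr_eq0 (c p)) -(subr_eq0 (y p)).
  case: (eqVneq (c p - c q) 0) => [-> /= ypq|cpq _].
    by rewrite polyC0 add0r scaler_eq0 polyX_eq0 orbF.
  by apply: contraNneq cpq => /(congr1 (fun d => d.[0])); rewrite !hornerE ?mulr0 ?addr0 => ->.
move=> e; rewrite horner_prod prodf_seq_neq0 => /allP H p q ps qs vpq.
have := H p ps; rewrite /= horner_prod prodf_seq_neq0 => /allP/(_ q qs) /implyP.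
case: eqVneq => // pq /(_ isT); rewrite !hornerE /= => /negP[]; apply/eqP.
have vpq0 : ray e p - ray e q = 0 by rewrite vpq subrr.
by rewrite -[RHS]vpq0 /ray; ring.
Qed.

End GoodColumns.

Section Limit.
Variables (C : numFieldType) (E : pzRingType) (ka : {rmorphism C -> E}) (J : eqType).
Hypothesis kaC : forall c x, ka c * x = x * ka c.
Variables (t : J -> J -> E) (c y : J -> C).
Implicit Types (p q r : J) (s b : seq J) (bs : seq (seq J)).
Notation regf := (regf ka).
Notation ray := (ray c y).

Lemma regf_sub_inv (a b : C) (x : E) : a != 0 -> regf (fun e => 1 - ka (a + e * b)^-1 * x).
Proof.
move=> a0; apply: (@regf_ext _ _ _ (fun e => 1 + ka (a + e * b)^-1 * (- x))).
  by move=> e; rewrite mulrN.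
apply: regf_add => //; first exact: regf_const.
by apply: regf_mul => //; [apply: regf_inv | apply: regf_const].
Qed.

Lemma regf_fused (u w : C) (a : J -> E) b :
  u != top c b -> regf (fun e => fused ka (ray e) a (u + e * w) b).
Proof.
move=> ub; have := @regf_sub_inv (u - top c b) (w - top y b) (\sum_(q <- b) a q) _.
rewrite subr_eq0 => /(_ ub); apply: regf_ext => e; rewrite /fused top_ray.
by congr (1 - ka _^-1 * _); ring.
Qed.

(** Inside a column the differences of parameters are constant along the ray and nonzero; for a
    later column the only pole is at its top box, which [tops] excludes at e = 0. *)
Lemma regf_Rfused bs : good c y bs -> regf (fun e => Rfused ka t (ray e) bs).
Proof.
elim: bs => [_|b bs IHbs]; first exact: regf_const.
elim: b => [/good_pop/IHbs //|p b IHb] gb.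
apply: regf_mul => //; last by apply: IHb; apply: good_tail gb.
apply: regf_mul => //; apply: (regf_prod kaC); last first.
  by move=> b' b'bs; apply: regf_fused; apply: good_top_neq gb b'bs.
move=> q qb.
have ypq : y p = y q.
  by case: gb => _ _ const _ _; apply: (const (p :: b)); rewrite ?mem_head // in_cons qb orbT.
have cpq := good_column_neq gb qb.
have := @regf_sub_inv (c p - c q) 0 (t p q) _; rewrite subr_eq0 => /(_ cpq).
by apply: regf_ext => e; rewrite /Rv /ray ypq; congr (1 - ka _^-1 * _); ring.
Qed.

Hypothesis t2 : forall p q, p != q -> t p q * t p q = 1.
Hypothesis tS : forall p q, t p q = t q p.
Hypothesis tJ : forall p q r, p != q -> p != r -> q != r -> t p q * t p r = t p r * t q r.
Hypothesis tC : forall p q r (s : J), p != r -> p != s -> q != r -> q != s ->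
  t p q * t r s = t r s * t p q.

Lemma Rprod_Rfused_ray bs e : good c y bs -> {in flatten bs &, injective (ray e)} ->
  Rprod ka t (ray e) (flatten bs) = Rfused ka t (ray e) bs.
Proof.
move=> gb vi; apply: Rprod_Rfused => //; first exact: good_uniq gb.
move=> b bbs; apply: column_ray; first exact: good_column gb b bbs.
exact: good_const gb b bbs.
Qed.

Lemma lin_closed_eq0 : lin_closed ka (fun x => x = 0).
Proof. by split=> // a x z -> ->; rewrite mulr0 addr0. Qed.

(** Off the roots of [sep_poly] the parameters are distinct, where [Rfused] equals the product of
    R-matrices and the identity is known. Both sides are regular at e = 0, so interpolation gives it
    at the contents. *)
Lemma antisym_Rfused bs b : good c y bs -> b \in bs -> antisym t b (Rfused ka t c bs).
Proof.
move=> gb bbs p q pb qb pq.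
have [d0 dP] := sep_polyP (good_sep gb).
apply/eqP; rewrite -addr_eq0; apply/eqP; rewrite -(ray0 c y).
apply: (@regf_interp _ _ ka kaC (fun e => t p q * Rfused ka t (ray e) bs + Rfused ka t (ray e) bs)
  _ _ lin_closed_eq0 d0).
  apply: regf_add => //; last exact: regf_Rfused.
  by apply: regf_mul => //; [exact: regf_const | exact: regf_Rfused].
move=> e /dP vi; rewrite -Rprod_Rfused_ray //; apply/eqP; rewrite addr_eq0; apply/eqP.
have [bs1 [bs2 def_bs]] : exists bs1 bs2, bs = bs1 ++ b :: bs2.
  by case/splitPr: bbs => bs1 bs2; exists bs1, bs2.
have e' : flatten bs = flatten bs1 ++ b ++ flatten bs2 by rewrite def_bs flatten_cat.
rewrite e'; apply: (antisym_column kaC) => //; rewrite -?e' //; last exact: good_uniq gb.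
by apply: column_ray; [apply: good_column gb b bbs | apply: good_const gb b bbs].
Qed.

Section RTT.
Variable P : J -> E.
Hypothesis PJ : forall q r, q != r -> P q * P r = P r * t q r.
Hypothesis tP : forall q r, q != r -> t q r * P q = P r * t q r.
Hypothesis tPC : forall q r (s : J), s != q -> s != r -> t q r * P s = P s * t q r.

Lemma rtt_Rfused bs u : good c y bs ->
  \prod_(q <- flatten bs) lop ka P c u q * Rfused ka t c bs =
  Rfused ka t c bs * \prod_(q <- rev (flatten bs)) lop ka P c u q.
Proof.
move=> gb; have [d0 dP] := sep_polyP (good_sep gb).
apply/eqP; rewrite -subr_eq0; apply/eqP; rewrite -(ray0 c y) -mulrN1.
pose f e := \prod_(q <- flatten bs) lop ka P (ray e) u q * Rfused ka t (ray e) bs +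
  Rfused ka t (ray e) bs * \prod_(q <- rev (flatten bs)) lop ka P (ray e) u q * -1.
have rl q : regf (fun e => lop ka P (ray e) u q).
  apply: polyf_reg; apply: (@polyf_ext _ _ _ (fun e => (ka (u - c q) - P q) + ka e * ka (- y q))).
    by move=> e; rewrite -rmorphM addrAC -rmorphD; congr (ka _ - _); rewrite /ray; ring.
  apply: polyf_add; first exact: polyf_const.
  by apply: polyf_shift; apply: polyf_const.
apply: (@regf_interp _ _ ka kaC f _ _ lin_closed_eq0 d0).
  apply: regf_add => //; apply: regf_mul => //.
  - by apply: regf_prod.
  - exact: regf_Rfused.
  - by apply: regf_mul => //; [exact: regf_Rfused | apply: regf_prod].
  - exact: regf_const.
move=> e /dP vi; rewrite /f -Rprod_Rfused_ray // mulrN1 (@rtt_Rprod _ _ ka) ?subrr //.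
exact: good_uniq gb.
Qed.

End RTT.

End Limit.

Section FfMorph.
Variables (C : fieldType) (E E' : pzRingType) (ka : {rmorphism C -> E}) (ka' : {rmorphism C -> E'}).
Variables (J : eqType) (t : J -> J -> E) (t' : J -> J -> E') (phi : {rmorphism E -> E'}).
Hypothesis phi_ka : forall a, phi (ka a) = ka' a.
Hypothesis phi_t : forall p q, phi (t p q) = t' p q.

Lemma fused_morph v (a : J -> E) (a' : J -> E') u b : (forall q, phi (a q) = a' q) ->
  phi (fused ka v a u b) = fused ka' v a' u b.
Proof.
move=> phi_a; rewrite rmorphB rmorph1 rmorphM phi_ka rmorph_sum.
by under eq_bigr do rewrite phi_a.
Qed.

Lemma Rfused_morph v bs : phi (Rfused ka t v bs) = Rfused ka' t' v bs.
Proof.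
elim: bs => [|b bs IHbs] /=; first exact: rmorph1.
elim: b => //= p b IHb; rewrite !rmorphM IHb !rmorph_prod; congr (_ * _ * _).
  by apply: eq_bigr => q _; rewrite rmorphB rmorph1 rmorphM phi_ka phi_t.
by apply: eq_bigr => b' _; apply: fused_morph.
Qed.

End FfMorph.

(** * Density on one skew diagram *)

Section Alg.
Variables (C : numFieldType) (E : pzRingType) (ka : {rmorphism C -> E}) (G : E -> Prop).

(** Words grow by generators on the right. This fits operators of the form b F: in the induction,
    the entry of T(u) nearest to F is moved across it, turning b F into a known corner element times
    a new factor. *)
Inductive alg : E -> Prop :=
| alg_0 : alg 0
| alg_1 : alg 1
| alg_lin a x z : alg x -> alg z -> alg (ka a * x + z)
| alg_gen x g : alg x -> G g -> alg (x * g).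

Lemma alg_closed : lin_closed ka alg.
Proof. by split; [exact: alg_0 | exact: alg_lin]. Qed.

Hypothesis kaC : forall c x, ka c * x = x * ka c.

Lemma algD x z : alg x -> alg z -> alg (x + z).
Proof. by move=> ax az; rewrite -[x]mul1r -(rmorph1 ka); apply: alg_lin. Qed.

Lemma algZ a x : alg x -> alg (ka a * x).
Proof. by move=> ax; rewrite -[_ * _]addr0; apply: alg_lin => //; apply: alg_0. Qed.

Lemma algM x z : alg x -> alg z -> alg (x * z).
Proof.
move=> ax; elim=> [||a z1 z2 _ IH1 _ IH2|z1 g _ IH1 Gg].
- by rewrite mulr0; apply: alg_0.
- by rewrite mulr1.
- by rewrite mulrDr mulrA -kaC -mulrA; apply: alg_lin.
- by rewrite mulrA; apply: alg_gen.
Qed.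

Lemma alg_mem g : G g -> alg g.
Proof. by move=> Gg; rewrite -[g]mul1r; apply: alg_gen => //; apply: alg_1. Qed.

Lemma alg_prod (I : Type) (s : seq I) (f : I -> E) :
  (forall i, alg (f i)) -> alg (\prod_(i <- s) f i).
Proof. by move=> af; apply: big_ind => //; [exact: alg_1 | exact: algM]. Qed.

End Alg.

Lemma alg_sub (C : numFieldType) (E : pzRingType) (ka : {rmorphism C -> E}) (G G' : E -> Prop) x :
  (forall c x, ka c * x = x * ka c) ->
  (forall g, G g -> alg ka G' g) -> alg ka G x -> alg ka G' x.
Proof.
move=> kaC GG'; elim=> [||a x1 x2 _ IH1 _ IH2|x1 g _ IH1 Gg].
- exact: alg_0.
- exact: alg_1.
- exact: alg_lin.
- by apply: algM => //; apply: GG'.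
Qed.

Section ScalarMatrix.
Variables (C : fieldType) (W : vectType C) (N : nat).

Definition smx_fun (x : endo W) : 'M[endo W]_N := x%:M.

Lemma smx_additive : zmod_morphism smx_fun.
Proof. by move=> a b; rewrite /smx_fun raddfB. Qed.

Lemma smx_multiplicative : monoid_morphism smx_fun.
Proof. by split=> [|a b] //; rewrite /smx_fun smxM. Qed.

HB.instance Definition _ := GRing.isZmodMorphism.Build (endo W) 'M[endo W]_N smx_fun smx_additive.
HB.instance Definition _ :=
  GRing.isMonoidMorphism.Build (endo W) 'M[endo W]_N smx_fun smx_multiplicative.

Definition smx : {rmorphism endo W -> 'M[endo W]_N} := smx_fun.

Lemma smxE x : smx x = x%:M.
Proof. by []. Qed.

End ScalarMatrix.

Section Sigma.
Variables (C : fieldType) (N : nat) (J : finType).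
Notation W := (tpow C N J).
Notation E0 := (endo W).
Notation E1 := 'M[endo W]_N.
Notation site := (@site C N J).
Notation flip := (@flip C N J).
Notation P0 := (@P0 C N J).
Notation ka0 := (@escal C W).
Notation ka1 := (@mscal C W N).
Notation smx := (@smx C W N).
Implicit Types (p q : J) (X Y : E1) (x : E0).

(* the auxiliary matrix factor put at the site p *)
Definition sigma p X : E0 := \sum_k \sum_l site p (delta_mx k l) * X k l.

Definition off_site p X := forall i j A, site p A * X i j = X i j * site p A.

(** The right side is the entry (j, i) of [P0 p * X]. Multiplication by the flip P_{0p} thus amounts
    to placing the auxiliary factor at the site p, which is how the residue of T(u) becomes an
    operator there. *)
Lemma sigma_delta p X i j : off_site p X ->
  sigma p X * site p (delta_mx i j) = \sum_k site p (delta_mx k j) * X k i.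
Proof.
move=> offX; rewrite /sigma mulr_suml; apply: eq_bigr => k _.
rewrite mulr_suml (bigD1 i) //= big1 ?addr0 => [|l li].
  by rewrite -mulrA -offX mulrA siteM mul_delta_mx.
by rewrite -mulrA -offX mulrA siteM mul_delta_mx_cond (negPf li) linear0 mul0r.
Qed.

Lemma sigmaM p X Y : off_site p X -> sigma p (X * Y) = sigma p X * sigma p Y.
Proof.
move=> offX; rewrite [sigma p Y]/sigma exchange_big /= mulr_sumr.
rewrite /sigma exchange_big /=; apply: eq_bigr => l _.
under eq_bigr do rewrite mulM1E mulr_sumr.
rewrite exchange_big /= mulr_sumr; apply: eq_bigr => m _.
rewrite mulrA sigma_delta // mulr_suml; apply: eq_bigr => k _; by rewrite mulrA.
Qed.

Lemma sigma1 p : sigma p 1 = 1.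
Proof.
rewrite /sigma -(site1 C N p) mx1_sum_delta linear_sum; apply: eq_bigr => k _ /=.
rewrite (bigD1 k) //= big1 ?addr0 => [|l lk]; first by rewrite mxE eqxx mulr1.
by rewrite mxE eq_sym (negPf lk) mulr0.
Qed.

Lemma sigmaL p a X Y : sigma p (X + ka1 a * Y) = sigma p X + ka0 a * sigma p Y.
Proof.
rewrite /sigma mulr_sumr -big_split; apply: eq_bigr => k _ /=.
rewrite mulr_sumr -big_split; apply: eq_bigr => l _ /=.
by rewrite mxE mscalE mulrDr escalE endoZr.
Qed.

Lemma sigmaD p X Y : sigma p (X + Y) = sigma p X + sigma p Y.
Proof. by rewrite -[in LHS](mul1r Y) -(rmorph1 ka1) sigmaL rmorph1 mul1r. Qed.

Lemma sigma0 p : sigma p 0 = 0.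
Proof. by rewrite /sigma big1 // => k _; rewrite big1 // => l _; rewrite mxE mulr0. Qed.

Lemma sigmaP0 p q : p != q -> sigma p (P0 q) = flip p q.
Proof.
move=> pq; rewrite flip_sum //; apply: eq_bigr => k _; apply: eq_bigr => l _.
by rewrite mxE.
Qed.

Lemma sigma_mul_smx p X x : sigma p (X * smx x) = sigma p X * x.
Proof.
rewrite /sigma mulr_suml; apply: eq_bigr => k _.
by rewrite mulr_suml; apply: eq_bigr => l _; rewrite mul_mx_scalarE mulrA.
Qed.

Lemma off_siteM p X Y : off_site p X -> off_site p Y -> off_site p (X * Y).
Proof.
move=> oX oY i j A; rewrite mulM1E mulr_sumr mulr_suml; apply: eq_bigr => k _.
by rewrite mulrA oX -!mulrA oY.
Qed.

Lemma off_siteD p X Y : off_site p X -> off_site p Y -> off_site p (X + Y).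
Proof. by move=> oX oY i j A; rewrite mxE mulrDr mulrDl oX oY. Qed.

Lemma off_siteB p X Y : off_site p X -> off_site p Y -> off_site p (X - Y).
Proof. by move=> oX oY i j A; rewrite !mxE mulrBr mulrBl oX oY. Qed.

Lemma off_site_smx p x : (forall A, site p A * x = x * site p A) -> off_site p (smx x).
Proof.
move=> ox i j A; rewrite smxE mxE; case: eqP => _; rewrite ?mulr1n ?mulr0n ?mulr0 ?mul0r//.
Qed.

Lemma off_site_scal p a : off_site p (ka1 a).
Proof. by apply: off_site_smx => A; rewrite escalC. Qed.

Lemma off_site_P0 p q : p != q -> off_site p (P0 q).
Proof. by move=> pq i j A; rewrite mxE siteC. Qed.

Lemma off_site_prod p (I : eqType) (s : seq I) (F : I -> E1) :
  (forall i, i \in s -> off_site p (F i)) -> off_site p (\prod_(i <- s) F i).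
Proof.
move=> oF; rewrite big_seq; apply: (big_ind (off_site p)) => //.
  by have := @off_site_scal p 1; rewrite rmorph1.
exact: off_siteM.
Qed.

Lemma off_siteN1 p X a : off_site p X -> off_site p (1 - ka1 a * X).
Proof.
move=> oX; rewrite -mulNr -rmorphN -(rmorph1 ka1); apply: off_siteD; first exact: off_site_scal.
by apply: off_siteM => //; apply: off_site_scal.
Qed.

Lemma sigma_prod p (I : eqType) (s : seq I) (F : I -> E1) (f : I -> E0) :
  (forall i, i \in s -> off_site p (F i)) -> (forall i, i \in s -> sigma p (F i) = f i) ->
  sigma p (\prod_(i <- s) F i) = \prod_(i <- s) f i.
Proof.
elim: s => [|i s IHs] oF sF; first by rewrite !big_nil sigma1.
rewrite !big_cons sigmaM ?sF ?mem_head //; last by apply: oF; rewrite mem_head.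
rewrite IHs // => j js; [apply: oF | apply: sF]; by rewrite in_cons js orbT.
Qed.

Lemma sigmaN1 p X a : sigma p (1 - ka1 a * X) = 1 - ka0 a * sigma p X.
Proof. by rewrite -mulNr -rmorphN sigmaL sigma1 rmorphN mulNr. Qed.

Lemma sigma_sum p (b : seq J) (F : J -> E1) :
  sigma p (\sum_(q <- b) F q) = \sum_(q <- b) sigma p (F q).
Proof. by apply: (big_morph _ (@sigmaD p) (sigma0 p)). Qed.

Lemma off_site_fused p v (u : C) (b : seq J) : p \notin b -> off_site p (fused ka1 v P0 u b).
Proof.
move=> pb; apply: off_siteN1; rewrite big_seq.
apply: (big_ind (off_site p)) => [|X Y|q qb]; last 1 first.
- by apply: off_site_P0; apply: contraNneq pb => ->.
- by have := @off_site_scal p 0; rewrite rmorph0.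
- exact: off_siteD.
Qed.

Lemma lop_mulE p v (u : C) X i j : (lop ka1 P0 v u p * X) i j =
  ka0 (u - v p) * X i j - \sum_r site p (delta_mx r i) * X r j.
Proof.
have -> : lop ka1 P0 v u p * X = ka1 (u - v p) * X - P0 p * X by rewrite -mulrBl.
rewrite mxE [(- (P0 p * X)) i j]mxE mscalE escalE mulM1E; congr (_ - _).
by apply: eq_bigr => r _; rewrite mxE.
Qed.

Lemma sigma_fused p v (u : C) (b : seq J) : p \notin b ->
  sigma p (fused ka1 v P0 u b) = fused ka0 v (flip p) u b.
Proof.
move=> pb; rewrite sigmaN1 sigma_sum big_seq; congr (1 - _ * _).
rewrite [RHS]big_seq; apply: eq_bigr => q qb; apply: sigmaP0.
by apply: contraNneq pb => ->.
Qed.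

End Sigma.

Section Density.
Variables (C : numFieldType) (N : nat) (J : finType) (c y : J -> C).
Notation W := (tpow C N J).
Notation E0 := (endo W).
Notation E1 := 'M[endo W]_N.
Notation site := (@site C N J).
Notation flip := (@flip C N J).
Notation P0 := (@P0 C N J).
Notation ka0 := (@escal C W).
Notation ka1 := (@mscal C W N).
Notation smx := (@smx C W N).
Implicit Types (p q : J) (s b : seq J) (bs : seq (seq J)).

Definition Lop s (u : C) : E1 := \prod_(q <- s) lop ka1 P0 c u q.
Definition fusion_op bs : E0 := Rfused ka0 flip c bs.

Definition Lgen s (x : E0) := exists u i j, x = Lop s u i j.

Lemma smx_flip2 p q : p != q -> smx (flip p q) * smx (flip p q) = 1.
Proof. by move=> _; rewrite -rmorphM flip2 rmorph1. Qed.

Lemma smx_flipS p q : smx (flip p q) = smx (flip q p).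
Proof. by rewrite flipC. Qed.

Lemma flipJ' p q r : p != q -> p != r -> q != r -> flip p q * flip p r = flip p r * flip q r.
Proof. by move=> pq pr qr; rewrite flipJ // eq_sym. Qed.

Lemma smx_flipJ p q r : p != q -> p != r -> q != r ->
  smx (flip p q) * smx (flip p r) = smx (flip p r) * smx (flip q r).
Proof.
move=> pq pr qr.
exact: (etrans (esym (rmorphM smx _ _)) (etrans (congr1 smx (flipJ' pq pr qr)) (rmorphM smx _ _))).
Qed.

Lemma smx_flipC p q r (s : J) : p != r -> p != s -> q != r -> q != s ->
  smx (flip p q) * smx (flip r s) = smx (flip r s) * smx (flip p q).
Proof.
move=> pr ps qr qs; have e : flip p q * flip r s = flip r s * flip p q by rewrite flip_comm.
exact: (etrans (esym (rmorphM smx _ _)) (etrans (congr1 smx e) (rmorphM smx _ _))).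
Qed.

Lemma smx_fusion_op bs : smx (fusion_op bs) = Rfused ka1 (fun p q => smx (flip p q)) c bs.
Proof. exact: Rfused_morph. Qed.

Lemma rtt_fusion_op bs u : good c y bs ->
  Lop (flatten bs) u * smx (fusion_op bs) = smx (fusion_op bs) * Lop (rev (flatten bs)) u.
Proof.
move=> gb; rewrite smx_fusion_op; apply: (rtt_Rfused (@mscalC _ _ _) smx_flip2 smx_flipS smx_flipJ smx_flipC _ _ _ _ gb).
- by move=> q r qr; apply: P0_flip.
- by move=> q r _; apply: flip_P0.
- by move=> q r s; apply: flip_P0C.
Qed.

Lemma antisym_fusion_op bs b : good c y bs -> b \in bs -> antisym flip b (fusion_op bs).
Proof.
move=> gb bbs; apply: (antisym_Rfused (@escalC _ _) _ _ _ _ gb bbs).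
- by move=> p q _; apply: flip2.
- exact: flipC.
- exact: flipJ'.
- exact: flip_comm.
Qed.

(** The operator F is built by sums and products from scalars and flips of pairs of its own
    boxes. *)
Lemma fusion_op_centralizer bs (x : E0) :
  (forall q r, q \in flatten bs -> r \in flatten bs -> x * flip q r = flip q r * x) ->
  x * fusion_op bs = fusion_op bs * x.
Proof.
have subc a z : x * z = z * x -> x * (1 - ka0 a * z) = (1 - ka0 a * z) * x.
  by move=> H; rewrite mulrBr mulrBl mulr1 mul1r mulrA -escalC -mulrA H mulrA.
elim: bs => [|b bs IHbs]; first by rewrite mulr1 mul1r.
elim: b => [//|q b IHb] /= xf.
have IH : x * fusion_op (b :: bs) = fusion_op (b :: bs) * x.
  by apply: IHb => r r' rb r'b; apply: xf; rewrite in_cons ?rb ?r'b orbT.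
rewrite /fusion_op /= mulrA -[RHS]mulrA -[X in _ = _ * X]IH [RHS]mulrA; congr (_ * _).
have qq : q \in q :: b ++ flatten bs by rewrite mem_head.
rewrite mulrA (comm_prod (x := x)) => [|r rb]; last first.
  by rewrite /Rv; apply: subc; apply: xf => //; rewrite in_cons mem_cat rb orbT.
rewrite -!mulrA; congr (_ * _); rewrite (comm_prod (x := x)) // => b' b'bs.
apply: subc; rewrite mulr_sumr mulr_suml big_seq [RHS]big_seq; apply: eq_bigr => r rb'.
apply: xf => //; rewrite in_cons mem_cat; apply/orP; right; apply/orP; right.
by apply/flattenP; exists b'.
Qed.

Lemma fusion_op_comm p bs A : p \notin flatten bs -> site p A * fusion_op bs = fusion_op bs * site p A.
Proof.
move=> pbs; apply: fusion_op_centralizer => q r qb rb; rewrite flip_siteC //.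
  by apply: contraNneq pbs => ->.
by apply: contraNneq pbs => ->.
Qed.

Lemma off_site_lop p u q : p != q -> off_site p (lop ka1 P0 c u q).
Proof.
by move=> pq; apply: off_siteB; [apply: off_site_scal | apply: off_site_P0].
Qed.

Lemma polyf_Lop s i j : polyf ka0 (fun u => Lop s u i j).
Proof.
apply: (@polyf_map _ _ _ ka1 ka0 (fun M : E1 => M i j) (Lop s)).
- by move=> a M1 M2; rewrite mxE mscalE escalE.
- by rewrite mxE.
apply: polyf_prod => [|q]; first exact: mscalC.
apply: (@polyf_ext _ _ _ (fun u => ka1 u + (ka1 (- c q) - P0 q))).
  by move=> u; rewrite /lop rmorphD addrA.
by apply: polyf_add; [apply: (polyf_id (@mscalC C W N)) | exact: polyf_const].
Qed.

Lemma off_site_Lop p s u : p \notin s -> off_site p (Lop s u).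
Proof.
move=> ps; apply: off_site_prod => q qs; apply: off_site_lop.
by apply: contraNneq ps => ->.
Qed.

Lemma alg_comm p s x A : p \notin s -> alg ka0 (Lgen s) x -> site p A * x = x * site p A.
Proof.
move=> ps; elim=> [||a x1 x2 _ IH1 _ IH2|x1 g _ IH1 [u [i [j ->]]]].
- by rewrite mulr0 mul0r.
- by rewrite mulr1 mul1r.
- by rewrite mulrDr mulrDl mulrA -escalC -!mulrA IH1 IH2.
- by rewrite mulrA IH1 -!mulrA off_site_Lop.
Qed.

Section Step.
Variables (p : J) (b : seq J) (bs : seq (seq J)).
Hypothesis gb : good c y ((p :: b) :: bs).

Let s := flatten (b :: bs).
Let F := fusion_op (b :: bs).
Let gb' : good c y (b :: bs) := good_tail gb.

(** T(u) on the boxes after p, as it acts on F. The later columns are fused; the rest of the column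
    of p is not, since its contents already differ from c p. So [Phi] is regular at c p, although
    T(u) itself need not be. *)
Let Phi (u : C) : E1 :=
  \prod_(q <- b) (1 - ka1 (u - c q)^-1 * P0 q) * \prod_(b' <- bs) fused ka1 c P0 u b'.

(** The factor that adding the box p contributes to the fused operator, which becomes X F. *)
Let X : E0 := \prod_(q <- b) Rv ka0 flip c p q * \prod_(b' <- bs) fused ka0 c (flip p) (c p) b'.

Let ps : p \notin s.
Proof. by case/andP: (good_uniq gb). Qed.

Let ps' q : q \in s -> p != q.
Proof. by move=> qs; apply: contraNneq ps => ->. Qed.

Let off_Phi u : off_site p (Phi u).
Proof.
apply: off_siteM; apply: off_site_prod.
  move=> q qb; apply: off_siteN1; apply: off_site_P0; apply: ps'.
  by rewrite /s /= mem_cat qb.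
move=> b' b'bs; apply: off_site_fused; apply/negP => pb'; have := ps.
by rewrite /s /= mem_cat negb_or => /andP[_ /negP[]]; apply/flattenP; exists b'.
Qed.

(** The R-matrices of T(u) at u = c p, with the auxiliary factor placed at p, are the R-matrices
    that join the box p to the remaining ones. *)
Let sigma_Phi : sigma p (Phi (c p)) = X.
Proof.
rewrite sigmaM; last first.
  apply: off_site_prod => q qb; apply: off_siteN1; apply: off_site_P0; apply: ps'.
  by rewrite /s /= mem_cat qb.
have pb' b' : b' \in bs -> p \notin b'.
  move=> b'bs; apply/negP => pb'; have := ps.
  by rewrite /s /= mem_cat negb_or => /andP[_ /negP[]]; apply/flattenP; exists b'.
congr (_ * _); apply: sigma_prod.
- move=> q qb; apply: off_siteN1; apply: off_site_P0; apply: ps'.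
  by rewrite /s /= mem_cat qb.
- move=> q qb; rewrite sigmaN1 sigmaP0 //; apply: ps'.
  by rewrite /s /= mem_cat qb.
- by move=> b' /pb'; apply: off_site_fused.
- by move=> b' /pb'; apply: sigma_fused.
Qed.

Let Phi_Lop u : (forall q, q \in s -> u != c q) ->
  Phi u * smx F = ka1 (\prod_(q <- s) (u - c q)^-1) * (Lop s u * smx F).
Proof.
move=> us; rewrite -mulrA.
have -> : \prod_(b' <- bs) fused ka1 c P0 u b' * smx F =
    \prod_(q <- flatten bs) (1 - ka1 (u - c q)^-1 * P0 q) * smx F.
  symmetry; apply: (@fuse_columns _ _ ka1 _ (@mscalC _ _ _) c predT P0 (fun p q => smx (flip p q))) => //.
  - by move=> q r _ _ qr; apply: P0_flip.
  - by move=> q r q' _ _ _ h1 h2; apply: flip_P0C.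
  - by have := good_uniq gb'; rewrite /= cat_uniq => /and3P[].
  - by move=> b' b'bs; apply: (good_column gb'); rewrite in_cons b'bs orbT.
  - by move=> q qs; apply: us; rewrite /s /= mem_cat qs orbT.
  move=> b' b'bs q r qb rb qr.
  by rewrite -rmorphM (antisym_fusion_op gb' (b := b')) ?in_cons ?b'bs ?orbT // rmorphN.
have e : \prod_(q <- b) (1 - ka1 (u - c q)^-1 * P0 q)
    * \prod_(q <- flatten bs) (1 - ka1 (u - c q)^-1 * P0 q) =
  ka1 (\prod_(q <- s) (u - c q)^-1) * Lop s u.
  by rewrite -big_cat; apply: (prod_lop (@mscalC _ _ _)).
by rewrite [LHS]mulrA [RHS]mulrA e.
Qed.

Let gen_poly : {poly C} := \prod_(q <- s) ('X + (c p - c q)%:P).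

Let gen_poly_neq0 : gen_poly != 0.
Proof.
rewrite prodf_seq_neq0; apply/allP => q _ /=.
by rewrite -size_poly_eq0 size_XaddC.
Qed.

Let gen_polyP e : gen_poly.[e] != 0 -> forall q, q \in s -> c p + e != c q.
Proof.
rewrite horner_prod prodf_seq_neq0 => /allP H q /H /=; rewrite hornerD hornerX hornerC.
by apply: contraNneq => H1; apply/eqP; rewrite -H1; ring.
Qed.

Let regf_Phi : regf ka1 (fun e => Phi (c p + e)).
Proof.
apply: regf_mul; first exact: mscalC.
  apply: (regf_prod (@mscalC _ _ _)) => q qb.
  have := @regf_sub_inv _ _ ka1 (@mscalC _ _ _) (c p - c q) 1 (P0 q) _.
  rewrite subr_eq0 (good_column_neq gb qb) => /(_ isT); apply: regf_ext => e.
  by rewrite mulr1 addrAC.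
apply: (regf_prod (@mscalC _ _ _)) => b' b'bs.
have := @regf_sub_inv _ _ ka1 (@mscalC _ _ _) (c p - top c b') 1 (\sum_(q <- b') P0 q) _.
rewrite subr_eq0 (good_top_neq gb b'bs) => /(_ isT); apply: regf_ext => e.
by rewrite mulr1 addrAC.
Qed.

(** At generic u this is the relation of T(u) with F, read through [Phi_Lop]; being a right multiple
    of F is a linear condition and survives interpolation to u = c p. *)
Let Phi_F : exists Y : E1, Phi (c p) * smx F = smx F * Y.
Proof.
pose Q (x : E1) := exists Y : E1, x = smx F * Y.
have QL : lin_closed ka1 Q by apply: lin_closed_rmul; apply: mscalC.
rewrite -[c p]addr0; apply: (@regf_interp _ _ ka1 (@mscalC _ _ _)
  (fun e => Phi (c p + e) * smx F) Q _ QL gen_poly_neq0).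
  by apply: regf_mul => //; [exact: mscalC | exact: regf_const].
move=> e /gen_polyP pe; rewrite Phi_Lop // rtt_fusion_op //.
by rewrite -(scal_mulCA (@mscalC C W N)); eexists.
Qed.

Let Lop_F i j u : exists Y : E0, Lop s u i j * F = F * Y.
Proof.
exists (Lop (rev s) u i j); have := congr1 (fun M : E1 => M i j) (rtt_fusion_op u gb').
by rewrite smxE mul_mx_scalarE mul_scalar_mxE.
Qed.

Let B := alg ka0 (Lgen (p :: s)).

(** The subspace B F, in which the residue and the corner elements are to be found. *)
Let BF (x : E0) := exists2 z, B z & z * F = x.

Let BF_closed : lin_closed ka0 BF.
Proof. exact: lin_closed_lmul (alg_closed _ _). Qed.

Let BFZ a x : BF x -> BF (ka0 a * x).
Proof. by move=> H; rewrite -[_ * _]addr0; case: BF_closed => H0; apply. Qed.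

Let BFD x z : BF x -> BF z -> BF (x + z).
Proof. by move=> Hx; rewrite -[x]mul1r -(rmorph1 ka0); case: BF_closed => _; apply. Qed.

(* the residue of Lop (p :: s) u at u = c p *)
Let residue i j : BF (X * site p (delta_mx i j) * F).
Proof.
pose Q (M : E1) := forall i j, BF (M i j).
have QL : lin_closed ka1 Q.
  split; first by move=> k l; rewrite mxE; case: BF_closed.
  by move=> a M1 M2 Q1 Q2 k l; rewrite mxE mscalE -escalE; case: BF_closed => _; apply.
(* The scalar that relates [Phi] to [Lop] may have a pole at c p, when another box lies on the same
   diagonal. So membership in B F is proved for u = c p + e with e generic, and interpolated to e =
   0, where only - P_{0p} remains of the factor of p. *)
have : Q ((ka1 0 - P0 p) * (Phi (c p + 0) * smx F)).
  apply: (@regf_interp _ _ ka1 (@mscalC _ _ _)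
    (fun e => (ka1 e - P0 p) * (Phi (c p + e) * smx F)) Q _ QL gen_poly_neq0).
    apply: regf_mul => //; [exact: mscalC| |].
      apply: regf_add; [exact: mscalC| |exact: regf_const].
      by apply: polyf_reg; apply: polyf_id; apply: (@mscalC C W N).
    by apply: regf_mul => //; [exact: mscalC | exact: regf_const].
  move=> e /gen_polyP pe k l; rewrite Phi_Lop //.
  have sc := scal_mulCA (@mscalC C W N).
  rewrite sc mscalE -escalE; apply: BFZ.
  have -> : (ka1 e - P0 p) * (Lop s (c p + e) * smx F) = Lop (p :: s) (c p + e) * smx F.
    by rewrite /Lop big_cons -mulrA /lop [c p + e]addrC addrK.
  rewrite smxE mul_mx_scalarE; exists (Lop (p :: s) (c p + e) k l) => //.
  by apply: alg_mem; exists (c p + e), k, l.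
move/(_ j i)/(BFZ (-1)); rewrite rmorph0 sub0r addr0 mulNr mxE rmorphN rmorph1 mulN1r opprK.
have -> : P0 p * (Phi (c p) * smx F) = (P0 p * Phi (c p)) * smx F by rewrite mulrA.
rewrite smxE mul_mx_scalarE mulM1E -sigma_Phi sigma_delta //.
by under eq_bigr do rewrite mxE.
Qed.

Let BF_site (Z : E0) A :
  (forall i j, BF (X * site p (delta_mx i j) * Z)) -> BF (X * site p A * Z).
Proof.
move=> H; rewrite [A]matrix_sum_delta linear_sum mulr_sumr mulr_suml.
case: (BF_closed) => BF0 _; apply: big_ind => // i _.
rewrite linear_sum mulr_sumr mulr_suml; apply: big_ind => // j _.
by rewrite linearZ /= endoZr endoZl -escalE; apply: BFZ.
Qed.

Let F_comm A : site p A * F = F * site p A.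
Proof. exact: fusion_op_comm. Qed.

(* Multiplying by Lop (p :: s) v k l gives both (v - c p) w - w' and (v - c p) w' - w, where  *)
(* w' is w with two indices exchanged; hence ((v - c p)^2 - 1) w is attained, and so is w *)
(* for all v by interpolation.                                                            *)
Let density_step (x : E0) A : alg ka0 (Lgen s) x -> BF (X * site p A * (x * F)).
Proof.
move=> ax; elim: ax A => [||a x1 x2 _ IH1 _ IH2|x1 g ax1 IH1 [u [k [l ->]]]] A.
- by rewrite mul0r mulr0; case: BF_closed.
- by rewrite mul1r; apply: BF_site => i j; apply: residue.
- rewrite mulrDl -(mulrA _ x1) mulrDr (scal_mulCA (@escalC _ _)); apply: BFD => //.
  exact: BFZ.
rewrite -(mulrA x1); apply: BF_site => {A} i j.
(* The operator z is known only through z F. It can still be applied here, because [Lop s v m n * F]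
   is a right multiple of F and F commutes with the matrices at p. *)
have shift (z : E0) (A B' : 'M[C]_N) (v : C) (m n : 'I_N) : z * F = X * site p A * (x1 * F) ->
    z * (site p B' * (Lop s v m n * F)) = X * site p (A *m B') * (x1 * (Lop s v m n * F)).
  have [Y ->] := Lop_F m n v; move=> zF.
  rewrite (mulrA (site p B')) F_comm -(mulrA F) mulrA zF -!mulrA; congr (_ * _).
  rewrite -siteM -!mulrA (mulrA F) -F_comm -!mulrA; congr (_ * _).
  by congr (_ * _); rewrite !mulrA (alg_comm B' ps ax1).
pose w (v : C) (i1 i2 m n : 'I_N) := X * site p (delta_mx i1 i2) * (x1 * (Lop s v m n * F)).
have H (v : C) (i1 i2 m n : 'I_N) : BF (ka0 (v - c p) * w v i1 i2 m n - w v i1 m i2 n).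
  have [z Bz zF] := IH1 (delta_mx i1 i2).
  exists (z * Lop (p :: s) v m n); first by apply: alg_gen => //; exists v, m, n.
  have -> : Lop (p :: s) v m n =
      ka0 (v - c p) * Lop s v m n - \sum_r site p (delta_mx r m) * Lop s v r n.
    by rewrite /Lop big_cons lop_mulE.
  rewrite -mulrA mulrBl mulrBr -mulrA (scal_mulCA (@escalC _ _)); congr (_ * _ - _).
    by have := shift z (delta_mx i1 i2) 1%:M v m n zF; rewrite site1 mul1r mulmx1.
  rewrite mulr_suml mulr_sumr (bigD1 i2) //= big1 ?addr0 => [|r rb].
    by rewrite -mulrA (shift _ _ _ _ _ _ zF) mul_delta_mx.
  rewrite -mulrA (shift _ _ _ _ _ _ zF) mul_delta_mx_cond eq_sym (negPf rb).
  by rewrite linear0 mulr0 mul0r.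
suff : forall v, BF (w v i j k l) by apply.
apply: (@polyf_interp _ _ ka0 (@escalC _ _) _ _ (('X - (c p)%:P) ^+ 2 - 1) BF_closed).
- apply/eqP => /(congr1 (fun d : {poly C} => d.[c p])); rewrite !hornerE subrr expr0n sub0r.
  by move/eqP; rewrite oppr_eq0 oner_eq0.
- apply: polyf_mull; first exact: escalC.
  apply: polyf_mull; first exact: escalC.
  apply: polyf_mul; [exact: escalC | | exact: polyf_const].
  exact: polyf_Lop.
move=> v nz; have := H v i j k l; have := H v i k j l.
set x1' := w v i j k l; set x2' := w v i k j l => H1 H2.
have := BFD (BFZ (v - c p) H2) H1.
rewrite scal_elim.
move/(BFZ ((v - c p) ^+ 2 - 1)^-1); rewrite mulrA -rmorphM mulVf ?rmorph1 ?mul1r //.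
by move: nz; rewrite !hornerE.
Qed.

(** [density_step] gives z F = X A x F = X A F Z F with A at the site p. To obtain z X F instead, X
    F is rewritten as a right multiple of F; the same rewriting read backwards restores X F on the
    right. *)
Lemma density_cons A (Z : E0) :
  (exists2 x, alg ka0 (Lgen s) x & x * F = F * Z * F) ->
  exists2 x, alg ka0 (Lgen (p :: s)) x & x * (X * F) = X * F * (site p A * Z) * (X * F).
Proof.
move=> [x ax xF]; have [z Bz zF] := density_step A ax; exists z => //.
have [Y PY] := Phi_F.
have XF : X * F = F * sigma p Y.
  rewrite -sigma_Phi -sigma_mul_smx PY /sigma mulr_sumr; apply: eq_bigr => k _.
  rewrite mulr_sumr; apply: eq_bigr => l _.
  by rewrite smxE mul_scalar_mxE mulrA F_comm mulrA.
rewrite {1}XF [LHS]mulrA zF xF [X in _ = _ * X]XF !mulrA.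
by rewrite -(mulrA X (site p A) F) F_comm !mulrA.
Qed.

End Step.

Lemma density bs (A : J -> 'M[C]_N) : good c y bs ->
  exists2 x, alg ka0 (Lgen (flatten bs)) x &
    x * fusion_op bs = fusion_op bs * \prod_(p <- flatten bs) site p (A p) * fusion_op bs.
Proof.
elim: bs => [_|b bs IHbs].
  by exists 1; rewrite ?big_nil ?mulr1 //; apply: alg_1.
elim: b => [/good_pop/IHbs //|p b IHb] gb.
by rewrite /= big_cons; apply: density_cons => //; apply: IHb; apply: good_tail gb.
Qed.

End Density.

(** * Nonvanishing of the fused operator *)

Section Nonvanishing.
Variables (C : numFieldType) (N : nat) (J : finType) (c y : J -> C).
Notation W := (tpow C N J).
Notation E0 := (endo W).
Notation flip := (@flip C N J).
Notation ka0 := (@escal C W).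
Notation fusion_op := (@fusion_op C N J c).
Variable f : {ffun J -> 'I_N}.
Implicit Types (p q r : J) (b : seq J) (bs : seq (seq J)) (phi : W) (g : {ffun J -> 'I_N}).

Definition swap g p q : {ffun J -> 'I_N} := [ffun r => g (tperm p q r)].

(** From top to bottom a column carries the labels size - 1, ..., 1, 0, so the columns must have
    length at most N. The diagonal coefficient of F at the basis vector with these labels is shown
    not to vanish. *)
Fixpoint std_labels b : Prop :=
  if b is q :: b' then f q = size b' :> nat /\ std_labels b' else True.

Lemma std_labels_lt b q : std_labels b -> q \in b -> (f q < size b)%N.
Proof.
elim: b => // r b IHb [fr sb]; rewrite in_cons => /orP[/eqP->|qb] /=; first by rewrite fr.
by apply: ltnW; apply: IHb.
Qed.

Lemma std_labels_ex b k : std_labels b -> (k < size b)%N ->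
  exists2 q, q \in b & f q = k :> nat.
Proof.
elim: b => // r b IHb [fr sb] /=; rewrite ltnS leq_eqVlt => /orP[/eqP->|kb].
  by exists r; rewrite ?mem_head.
by have [q qb fq] := IHb sb kb; exists q; rewrite // in_cons qb orbT.
Qed.

Lemma flipE' p q phi g : (flip p q phi : {ffun _ -> C^o}) g = phi (swap g p q).
Proof. exact: flipE. Qed.

Lemma escal_app a (x : E0) phi g :
  ((ka0 a * x) phi : {ffun _ -> C^o}) g = a * (x phi : {ffun _ -> C^o}) g.
Proof. by rewrite escalE scale_lfunE ffunE. Qed.

Lemma sub_scal_app a (x : E0) phi g :
  ((1 - ka0 a * x) phi : {ffun _ -> C^o}) g = phi g - a * (x phi : {ffun _ -> C^o}) g.
Proof.
rewrite add_lfunE opp_lfunE ffunE endo1; congr (_ + _).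
by rewrite ffunE escal_app.
Qed.

Definition antisym_vec b phi := forall q r, q \in b -> r \in b -> q != r -> flip q r phi = - phi.

Lemma antisym_vec0 b phi g q r : antisym_vec b phi -> q \in b -> r \in b -> q != r ->
  g q = g r -> phi g = 0.
Proof.
move=> aphi qb rb qr gqr; have := congr1 (fun h : {ffun _ -> C^o} => h g) (aphi q r qb rb qr).
have gs : swap g q r = g.
  by apply/ffunP => s; rewrite ffunE; case: tpermP => // ->.
rewrite flipE' gs [RHS]ffunE => /eqP; rewrite -subr_eq0 opprK -mulr2n.
by rewrite -[_ *+ 2]mulr_natr mulf_eq0 pnatr_eq0 orbF => /eqP.
Qed.

Lemma fused_app p b phi g :
  (fused ka0 c (flip p) (c p) b phi : {ffun _ -> C^o}) g =
  phi g - (c p - top c b)^-1 * \sum_(q <- b) phi (swap g p q).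
Proof.
rewrite /fused sub_scal_app endo_sumE; congr (_ - _ * _).
by apply: eq_bigr => q _; rewrite flipE'.
Qed.

Lemma swap_out g p q r : r != p -> r != q -> swap g p q r = g r.
Proof. by move=> rp rq; rewrite ffunE tpermD // eq_sym. Qed.

Lemma swap_id g p q : g p = g q -> swap g p q = g.
Proof. by move=> gpq; apply/ffunP => r; rewrite ffunE; case: tpermP => // ->. Qed.

Lemma swapL g p q : swap g p q p = g q.
Proof. by rewrite ffunE tpermL. Qed.

Lemma swapR g p q : swap g p q q = g p.
Proof. by rewrite ffunE tpermR. Qed.

(** A fused factor multiplies the coefficient at f by 1 + k/(m + 1), where k counts the boxes of the
    column b labelled like p; this is positive. All other swaps vanish, provided that the
    coefficients with a smaller label at p and the labels of f on the later columns are zero, a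
    condition that each factor preserves. *)
Lemma fused_coef p bs phi : p \notin flatten bs -> uniq (flatten bs) ->
  {in bs, forall b, antisym_vec b phi} -> {in bs, forall b, std_labels b} ->
  {in bs, forall b, exists m : nat, top c b = c p + m.+1%:R} ->
  (forall g, (g p < f p)%N -> phi g = 0) ->
  let psi := (\prod_(b <- bs) fused ka0 c (flip p) (c p) b : E0) phi in
  (exists2 a, a != 0 & (psi : {ffun _ -> C^o}) f = a * phi f) /\
  (forall g, {in flatten bs, forall q, g q = f q} -> (g p < f p)%N -> psi g = 0).
Proof.
elim: bs phi => [|b bs IHbs] phi.
  move=> _ _ _ _ _ phi0; rewrite /= big_nil endo1; split=> [|g _]; last exact: phi0.
  by exists 1; rewrite ?oner_neq0 ?mul1r.
rewrite /= mem_cat negb_or => /andP[pb pbs]; rewrite cat_uniq => /and3P[ub /hasPn bbs ubs].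
move=> aphi sl tb phi0; rewrite big_cons.
have sub b' : b' \in bs -> b' \in b :: bs by rewrite in_cons orbC => ->.
have [||||||] := IHbs phi => //; do ?[by move=> b' /sub; auto].
set P := \prod_(b <- bs) _; move=> [a' a'0 psif] psi0.
set psi := P phi in psif psi0 *; rewrite endoM -/psi.
have apsi : antisym_vec b psi.
  move=> q r qb rb qr; rewrite /psi -endoM.
  have -> : flip q r * P = P * flip q r.
    rewrite /P big_seq; apply: (big_ind (fun x => flip q r * x = x * flip q r)).
    - by rewrite mulr1 mul1r.
    - by move=> x z Hx Hz; rewrite mulrA Hx -!mulrA Hz.
    move=> b' b'bs; apply: (fused_comm (@escalC _ _)) => s sb'.
    have sbs : s \in flatten bs by apply/flattenP; exists b'.
    have nb t : t \in b -> t != s by move=> tb'; apply: contraNneq (bbs s sbs) => <-.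
    apply: flip_comm; rewrite ?nb // -/(_ \notin [:: p]).
      by apply: contraNneq pb => <-.
    by apply: contraNneq pb => <-.
  by rewrite endoM (aphi b (mem_head _ _) q r) // linearN.
have slb := sl b (mem_head _ _); have [m topb] := tb b (mem_head _ _).
have pnb q : q \in b -> p != q by move=> qb; apply: contraNneq pb => ->.
have pnbs q : q \in flatten bs -> q != p by move=> qb; apply: contraNneq pbs => <-.
have bnbs q r : q \in flatten bs -> r \in b -> q != r.
  by move=> qbs rb; apply: contraTneq rb => <-; apply: bbs.
(* Swapping distinct labels of p and q gives zero for one of two reasons. If g p is less than the
   length of b, that label already occurs in b and antisymmetry applies. Otherwise p receives a
   label of b, which is smaller than f p. *)
have key g q : q \in b -> {in b ++ flatten bs, forall r, g r = f r} -> (g p <= f p)%N ->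
    g p != g q -> psi (swap g p q) = 0.
  move=> qb gf gp gpq; have gfb r : r \in b -> g r = f r by move=> rb; apply: gf; rewrite mem_cat rb.
  have [gpb|bgp] := ltnP (g p) (size b).
    have [r rb fr] := std_labels_ex slb gpb.
    have rq : r != q by apply: contraNneq gpq => <-; apply/eqP/val_inj; rewrite /= (gfb r rb) fr.
    apply: (antisym_vec0 apsi rb qb rq); rewrite swapR swap_out // 1?eq_sym ?pnb //.
    by apply: val_inj; rewrite /= (gfb r rb).
  apply: psi0 => [r rbs|].
    by rewrite swap_out ?pnbs ?bnbs // gf // mem_cat rbs orbT.
  rewrite swapL gfb //; apply: leq_trans gp; apply: leq_trans bgp.
  exact: std_labels_lt.
split=> [|g gf gp]; rewrite fused_app; last first.
  have gf' : {in b ++ flatten bs, forall r, g r = f r} by [].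
  rewrite psi0 ?gp //; last by move=> r rbs; apply: gf; rewrite mem_cat rbs orbT.
  rewrite big_seq big1 ?mulr0 ?subr0 // => q qb.
  have [gpq|gpq] := eqVneq (g p) (g q); last by apply: key; rewrite // ltnW.
  by rewrite swap_id // psi0 // => r rbs; apply: gf; rewrite mem_cat rbs orbT.
have -> : \sum_(q <- b) psi (swap f p q) = (count (fun q => f p == f q) b)%:R * psi f.
  rewrite -sum1_count natr_sum mulr_suml [RHS]big_mkcond big_seq [RHS]big_seq /=.
  apply: eq_bigr => q qb; case: eqVneq => [fpq|fpq]; first by rewrite swap_id // mul1r.
  by rewrite key.
exists ((1 - (c p - top c b)^-1 * (count (fun q => f p == f q) b)%:R) * a'); last first.
  by rewrite psif; ring.
rewrite mulf_neq0 // topb opprD addNKr invrN mulNr opprK.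
by rewrite lt0r_neq0 // ltr_pwDl // mulr_ge0 // ?invr_ge0 ler0n.
Qed.

(** The boxes below p in its own column have smaller labels, so a swap with one of them lowers the
    label at p and contributes nothing: the coefficient is unchanged. *)
Lemma column_coef p b bs (psi : W) : p \notin b ++ flatten bs -> uniq (b ++ flatten bs) ->
  {in b, forall q, (f q < f p)%N} ->
  (forall g, {in flatten bs, forall q, g q = f q} -> (g p < f p)%N -> psi g = 0) ->
  let chi := (\prod_(q <- b) Rv ka0 flip c p q : E0) psi in
  (chi : {ffun _ -> C^o}) f = psi f /\
  (forall g, {in b ++ flatten bs, forall q, g q = f q} -> (g p < f p)%N -> chi g = 0).
Proof.
elim: b => [|q b IHb] /=; first by rewrite big_nil endo1.
rewrite in_cons negb_or => /andP[pq pb] /andP[qb ub] fb psi0; rewrite big_cons endoM.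
have [|chif chi0] := IHb pb ub _ psi0; first by move=> r rb; apply: fb; rewrite in_cons rb orbT.
set chi := (\prod_(r <- b) _ : E0) psi in chif chi0 *.
have sw g : {in q :: b ++ flatten bs, forall r, g r = f r} -> chi (swap g p q) = 0.
  move=> gf; apply: chi0 => [r rb|]; last by rewrite swapL gf ?mem_head // fb ?mem_head.
  rewrite swap_out ?gf ?in_cons ?rb ?orbT //.
    by apply: contraNneq pb => <-.
  by apply: contraNneq qb => <-.
rewrite /Rv; split=> [|g gf gp]; rewrite sub_scal_app flipE' sw // mulr0 subr0 //.
by apply: chi0 => // r rb; apply: gf; rewrite in_cons rb orbT.
Qed.

Lemma fusion_op_coef bs : good c y bs -> {in bs, forall b, std_labels b} ->
  (fusion_op bs (tbasis C f) : {ffun _ -> C^o}) f != 0.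
Proof.
elim: bs => [_ _|b bs IHbs]; first by rewrite endo1 ffunE eqxx oner_neq0.
elim: b => [/good_pop gb sl|p b IHb gb sl].
  by apply: IHbs => // b bbs; apply: sl; rewrite in_cons bbs orbT.
have [fp slb] := sl _ (mem_head _ _).
have sl' b' : b' \in bs -> std_labels b' by move=> b'bs; apply: sl; rewrite in_cons b'bs orbT.
have gb' := good_tail gb.
have {}IHb : (fusion_op (b :: bs) (tbasis C f) : {ffun _ -> C^o}) f != 0.
  by apply: IHb => // b'; rewrite in_cons => /orP[/eqP->|/sl'].
have /= /andP[pb ub] := good_uniq gb.
rewrite /fusion_op /= -mulrA !endoM.
set phi := (fusion_op (b :: bs)) (tbasis C f) in IHb *.
(* F on the remaining boxes commutes with the matrix units at p, hence keeps the label at p. *)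
have phi0 g : g p != f p -> phi g = 0.
  move=> gp; have tb : tbasis C f = site p (delta_mx (f p) (f p)) (tbasis C f).
    apply/ffunP => h; rewrite site_deltaE !ffunE; case: (eqVneq h f) => [->|hf].
      rewrite eqxx mul1r; suff -> : upd f p (f p) = f by rewrite eqxx.
      by apply/ffunP => r; rewrite ffunE; case: eqP => // ->.
    case: (eqVneq (h p) (f p)) => [hp|]; last by rewrite mul0r.
    suff -> : upd h p (f p) = h by rewrite (negPf hf) mulr0.
    by apply/ffunP => r; rewrite ffunE; case: eqP => // ->.
  by rewrite /phi tb -endoM -fusion_op_comm // endoM site_deltaE (negPf gp) mul0r.
have [||||||[a a0 psif] psi0] := @fused_coef p bs phi.
- by apply: contra pb => pbs; rewrite mem_cat pbs orbT.
- by move: ub; rewrite cat_uniq => /and3P[].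
- move=> b' b'bs q r qb rb qr; rewrite /phi -endoM (antisym_fusion_op N gb' (b := b')) ?opp_lfunE //.
  by rewrite in_cons b'bs orbT.
- exact: sl'.
- by case: gb => _ _ _ _ [H _] b' b'bs; apply: H; rewrite ?mem_head.
- by move=> g gp; apply: phi0; rewrite -val_eqE neq_ltn gp.
have [|-> _] := @column_coef p b bs _ pb ub _ psi0.
  by move=> q qb; rewrite fp; apply: std_labels_lt.
by rewrite psif mulf_neq0.
Qed.

End Nonvanishing.

Section Labels.
Variables (N : nat) (J : finType).
Hypothesis N_gt0 : (0 < N)%N.

Lemma std_labels_ext (f f' : {ffun J -> 'I_N}) b :
  {in b, f =1 f'} -> std_labels f b -> std_labels f' b.
Proof.
elim: b => // q b IHb ff' [fq sb] /=; split; first by rewrite -ff' ?mem_head.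
by apply: IHb => // r rb; apply: ff'; rewrite in_cons rb orbT.
Qed.

Lemma std_labels_exist bs : uniq (flatten bs) -> {in bs, forall b, (size b <= N)%N} ->
  exists f : {ffun J -> 'I_N}, {in bs, forall b, std_labels f b}.
Proof.
elim: bs => [_ _|b bs IHbs]; first by exists [ffun => Ordinal N_gt0].
elim: b => [us sN|p b IHb us sN].
  have [|f fP] := IHbs us; first by move=> b' b'bs; apply: sN; rewrite in_cons b'bs orbT.
  by exists f => b'; rewrite in_cons => /orP[/eqP->//|]; apply: fP.
have sb : (size b < N)%N := sN _ (mem_head _ _).
have /= /andP[pb us'] := us.
have [|f fP] := IHb us'.
  move=> b'; rewrite in_cons => /orP[/eqP->|b'bs]; first exact: ltnW.
  by apply: sN; rewrite in_cons b'bs orbT.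
have upd_out b' : b' \in b :: bs -> {in b', f =1 upd f p (Ordinal sb)}.
  move=> b'bs q qb'; rewrite ffunE; case: eqP => // qp; case/negP: pb.
  by rewrite -qp; apply/(flattenP (A := b :: bs)); exists b'.
exists (upd f p (Ordinal sb)) => b'; rewrite in_cons => /orP[/eqP->|b'bs].
  split; first by rewrite ffunE eqxx.
  by apply: std_labels_ext (upd_out b _) (fP b _); rewrite mem_head.
by apply: std_labels_ext (upd_out b' _) (fP b' _); rewrite in_cons b'bs orbT.
Qed.

End Labels.

(** * Columns of a skew diagram *)

Section SkewColumns.
Variable w : skew_diagram.
Notation n := (nbox w).

Definition rows (j : nat) :=
  [seq i <- iota 1 (size (outer w)) | (part (inner w) i < j <= part (outer w) i)%N].

Definition box_columns : seq (seq (nat * nat)) :=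
  [seq [seq (i, j) | i <- rows j] | j <- iota 1 (part (outer w) 1)].

Lemma boxesE : boxes w = flatten box_columns.
Proof. by []. Qed.

Definition all_columns : seq (seq 'I_n) := reshape (shape box_columns) (enum 'I_n).

(** Empty columns are dropped: [top] of an empty list is the dummy value 0, on which [tops] would
    impose a false condition. *)
Definition columns := [seq b <- all_columns | b != [::]].

Lemma map_box_enum : [seq box p | p <- enum 'I_n] = boxes w.
Proof. exact: map_tnth_enum (in_tuple (boxes w)). Qed.

Lemma map_all_columns : [seq [seq box p | p <- b] | b <- all_columns] = box_columns.
Proof. by rewrite map_reshape map_box_enum boxesE flattenK. Qed.

Lemma flatten_columns : flatten columns = enum 'I_n.
Proof.
have <- : flatten all_columns = enum 'I_n.
  by rewrite reshapeKr // size_enum_ord -size_flatten.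
rewrite /columns; elim: all_columns => //= b bs IHbs.
by case: b => //= p b; rewrite IHbs.
Qed.

Lemma part_anti la i k : sorted geq la -> (i <= k)%N -> (part la k <= part la i)%N.
Proof.
move=> sla ik; rewrite /part; have [kla|kla] := ltnP k.-1 (size la); last by rewrite nth_default.
have := @sorted_leq_nth _ geq _ _ 0%N la sla i.-1 k.-1; rewrite !inE /=.
apply=> //; last lia; last by lia.
- by move=> a b d /= h1 h2; apply: leq_trans h1.
- by move=> a /=.
Qed.

Lemma sorted_filter_iota (P : pred nat) m k :
  (forall i i' i'', (i <= i' <= i'')%N -> P i -> P i'' -> P i') ->
  sorted (fun i i' => i' == i.+1) [seq i <- iota m k | P i].
Proof.
move=> cP; elim: k m => //= k IHk m; case: ifP => // Pm.
case: k IHk => //= k IHk; case: ifP => [Pm1|Pm1].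
  by rewrite /= eqxx; have := IHk m.+1; rewrite /= Pm1.
suff -> : [seq i <- iota m.+2 k | P i] = [::] by [].
apply/eqP; rewrite -[_ == _]negbK -has_filter; apply/hasPn => i; rewrite mem_iota => /andP[mi _].
by apply/negP => Pi; move: Pm1; rewrite (cP m _ i) //; lia.
Qed.

Lemma rows_convex j i i' i'' : (i <= i' <= i'')%N ->
  (part (inner w) i < j <= part (outer w) i)%N ->
  (part (inner w) i'' < j <= part (outer w) i'')%N ->
  (part (inner w) i' < j <= part (outer w) i')%N.
Proof.
move=> /andP[h1 h2] /andP[h3 h4] /andP[h5 h6]; apply/andP; split.
  by apply: leq_ltn_trans h3; apply: part_anti; rewrite ?inner_sorted.
by apply: leq_trans h6 _; apply: part_anti; rewrite ?outer_sorted.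
Qed.

Lemma mem_rows j i : i \in rows j ->
  [/\ (0 < i)%N, (i <= size (outer w))%N & (part (inner w) i < j <= part (outer w) i)%N].
Proof. by rewrite mem_filter mem_iota => /andP[h1 /andP[h2 h3]]; split=> //; lia. Qed.

Lemma head_rows_le j i r : rows j = i :: r -> {in rows j, forall k, (i <= k)%N}.
Proof.
move=> e k; rewrite e in_cons => /orP[/eqP-> //|kr].
have : sorted ltn (rows j) by apply: sorted_filter (iota_ltn_sorted _ _); apply: ltn_trans.
by rewrite e /= => /(order_path_min ltn_trans) /allP /(_ k kr) /ltnW.
Qed.

(** If j' is at most lambda_i, then (i, j') is itself a box of the column j', and the head lies no
    lower. Otherwise lambda_i < j' <= lambda_k, so k < i as lambda decreases. *)
Lemma top_rows_le j j' i k r : (j < j')%N -> i \in rows j -> rows j' = k :: r -> (k <= i)%N.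
Proof.
move=> jj' ij e; have [i0 iN /andP[mi li]] := mem_rows ij.
have [j'li|lij'] := leqP j' (part (outer w) i).
  apply: (head_rows_le e); rewrite mem_filter mem_iota j'li andbT.
  by rewrite (leq_trans mi) //; lia.
have kr : k \in rows j' by rewrite e mem_head.
have [k0 kN /andP[mk lk]] := mem_rows kr.
rewrite leqNgt; apply/negP => ik.
by have := part_anti (outer_sorted w) (ltnW ik); lia.
Qed.

Lemma columns_box b : b \in all_columns -> exists2 j, j \in iota 1 (part (outer w) 1) &
  [seq box p | p <- b] = [seq (i, j) | i <- rows j].
Proof.
move=> bc; have : [seq box p | p <- b] \in box_columns by rewrite -map_all_columns map_f.
by case/mapP => j jI e; exists j.
Qed.

Lemma columns_sub b : b \in columns -> b \in all_columns.
Proof. by rewrite mem_filter => /andP[]. Qed.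

Lemma uniq_boxes : uniq (boxes w).
Proof.
apply: allpairs_uniq_dep; first exact: iota_uniq.
  by move=> j _; apply: filter_uniq; apply: iota_uniq.
by move=> [j i] [j' i'] _ _ [-> ->].
Qed.

Lemma box_inj : injective (@box w).
Proof. by apply/tuple_uniqP; exact: uniq_boxes. Qed.

Lemma mem_column (b : seq 'I_n) p j : [seq box q | q <- b] = [seq (i, j) | i <- rows j] -> p \in b ->
  (box p).2 = j /\ (box p).1 \in rows j.
Proof.
move=> e pb; have : box p \in [seq (i, j) | i <- rows j] by rewrite -e map_f.
by case/mapP => i ir ->.
Qed.

Variable C : numFieldType.

Definition colidx (p : 'I_n) : C := (box p).2%:R.

Lemma good_columns : good (@content C w) colidx columns.
Proof.
split.
- by rewrite flatten_columns enum_uniq.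
- move=> b /columns_sub /columns_box[j _ e].
  have srt : sorted (fun i i' => i' == i.+1) (rows j).
    by apply: sorted_filter_iota => i i' i'' h; apply: rows_convex.
  have : sorted (fun x x' : nat * nat => (x'.1 == x.1.+1) && (x.2 == x'.2)) [seq box p | p <- b].
    rewrite e sorted_map; apply: sub_sorted srt => i i' /=; by rewrite eqxx andbT.
  rewrite sorted_map; apply: sub_sorted => p q /andP[/eqP e1 /eqP e2].
  by rewrite /content e1 e2 -addn1 natrD; apply/eqP; ring.
- move=> b /columns_sub /columns_box[j _ e] p q pb qb.
  by rewrite /colidx (mem_column e pb).1 (mem_column e qb).1.
- move=> p q _ _; apply: contraNT; rewrite negb_or !negbK => /andP[/eqP h1 /eqP h2].
  have h3 : (box p).2 = (box q).2 by apply/eqP; rewrite -(eqr_nat C); apply/eqP.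
  move: h1; rewrite /content h3 => /addrI /oppr_inj /eqP; rewrite eqr_nat => /eqP h4.
  by apply/eqP/box_inj; case: (box p) (box q) h3 h4 => [? ?] [? ?] /= -> ->.
have : pairwise ltn (iota 1 (part (outer w) 1)).
  by rewrite -(sorted_pairwise ltn_trans) iota_ltn_sorted.
rewrite /columns; move: (map_all_columns); rewrite /box_columns.
elim: (iota 1 _) all_columns => [|j js IHjs] [|b bs] //= [e es] /andP[/allP jjs pjs].
have {}IHjs := IHjs bs es pjs.
case: ifP => // bn; split=> // p b' pb; rewrite mem_filter => /andP[b'n b'bs].
have : [seq box q | q <- b'] \in [seq [seq (i, j) | i <- rows j] | j <- js] by rewrite -es map_f.
case/mapP => j' j'js e'; have jj' := jjs _ j'js.
case: b' b'n b'bs e' => // q b' _ _ e'.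
have [p2 p1] := mem_column e pb; have [q2 q1] := mem_column e' (mem_head _ _).
have [k [r er]] : exists k r, rows j' = k :: r.
  by case: (rows j') e' => // k r _; exists k, r.
have qk : (box q).1 = k by move: e'; rewrite er => -[-> _].
have le := top_rows_le jj' p1 er.
(* The contents differ by (j' - j) + (i - k), with j < j' and k <= i for the row i of p. *)
exists (j' - j.+1 + ((box p).1 - k))%N; rewrite /= /content p2 q2 qk.
rewrite -addn1 !natrD !natrB // -(addn1 j) natrD; ring.
Qed.

Lemma size_columns b : b \in columns -> exists j, (size b <= column_length w j)%N.
Proof.
move=> bc; have ub : uniq b.
  have := enum_uniq 'I_n; rewrite -flatten_columns.
  have [s1 [s2 ->]] : exists s1 s2, columns = s1 ++ b :: s2.
    by case/splitPr: bc => s1 s2; exists s1, s2.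
  by rewrite flatten_cat /= !cat_uniq => /and4P[_ _ ].
have [j _ e] := columns_box (columns_sub bc); exists j.
rewrite /column_length -map_box_enum count_map -size_filter uniq_leq_size // => p pb.
by rewrite mem_filter mem_enum andbT /= (mem_column e pb).1.
Qed.

End SkewColumns.

(** * Identification of the value given by the fusion procedure *)

Section FusionValue.
Variables (C : numFieldType) (N : nat).

Lemma tbasis_decomp (J : finType) (phi : tpow C N J) :
  phi = \sum_f (phi : {ffun _ -> C^o}) f *: tbasis C f.
Proof.
apply/ffunP => f; rewrite sum_ffunE (bigD1 f) //= big1 ?addr0 => [|f' ff'].
  by rewrite !ffunE eqxx [_ *: _]mulr1.
by rewrite !ffunE eq_sym (negPf ff') [_ *: _]mulr0.
Qed.

Lemma tbasis_eq (J : finType) (x z : endo (tpow C N J)) :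
  (forall a b, (x (tbasis C b) : {ffun _ -> C^o}) a = (z (tbasis C b) : {ffun _ -> C^o}) a) ->
  x = z.
Proof.
move=> H; apply/lfunP => phi; rewrite [phi]tbasis_decomp !linear_sum; apply: eq_bigr => f _.
by rewrite !linearZ; congr (_ *: _); apply/ffunP => a; apply: H.
Qed.

Lemma Rfus_Rprod (n : nat) (v : 'I_n -> C) :
  Rfus N v = Rprod (@escal C _) (@flip C N 'I_n) v (enum 'I_n).
Proof.
rewrite /Rfus.
have -> : index_enum 'I_n = enum 'I_n by rewrite enumT; reflexivity.
have -> : \prod_(p <- enum 'I_n) \prod_(q <- enum 'I_n | (p < q)%N) (1 - (v p - v q)^-1 *: flip C N p q) =
    \prod_(p <- enum 'I_n) \prod_(q <- enum 'I_n | (p < q)%N)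
      Rv (@escal C _) (@flip C N 'I_n) v p q.
  by do 2!(apply: eq_bigr => ? _); rewrite /Rv escalE.
have : sorted ltn (map val (enum 'I_n)) by rewrite val_enum_ord iota_ltn_sorted.
elim: (enum 'I_n) => [|p s IHs] /= ps; first by rewrite big_nil.
have ps' : all (fun q : 'I_n => p < q)%N s.
  by have := order_path_min ltn_trans ps; rewrite all_map.
have sps : sorted ltn (map val s) by case: (s) ps => //= q s' /andP[].
rewrite big_cons big_cons ltnn -IHs //; congr (_ * _).
  rewrite big_mkcond [RHS]big_seq big_seq; apply: eq_bigr => q qs.
  by rewrite (allP ps').
rewrite big_seq [RHS]big_seq; apply: eq_bigr => q qs; rewrite big_cons.
by rewrite ltnNge ltnW //; apply: (allP ps').
Qed.

Lemma meval_line (J : nat) (c y : 'I_J -> C) (P : {mpoly C[J]}) :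
  exists d : {poly C}, forall e, d.[e] = P.@[ray c y e].
Proof.
exists (\sum_(m <- msupp P) P@_m *: \prod_i ((c i)%:P + (y i) *: 'X) ^+ m i) => e.
rewrite mevalE horner_sum; apply: eq_bigr => m _.
rewrite hornerZ horner_prod; congr (_ * _); apply: eq_bigr => i _.
by rewrite horner_exp hornerD hornerC hornerZ hornerX mulrC.
Qed.

(** The ray with direction given by the column indices stays in [Domega] and has distinct
    coordinates for generic e, where the given quotient num/den equals the fused product. After
    multiplication by den both sides are regular along the ray, so they agree at e = 0, where den
    does not vanish. *)
Lemma fusion_value_unique (w : skew_diagram) (F : endo (tpow C N 'I_(nbox w))) :
  fusion_value F -> F = fusion_op N (@content C w) (columns w).
Proof.
move=> Fv; apply: tbasis_eq => a b.
have gc := good_columns w C.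
set c := @content C w in gc *; set y := @colidx w C in gc.
have [num [den [den0 RF ->]]] := Fv a b.
have [d dE] := meval_line c y den; have [m mE] := meval_line c y num.
have [s0 sP] := sep_polyP (good_sep gc).
have d0 : d.[0] != 0 by rewrite dE ray0.
have dn0 : d != 0 by apply: contraNneq d0 => ->; rewrite horner0.
pose phi (x : endo (tpow C N 'I_(nbox w))) : C := (x (tbasis C b) : {ffun _ -> C^o}) a.
pose kb : {rmorphism C -> C} := idfun.
have kbC (u x : C) : kb u * x = x * kb u by rewrite mulrC.
suff : phi (fusion_op N c (columns w)) * d.[0] - m.[0] = 0.
  move/eqP; rewrite subr_eq0 => /eqP H; apply: (mulIf d0); rewrite [RHS]H.
  by rewrite dE mE ray0 divfK.
pose f e := phi (Rfused (@escal C _) (@flip C N 'I_(nbox w)) (ray c y e) (columns w)) * d.[e] - m.[e].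
have f0E : f 0 = phi (fusion_op N c (columns w)) * d.[0] - m.[0] by rewrite /f ray0.
rewrite -f0E; apply: (@regf_interp _ _ kb kbC f (fun x => x = 0) (sep_poly c y (flatten (columns w)) * d)).
- exact: lin_closed_eq0.
- by rewrite mulf_neq0.
- apply: regf_add => //; last first.
    apply: polyf_reg; apply: (@polyf_ext _ _ _ (fun e => (-1) * kb m.[e])).
      by move=> e; rewrite mulN1r.
    by apply: polyf_mull => //; apply: polyf_scal.
  apply: regf_mul => //; last by apply: polyf_reg; apply: (polyf_scal kbC).
  apply: (@regf_map _ _ _ (@escal C _) kb phi).
  - by move=> u x z; rewrite /phi add_lfunE ffunE escal_app.
  - by rewrite /phi zero_lfunE ffunE.
  by apply: regf_Rfused => //; exact: escalC.
move=> e; rewrite hornerM mulf_eq0 negb_or => /andP[se de].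
have vi := sP e se.
have viT : injective (ray c y e).
  by move=> p q; apply: vi; rewrite flatten_columns mem_enum.
rewrite /f -(Rprod_Rfused_ray (@escalC _ _)) //; last first.
- exact: flip_comm.
- exact: flipJ'.
- exact: flipC.
- by move=> p q _; apply: flip2.
rewrite flatten_columns -Rfus_Rprod /phi RF -?dE //.
  by rewrite -mE divfK // subrr.
by move=> p q pq; rewrite /ray /y /colidx /c pq; ring.
Qed.

End FusionValue.

(** * Series in u^-1 and the reflection equation *)

Definition series (A : Type) : Type := nat -> A.

Section SeriesRing.
Variable A : pzRingType.
Implicit Types f g h : series A.

HB.instance Definition _ := gen_eqMixin (series A).
HB.instance Definition _ := gen_choiceMixin (series A).

Let add f g : series A := fun k => f k + g k.
Let opp f : series A := fun k => - f k.
Let zero : series A := fun=> 0.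

Let addA : associative add.
Proof. by move=> f g h; apply: funext => k; apply: addrA. Qed.
Let addC : commutative add.
Proof. by move=> f g; apply: funext => k; apply: addrC. Qed.
Let add0 : left_id zero add.
Proof. by move=> f; apply: funext => k; apply: add0r. Qed.
Let addN : left_inverse zero opp add.
Proof. by move=> f; apply: funext => k; apply: addNr. Qed.

HB.instance Definition _ := GRing.isZmodule.Build (series A) addA addC add0 addN.

Lemma series_add f g k : (f + g) k = f k + g k. Proof. by []. Qed.
Lemma series_opp f k : (- f) k = - f k. Proof. by []. Qed.
Lemma series_sum I (r : seq I) (P : pred I) (F : I -> series A) k :
  (\sum_(i <- r | P i) F i) k = \sum_(i <- r | P i) F i k.
Proof. by apply: (big_morph (fun f : series A => f k)). Qed.

Lemma smul_rev f g k : smul f g k = \sum_(i < k.+1) f (k - i)%N * g i.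
Proof.
rewrite /smul (reindex_inj rev_ord_inj) /=; apply: eq_bigr => i _.
by rewrite subSS subKn // -ltnS.
Qed.

Let mulA : associative (@smul A).
Proof.
move=> f g h; apply: funext => k; rewrite [RHS]smul_rev {1}/smul.
pose coef3 i j := f i * (g (k - i - j)%N * h j).
transitivity (\sum_(i < k.+1) \sum_(j < k.+1 | (j <= k - i)%N) coef3 i j).
  apply: eq_bigr => i _; rewrite smul_rev (big_ord_narrow_leq (leq_subr _ _)) /=.
  by rewrite mulr_sumr.
rewrite (exchange_big_dep predT) //=; apply: eq_bigr => j _.
transitivity (\sum_(i < k.+1 | (i <= k - j)%N) coef3 i j).
  by apply: eq_bigl => i /=; rewrite -ltnS -(ltnS i) -!subSn // ?leq_ord // ltn_subCr.
rewrite (big_ord_narrow_leq (leq_subr _ _)) /smul mulr_suml /=; apply: eq_bigr => i _.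
by rewrite /coef3 -!subnDA addnC mulrA.
Qed.

Let mul1 : left_id (sone A) (@smul A).
Proof.
move=> f; apply: funext => k; rewrite /smul big_ord_recl big1 ?addr0 => [|i _].
  by rewrite /sone eqxx mul1r subn0.
by rewrite /sone mul0r.
Qed.

Let mulr1' : right_id (sone A) (@smul A).
Proof.
move=> f; apply: funext => k; rewrite smul_rev big_ord_recl big1 ?addr0 => [|i _].
  by rewrite /sone eqxx mulr1 subn0.
by rewrite /sone mulr0.
Qed.

Let mulDl : left_distributive (@smul A : series A -> series A -> series A) +%R.
Proof.
move=> f g h; apply: funext => k; rewrite series_add /smul -big_split.
by apply: eq_bigr => i _; rewrite series_add mulrDl.
Qed.

Let mulDr : right_distributive (@smul A : series A -> series A -> series A) +%R.
Proof.
move=> f g h; apply: funext => k; rewrite series_add /smul -big_split.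
by apply: eq_bigr => i _; rewrite series_add mulrDr.
Qed.

HB.instance Definition _ :=
  GRing.Zmodule_isPzRing.Build (series A) mulA mul1 mulr1' mulDl mulDr.

Lemma series_mul f g k : (f * g) k = \sum_(i < k.+1) f i * g (k - i)%N.
Proof. by []. Qed.

Lemma series_mul_rev f g k : (f * g) k = \sum_(i < k.+1) f (k - i)%N * g i.
Proof. exact: smul_rev. Qed.

Lemma series_1 k : (1 : series A) k = (k == 0%N)%:R. Proof. by []. Qed.

Lemma series_mul0 f g : (f * g) 0%N = f 0%N * g 0%N.
Proof. by rewrite series_mul big_ord_recl big_ord0 addr0. Qed.

Definition cst_fun (a : A) : series A := fun k => if k is 0 then a else 0.

Lemma cst_additive : zmod_morphism cst_fun.
Proof. by move=> a b; apply: funext => -[|k]; rewrite series_add series_opp /= ?subr0. Qed.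

Lemma cst_multiplicative : monoid_morphism cst_fun.
Proof.
split=> [|a b]; apply: funext => -[|k] //; first by rewrite series_mul0.
by rewrite series_mul big1 // => -[[|i] lt_i] _ /=; rewrite ?subn0 /= ?mulr0 ?mul0r.
Qed.

HB.instance Definition _ := GRing.isZmodMorphism.Build A (series A) cst_fun cst_additive.
HB.instance Definition _ := GRing.isMonoidMorphism.Build A (series A) cst_fun cst_multiplicative.
Definition cst : {rmorphism A -> series A} := cst_fun.

Lemma cst_mulE a f k : (cst a * f) k = a * f k.
Proof. by rewrite series_mul big_ord_recl big1 ?addr0 ?subn0 // => i _; rewrite mul0r. Qed.

Lemma mul_cstE a f k : (f * cst a) k = f k * a.
Proof. by rewrite series_mul_rev big_ord_recl big1 ?addr0 ?subn0 // => i _; rewrite mulr0. Qed.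

End SeriesRing.
Arguments cst {A}.

Section SeriesMap.
Variables (A B : pzRingType) (phi : {rmorphism A -> B}).

Definition smap_fun (f : series A) : series B := fun k => phi (f k).

Lemma smap_additive : zmod_morphism smap_fun.
Proof. by move=> f g; apply: funext => k; rewrite /smap_fun series_add series_opp rmorphB. Qed.

Lemma smap_multiplicative : monoid_morphism smap_fun.
Proof.
split=> [|f g]; apply: funext => k; rewrite /smap_fun; first by rewrite !series_1 rmorph_nat.
by rewrite !series_mul rmorph_sum; apply: eq_bigr => i _; rewrite rmorphM.
Qed.

HB.instance Definition _ :=
  GRing.isZmodMorphism.Build (series A) (series B) smap_fun smap_additive.
HB.instance Definition _ :=
  GRing.isMonoidMorphism.Build (series A) (series B) smap_fun smap_multiplicative.
Definition smap : {rmorphism series A -> series B} := smap_fun.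

End SeriesMap.
Arguments smap {A B} phi.

Section PolySeries.
Variables (K : comNzRingType) (A : pzRingType) (phi : {rmorphism K -> A}).

Definition pser_fun (p : {poly K}) : series A := fun k => phi p`_k.

Lemma pser_additive : zmod_morphism pser_fun.
Proof. by move=> p q; apply: funext => k; rewrite /pser_fun series_add series_opp coefB rmorphB. Qed.

Lemma pser_multiplicative : monoid_morphism pser_fun.
Proof.
split=> [|p q]; apply: funext => k; rewrite /pser_fun; first by rewrite coef1 rmorph_nat.
by rewrite coefM series_mul rmorph_sum; apply: eq_bigr => i _; rewrite rmorphM.
Qed.

HB.instance Definition _ := GRing.isZmodMorphism.Build {poly K} (series A) pser_fun pser_additive.
HB.instance Definition _ :=
  GRing.isMonoidMorphism.Build {poly K} (series A) pser_fun pser_multiplicative.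
Definition pser : {rmorphism {poly K} -> series A} := pser_fun.

Hypothesis phiC : forall c x, phi c * x = x * phi c.

Lemma pserC p f : pser p * f = f * pser p.
Proof.
apply: funext => k; rewrite [RHS]series_mul_rev series_mul.
rewrite (reindex_inj rev_ord_inj) [RHS](reindex_inj rev_ord_inj) /=.
by apply: eq_bigr => i _; rewrite phiC subKn // -ltnS.
Qed.

End PolySeries.
Arguments pser {K A} phi.

Lemma smul2E (A : pzRingType) (f g : nat -> nat -> A) :
  smul2 f g = (f : series (series A)) * (g : series (series A)).
Proof.
apply: funext => r; apply: funext => s; rewrite series_mul series_sum.
by apply: eq_bigr => i _; rewrite series_mul.
Qed.

Lemma smul2_4E (A : pzRingType) (f g h k : series (series A)) :
  smul2 f (smul2 g (smul2 h k)) = f * (g * (h * k)).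
Proof. by rewrite !smul2E. Qed.

Section LinearFactors.
Variables (C : fieldType) (A : pzRingType) (ka : {rmorphism C -> A}).
Hypothesis kaC : forall c x, ka c * x = x * ka c.

(** Each R-matrix factor is [geo a * lin x], where [geo a] is the expansion of (1 - a/u)^-1 and
    [lin x] is 1 + x/u. As [geo a] is central, the defining relations reduce to identities between
    linear forms. *)
Definition geo (a : C) : series A := fun k => ka (a ^+ k).
Definition lin (x : A) : series A := fun k => match k with 0 => 1 | 1 => x | _ => 0 end.

Lemma geoC a (f : series A) : geo a * f = f * geo a.
Proof.
apply: funext => k; rewrite [RHS]series_mul_rev series_mul.
by apply: eq_bigr => i _; rewrite kaC.
Qed.

Lemma mul_linE (x : A) (f : series A) k : (f * lin x) k.+1 = f k.+1 + f k * x.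
Proof.
rewrite series_mul_rev !big_ord_recl big1 ?addr0 => [|i _]; last by rewrite mulr0.
by rewrite subn0 mulr1 /= subSS subn0.
Qed.

Lemma lin_mulE (x : A) (f : series A) k : (lin x * f) k.+1 = f k.+1 + x * f k.
Proof.
rewrite series_mul !big_ord_recl big1 ?addr0 => [|i _]; last by rewrite mul0r.
by rewrite subn0 mul1r /= subSS subn0.
Qed.

Lemma geo_lin a x (f : series A) : f 0%N = 1 -> (forall k, f k.+1 = ka (a ^+ k) * x) ->
  f = geo a * lin (x - ka a).
Proof.
move=> f0 fS; apply: funext => -[|k]; first by rewrite series_mul0 mulr1 /geo expr0 rmorph1.
by rewrite mul_linE fS /geo mulrBr exprSr rmorphM addrC subrK.
Qed.

Lemma scal_oppr a (x : A) : ka a * - x = ka (- a) * x.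
Proof. by rewrite rmorphN mulrN mulNr. Qed.

Lemma scal_sign k a (x : A) : (-1) ^+ k.+1 * (ka (- a ^+ k) * x) = ka ((- a) ^+ k) * x.
Proof.
rewrite mulrA -(rmorphN1 ka) -rmorphXn -rmorphM; congr (ka _ * _).
by rewrite exprS mulN1r mulrNN -exprNn.
Qed.

End LinearFactors.

Lemma sum_if_eq (V : nmodType) (I : finType) (i : I) (F : I -> V) :
  \sum_j (if i == j then F j else 0) = F i.
Proof. by rewrite -big_mkcond /= (eq_bigl (pred1 i)) ?big_pred1_eq // => j; rewrite eq_sym. Qed.

Lemma sum_only (V : nmodType) (I : finType) (i : I) (F : I -> V) :
  (forall j, j != i -> F j = 0) -> \sum_j F j = F i.
Proof. by move=> fusion_op; rewrite (bigD1 i) //= big1 ?addr0. Qed.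

(** * Two auxiliary matrix factors *)

Section TwoFactors.
Variables (C : fieldType) (N : nat) (W : vectType C).
Notation E0 := (endo W).
Notation M1 := 'M[endo W]_N.
Notation M2 := 'M['M[endo W]_N]_N.

(** X a b c d is the coefficient of e_ab (x) e_cd. *)
Definition mk4 (X : 'I_N -> 'I_N -> 'I_N -> 'I_N -> E0) : M2 :=
  \matrix_(a, b) \matrix_(c, d) X a b c d.

Lemma mk4_eq X Y : (forall a b c d, X a b c d = Y a b c d) -> mk4 X = mk4 Y.
Proof. by move=> XY; apply/matrixP => a b; apply/matrixP => c d; rewrite !mxE. Qed.

Lemma mk4M X Y :
  mk4 X * mk4 Y = mk4 (fun a b c d => \sum_e \sum_h X a e c h * Y e b h d).
Proof.
apply/matrixP => a b; rewrite -mulmxE mxE; apply/matrixP => c d; rewrite summxE !mxE.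
by apply: eq_bigr => e _; rewrite -mulmxE !mxE; apply: eq_bigr => h _; rewrite !mxE.
Qed.

Definition left_fun (X : M1) : M2 := map_mx (@smx C W N) X.

Lemma left_additive : zmod_morphism left_fun.
Proof. by move=> X Y; rewrite /left_fun map_mxB. Qed.

Lemma left_multiplicative : monoid_morphism left_fun.
Proof. by split=> [|X Y]; rewrite /left_fun ?map_mx1 // -!mulmxE map_mxM. Qed.

HB.instance Definition _ := GRing.isZmodMorphism.Build M1 M2 left_fun left_additive.
HB.instance Definition _ := GRing.isMonoidMorphism.Build M1 M2 left_fun left_multiplicative.
Definition left : {rmorphism M1 -> M2} := left_fun.

Definition right_fun (X : M1) : M2 := X%:M.

Lemma right_additive : zmod_morphism right_fun.
Proof. by move=> X Y; rewrite /right_fun raddfB. Qed.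

Lemma right_multiplicative : monoid_morphism right_fun.
Proof. by split=> [|X Y] //; rewrite /right_fun scalar_mxM. Qed.

HB.instance Definition _ := GRing.isZmodMorphism.Build M1 M2 right_fun right_additive.
HB.instance Definition _ := GRing.isMonoidMorphism.Build M1 M2 right_fun right_multiplicative.
Definition right : {rmorphism M1 -> M2} := right_fun.

Lemma leftE X : left X = mk4 (fun a b c d => if c == d then X a b else 0).
Proof.
apply/matrixP => a b; apply/matrixP => c d; rewrite !mxE /=.
by case: eqP.
Qed.

Lemma rightE X : right X = mk4 (fun a b c d => if a == b then X c d else 0).
Proof.
apply/matrixP => a b; apply/matrixP => c d; rewrite !mxE.
by case: eqP; rewrite ?mulr1n // mulr0n mxE.
Qed.

Definition scal2_fun (a : C) : M2 := right (@mscal C W N a).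

Lemma scal2_additive : zmod_morphism scal2_fun.
Proof. by move=> a b; rewrite /scal2_fun !rmorphB. Qed.

Lemma scal2_multiplicative : monoid_morphism scal2_fun.
Proof. by split=> [|a b]; rewrite /scal2_fun ?rmorph1 // !rmorphM. Qed.

HB.instance Definition _ := GRing.isZmodMorphism.Build C M2 scal2_fun scal2_additive.
HB.instance Definition _ := GRing.isMonoidMorphism.Build C M2 scal2_fun scal2_multiplicative.
Definition scal2 : {rmorphism C -> M2} := scal2_fun.

Lemma scal2_left a : scal2 a = left (@mscal C W N a).
Proof.
rewrite leftE /= /scal2_fun rightE; apply: mk4_eq => i j k h.
by rewrite mscal_def !mxE; do 2!case: eqP.
Qed.

Lemma scal2_right a : scal2 a = right (@mscal C W N a).
Proof. by []. Qed.

Lemma scal2C a X : scal2 a * X = X * scal2 a.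
Proof.
apply/matrixP => i j; rewrite scal2_right /= /right_fun -!mulmxE mul_scalar_mx mxE.
rewrite mxE (bigD1 j) //= big1 ?addr0 => [|k kj]; last first.
  by rewrite !mxE (negPf kj) mulr0n mulr0.
by rewrite mxE eqxx mulr1n mscalC.
Qed.

Lemma sum_tens2E (X : 'I_N -> 'I_N -> 'M[C]_N) a b c d :
  (\sum_i \sum_j tens2 W (X i j) (delta_mx j i)) a b c d = X d c a b *: (1 : E0).
Proof.
transitivity (\sum_i \sum_j (if d == i then if c == j then X d c a b *: (1 : E0) else 0 else 0)).
  rewrite !summxE; apply: eq_bigr => i _; rewrite !summxE; apply: eq_bigr => j _.
  rewrite !mxE; do 2!case: eqP => [<-|_]; rewrite ?mulr1 ?mulr0 ?scale0r //.
rewrite -[RHS](sum_if_eq d (fun=> X d c a b *: (1 : E0))); apply: eq_bigr => i _.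
by case: eqP => _; [apply: (sum_if_eq c (fun=> _)) | rewrite big1].
Qed.

Lemma PmxE : Pmx N W = mk4 (fun a b c d => if a == d then if b == c then 1 else 0 else 0).
Proof.
apply/matrixP => a b; apply/matrixP => c d; rewrite /Pmx sum_tens2E !mxE.
by do 2!case: eqP; rewrite ?scale1r ?scale0r.
Qed.

Lemma Pmx_conj X : Pmx N W * mk4 X = mk4 (fun a b c d => X c b a d).
Proof.
rewrite PmxE mk4M; apply: mk4_eq => a b c d.
rewrite -[RHS](sum_if_eq c (fun e => X e b a d)); apply: eq_bigr => e _.
rewrite -[RHS](sum_if_eq a (fun h => if c == e then X e b h d else 0)); apply: eq_bigr => h _.
by rewrite [e == c]eq_sym; case: eqP => _; try case: eqP => _; rewrite ?mul1r ?mul0r.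
Qed.

Lemma mul_PmxE X : mk4 X * Pmx N W = mk4 (fun a b c d => X a d c b).
Proof.
rewrite PmxE mk4M; apply: mk4_eq => a b c d.
rewrite -[RHS](sum_if_eq d (fun e => X a e c b)); apply: eq_bigr => e _.
rewrite -[RHS](sum_if_eq b (fun h => if d == e then X a e c h else 0)); apply: eq_bigr => h _.
by rewrite [e == d]eq_sym; case: eqP => _; try case: eqP => _; rewrite ?mulr1 ?mulr0.
Qed.

Lemma Pmx2 : Pmx N W * Pmx N W = 1.
Proof.
rewrite {2}PmxE Pmx_conj -[RHS](rmorph1 right) rightE; apply: mk4_eq => a b c d.
by rewrite mxE [b == a]eq_sym; do 2!case: eqP.
Qed.

Lemma Pmx_left X : Pmx N W * left X = right X * Pmx N W.
Proof. by rewrite leftE rightE Pmx_conj mul_PmxE; apply: mk4_eq => a b c d. Qed.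

Lemma Pmx_right X : Pmx N W * right X = left X * Pmx N W.
Proof. by rewrite leftE rightE Pmx_conj mul_PmxE; apply: mk4_eq => a b c d. Qed.

Lemma mul_leftr X Y : left X * right Y = mk4 (fun a b c d => X a b * Y c d).
Proof.
rewrite leftE rightE mk4M; apply: mk4_eq => a b c d.
rewrite -[RHS](sum_if_eq b (fun e => X a e * Y c d)); apply: eq_bigr => e _.
rewrite -[RHS](sum_if_eq c (fun h => if b == e then X a e * Y h d else 0)); apply: eq_bigr => h _.
by rewrite [e == b]eq_sym; case: eqP => _; try case: eqP => _; rewrite ?mulr0 ?mul0r.
Qed.

Lemma mul_rightl X Y : right Y * left X = mk4 (fun a b c d => Y c d * X a b).
Proof.
rewrite leftE rightE mk4M; apply: mk4_eq => a b c d.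
rewrite -[RHS](sum_if_eq a (fun e => Y c d * X e b)); apply: eq_bigr => e _.
rewrite -[RHS](sum_if_eq d (fun h => if a == e then Y c h * X e b else 0)); apply: eq_bigr => h _.
by rewrite [h == d]eq_sym; case: eqP => _; try case: eqP => _; rewrite ?mulr0 ?mul0r.
Qed.

Lemma right_mk4 X Y : right X * mk4 Y = mk4 (fun a b c d => \sum_h X c h * Y a b h d).
Proof.
rewrite rightE mk4M; apply: mk4_eq => a b c d.
rewrite -[RHS](sum_if_eq a (fun e => \sum_h X c h * Y e b h d)); apply: eq_bigr => e _.
by case: eqP => _ //; rewrite big1 // => h _; rewrite mul0r.
Qed.

Lemma left_mk4 X Y : left X * mk4 Y = mk4 (fun a b c d => \sum_e X a e * Y e b c d).
Proof.
rewrite leftE mk4M; apply: mk4_eq => a b c d; apply: eq_bigr => e _.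
rewrite -[RHS](sum_if_eq c (fun h => X a e * Y e b h d)); apply: eq_bigr => h _.
by case: eqP => _; rewrite ?mul0r.
Qed.

Lemma mk4_right X Y : mk4 Y * right X = mk4 (fun a b c d => \sum_h Y a b c h * X h d).
Proof.
rewrite rightE mk4M; apply: mk4_eq => a b c d.
rewrite -[RHS](sum_if_eq b (fun e => \sum_h Y a e c h * X h d)); apply: eq_bigr => e _.
by rewrite [e == b]eq_sym; case: eqP => _ //; rewrite big1 // => h _; rewrite mulr0.
Qed.

Lemma mk4_left X Y : mk4 Y * left X = mk4 (fun a b c d => \sum_e Y a e c d * X e b).
Proof.
rewrite leftE mk4M; apply: mk4_eq => a b c d; apply: eq_bigr => e _.
rewrite -[RHS](sum_if_eq d (fun h => Y a e c h * X e b)); apply: eq_bigr => h _.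
by rewrite [h == d]eq_sym; case: eqP => _; rewrite ?mulr0.
Qed.

End TwoFactors.

(** * Relations among the flips and their partial transposes *)

Section Relations.
Variables (C : fieldType) (N : nat) (J : finType) (g : 'M[C]_N).
Hypothesis g_unit : g \in unitmx.
Hypothesis g_sym : g^T = g \/ g^T = - g.
Notation W := (tpow C N J).
Notation E0 := (endo W).
Notation M1 := 'M[endo W]_N.
Notation site := (@site C N J).
Notation P0 := (@P0 C N J).
Notation left := (@left C N W).
Notation right := (@right C N W).
Notation P12 := (@Pmx C N W).
Notation Q12 := (@Qmx C N g W).
Notation gi := (invmx g).

Definition Q0 p : M1 := tr_t1 g (P0 p).

Lemma tr_tE i j a b : tr_t g (delta_mx i j) a b = g a j * gi i b.
Proof.
rewrite /tr_t trmx_delta mxE (bigD1 i) //= big1 ?addr0 => [|k ki]; last first.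
  rewrite mxE big1 ?mul0r // => h _; rewrite mxE [k == i](negPf ki) andbF mulr0 //.
congr (_ * _); rewrite mxE (bigD1 j) //= big1 ?addr0 => [|k kj]; first by rewrite mxE !eqxx mulr1.
by rewrite mxE (negPf kj) mulr0.
Qed.

Lemma tr_t1E X a b : tr_t1 (W := W) g X a b = \sum_i \sum_j (g a j * gi i b) *: X i j.
Proof.
rewrite summxE; apply: eq_bigr => i _; rewrite summxE; apply: eq_bigr => j _.
by rewrite mxE tr_tE.
Qed.

(** The matrix at the site p in the entry (a, b) of Q_{0p}; Q_{0p} itself is P_{0p} with t applied
    to the auxiliary factor. *)
Definition Mq a b : 'M[C]_N := \matrix_(j, i) (g a j * gi i b).

Lemma Q0E p a b : Q0 p a b = site p (Mq a b).
Proof.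
rewrite tr_t1E [Mq a b]matrix_sum_delta linear_sum exchange_big /=; apply: eq_bigr => j _.
by rewrite linear_sum; apply: eq_bigr => i _; rewrite !mxE linearZ.
Qed.

Lemma QmxE : Q12 = mk4 (fun a b c d => (g a c * gi d b) *: (1 : E0)).
Proof.
apply/matrixP => a b; apply/matrixP => c d.
by rewrite /Qmx (sum_tens2E W (fun i j => tr_t g (delta_mx i j))) tr_tE !mxE.
Qed.

Lemma P0E p a b : P0 p a b = site p (delta_mx b a).
Proof. by rewrite mxE. Qed.

Lemma gK a b : \sum_i gi a i * g i b = (a == b)%:R.
Proof. by have := congr1 (fun X : 'M_N => X a b) (mulVmx g_unit); rewrite !mxE. Qed.

Lemma giK a b : \sum_i g a i * gi i b = (a == b)%:R.
Proof. by have := congr1 (fun X : 'M_N => X a b) (mulmxV g_unit); rewrite !mxE. Qed.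

Lemma left_P0_right p : left (P0 p) * right (P0 p) = right (P0 p) * P12.
Proof.
rewrite mul_leftr [right _]rightE mul_PmxE; apply: mk4_eq => a b c d.
rewrite !P0E siteM mul_delta_mx_cond eq_sym; case: eqP => _ //; last by rewrite mulr0n linear0.
Qed.

Lemma right_P0_left p : right (P0 p) * left (P0 p) = P12 * right (P0 p).
Proof.
rewrite mul_rightl [right _]rightE Pmx_conj; apply: mk4_eq => a b c d.
rewrite !P0E siteM mul_delta_mx_cond eq_sym; case: eqP => _ //.
by rewrite mulr0n linear0.
Qed.

Lemma Mq_delta (a b c d : 'I_N) : Mq a b *m delta_mx d c = \sum_h (g a h * gi d b) *: delta_mx h c.
Proof.
apply/matrixP => j k; rewrite mxE summxE [LHS](sum_only (i := d)) => [|i id]; last first.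
  by rewrite !mxE (negPf id) mulr0.
rewrite (sum_only (i := j)) => [|i ij]; last first.
  by rewrite !mxE eq_sym (negPf ij) mulr0.
by rewrite !mxE !eqxx.
Qed.

Lemma delta_Mq (a b c d : 'I_N) : delta_mx d c *m Mq a b = \sum_h (g a c * gi h b) *: delta_mx d h.
Proof.
apply/matrixP => j k; rewrite mxE summxE [LHS](sum_only (i := c)) => [|i ic]; last first.
  by rewrite mxE (negPf ic) andbF mul0r.
rewrite (sum_only (i := k)) => [|i ik]; last first.
  by rewrite !mxE [k == i]eq_sym (negPf ik) andbF mulr0.
by rewrite !mxE !eqxx !andbT mulrC.
Qed.

Lemma Mq_suml (a b c d : 'I_N) : \sum_e (g e c * gi d b) *: Mq a e = Mq a b *m delta_mx d c.
Proof.
apply/matrixP => j k; rewrite summxE mxE [RHS](sum_only (i := d)) => [|i id].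
  under eq_bigr do rewrite !mxE.
  transitivity (g a j * gi d b * \sum_e (gi k e * g e c)).
    by rewrite mulr_sumr; apply: eq_bigr => e _; ring.
  by rewrite gK !mxE eqxx.
by rewrite !mxE (negPf id) mulr0.
Qed.

Lemma Mq_sumr (a b c d : 'I_N) : \sum_e (g a c * gi d e) *: Mq e b = delta_mx d c *m Mq a b.
Proof.
apply/matrixP => j k; rewrite summxE mxE [RHS](sum_only (i := c)) => [|i ic].
  under eq_bigr do rewrite !mxE.
  transitivity (g a c * gi k b * \sum_e (gi d e * g e j)).
    by rewrite mulr_sumr; apply: eq_bigr => e _; ring.
  by rewrite gK !mxE eqxx andbT eq_sym; ring.
by rewrite mxE (negPf ic) andbF mul0r.
Qed.

Lemma MqM a b c d : Mq a b *m Mq c d = (c == b)%:R *: Mq a d.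
Proof.
apply/matrixP => j k; rewrite mxE; under eq_bigr do rewrite !mxE.
rewrite !mxE; transitivity (g a j * gi k d * \sum_i (g c i * gi i b)).
  by rewrite mulr_sumr; apply: eq_bigr => e _; ring.
by rewrite giK; ring.
Qed.

Lemma right_P0_Q p : right (P0 p) * Q12 = left (Q0 p) * right (P0 p).
Proof.
rewrite QmxE right_mk4 mul_leftr; apply: mk4_eq => a b c d.
rewrite Q0E P0E siteM Mq_delta linear_sum; apply: eq_bigr => h _.
by rewrite P0E endoZr mulr1 linearZ.
Qed.

Lemma left_Q0_Q p : left (Q0 p) * Q12 = left (Q0 p) * right (P0 p).
Proof.
rewrite QmxE left_mk4 mul_leftr; apply: mk4_eq => a b c d.
rewrite Q0E P0E siteM -Mq_suml linear_sum; apply: eq_bigr => h _.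
by rewrite Q0E endoZr mulr1 linearZ.
Qed.

Lemma Q_right_P0 p : Q12 * right (P0 p) = right (P0 p) * left (Q0 p).
Proof.
rewrite QmxE mk4_right mul_rightl; apply: mk4_eq => a b c d.
rewrite Q0E P0E siteM delta_Mq linear_sum; apply: eq_bigr => h _.
by rewrite P0E endoZl mul1r linearZ.
Qed.

Lemma Q_left_Q0 p : Q12 * left (Q0 p) = right (P0 p) * left (Q0 p).
Proof.
rewrite QmxE mk4_left mul_rightl; apply: mk4_eq => a b c d.
rewrite Q0E P0E siteM -Mq_sumr linear_sum; apply: eq_bigr => h _.
by rewrite Q0E endoZl mul1r linearZ.
Qed.

Lemma left_Q0_right p : left (Q0 p) * right (Q0 p) = P12 * right (Q0 p).
Proof.
rewrite mul_leftr [right _]rightE Pmx_conj; apply: mk4_eq => a b c d.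
rewrite !Q0E siteM MqM; case: eqP => _; first by rewrite scale1r.
by rewrite scale0r linear0.
Qed.

Lemma right_Q0_left p : right (Q0 p) * left (Q0 p) = right (Q0 p) * P12.
Proof.
rewrite mul_rightl [right _]rightE mul_PmxE; apply: mk4_eq => a b c d.
rewrite !Q0E siteM MqM [a == d]eq_sym [d == a]eq_sym; case: eqP => _; first by rewrite scale1r.
by rewrite scale0r linear0.
Qed.

(** Conjugation of Q by the flip transposes both g and its inverse. When g is skew-symmetric, so is
    its inverse, and the two signs cancel. *)
Lemma Q_sym : P12 * Q12 = Q12 * P12.
Proof.
rewrite QmxE Pmx_conj mul_PmxE; apply: mk4_eq => a b c d; congr (_ *: _).
have giT : gi^T = invmx g^T by rewrite trmx_inv.
case: g_sym => gT.
  have gE i j : g i j = g j i by rewrite -[in RHS]gT mxE.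
  have giE i j : gi i j = gi j i by rewrite -{1}gT -giT mxE.
  by rewrite gE giE.
have gE i j : g i j = - g j i by have := congr1 (fun X : 'M_N => X j i) gT; rewrite !mxE.
have giE i j : gi i j = - gi j i.
  have : gi^T = - gi.
    have h : g *m gi^T = - 1%:M.
      by have := trmx_mul gi g; rewrite mulVmx // trmx1 gT mulNmx => ->; rewrite opprK.
    by rewrite -[gi^T](mulKmx g_unit) h mulmxN mulmx1.
  by move=> /(congr1 (fun X : 'M_N => X j i)); rewrite !mxE.
by rewrite gE giE mulrNN.
Qed.

End Relations.

Lemma central_series (A : pzRingType) (f : series A) :
  (forall k x, f k * x = x * f k) -> forall h, f * h = h * f.
Proof.
move=> fC h; apply: funext => k; rewrite [RHS]series_mul_rev series_mul.
by apply: eq_bigr => i _; rewrite fC.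
Qed.

Section AbstractReflection.
Variables (E : pzRingType) (J : eqType) (R R' : E) (a1 a2 b1 b2 : J -> E) (s : seq J).
Hypothesis us : uniq s.
Hypothesis Raa : forall p, R * (a1 p * a2 p) = a2 p * (a1 p * R).
Hypothesis Rbb : forall p, R * (b1 p * b2 p) = b2 p * (b1 p * R).
Hypothesis bRa : forall p, b1 p * (R' * a2 p) = a2 p * (R' * b1 p).
Hypothesis aRb : forall p, a1 p * (R' * b2 p) = b2 p * (R' * a1 p).
Hypothesis RR' : R * R' = R' * R.
Hypothesis aaC : forall p q, p != q -> a1 p * a2 q = a2 q * a1 p.
Hypothesis bbC : forall p q, p != q -> b1 p * b2 q = b2 q * b1 p.
Hypothesis baC : forall p q, p != q -> b1 p * a2 q = a2 q * b1 p.
Hypothesis abC : forall p q, p != q -> a1 p * b2 q = b2 q * a1 p.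

Lemma abstract_rtt : R * (\prod_(p <- s) a1 p * \prod_(p <- s) a2 p) =
  \prod_(p <- s) a2 p * (\prod_(p <- s) a1 p * R).
Proof. by apply: prod_exchange => // p q _ _; apply: aaC. Qed.

(** Here a_i stands for the factors of T and b_i for those of T^t(-u), in the auxiliary factor i.
    The order is exchanged by five relations in turn: A1 R' B2, then R B1 B2, then R R', then R A1
    A2, and finally B1 R' A2. *)
Lemma abstract_reflection :
  let S1 := \prod_(p <- rev s) b1 p * \prod_(p <- s) a1 p in
  let S2 := \prod_(p <- rev s) b2 p * \prod_(p <- s) a2 p in
  R * (S1 * (R' * S2)) = S2 * (R' * (S1 * R)).
Proof.
set A1 := \prod_(p <- s) a1 p; set A2 := \prod_(p <- s) a2 p.
set B1 := \prod_(p <- rev s) b1 p; set B2 := \prod_(p <- rev s) b2 p => /=.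
have RA : R * (A1 * A2) = A2 * (A1 * R) := abstract_rtt.
have RB : R * (B1 * B2) = B2 * (B1 * R).
  by apply: prod_exchange => [||p q _ _ pq]; rewrite ?rev_uniq //; apply: bbC.
have BA : B1 * (R' * A2) = A2 * (R' * B1).
  by apply: prod_exchange_rev => // p q _ _; apply: baC.
have AB : A1 * (R' * B2) = B2 * (R' * A1).
  symmetry; apply: prod_exchange_rev => // p q _ _ pq.
  by rewrite abC // eq_sym.
transitivity (R * (B1 * (A1 * (R' * B2)) * A2)); first by rewrite !mulrA.
rewrite AB; transitivity (R * (B1 * B2) * (R' * A1 * A2)); first by rewrite !mulrA.
rewrite RB; transitivity (B2 * (B1 * (R * R') * (A1 * A2))); first by rewrite !mulrA.
rewrite RR'; transitivity (B2 * (B1 * R' * (R * (A1 * A2)))); first by rewrite !mulrA.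
rewrite RA; transitivity (B2 * ((B1 * (R' * A2)) * (A1 * R))); first by rewrite !mulrA.
by rewrite BA !mulrA.
Qed.

End AbstractReflection.

Section CentralFactors.
Variables (E : pzRingType) (c1 c2 z A B : E).
Hypothesis c1C : forall x, c1 * x = x * c1.
Hypothesis c2C : forall x, c2 * x = x * c2.

Lemma central_exchange : z * (A * B) = B * (A * z) ->
  z * ((c1 * A) * (c2 * B)) = (c2 * B) * ((c1 * A) * z).
Proof.
move=> H; transitivity (c1 * (c2 * (z * (A * B)))).
  by rewrite -(mulrA c1) (mulrA A) -c2C -(mulrA c2) !(mulrA z) -c1C -!mulrA (mulrA z) -c2C -!mulrA.
rewrite H -(mulrA c1 A) -[RHS]mulrA (mulrA B c1) -c1C -(mulrA c1 B).
by rewrite (mulrA c2 c1) (c2C c1) -mulrA.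
Qed.

Lemma central_exchange_mid : A * (z * B) = B * (z * A) ->
  (c1 * A) * (z * (c2 * B)) = (c2 * B) * (z * (c1 * A)).
Proof.
move=> H; transitivity (c1 * (c2 * (A * (z * B)))).
  by rewrite -(mulrA c1) (mulrA z) -c2C -(mulrA c2) (mulrA A) -c2C -(mulrA c2).
rewrite H (mulrA z c1) -c1C -(mulrA c1) -(mulrA c2) (mulrA B c1) -c1C -(mulrA c1).
by rewrite (mulrA c2 c1) (c2C c1) -mulrA.
Qed.

End CentralFactors.

Section LinearForms.
Variables (K : comNzRingType) (E : pzRingType) (ka : {rmorphism K -> E}).
Hypothesis kaC : forall c x, ka c * x = x * ka c.

Lemma linear_sub x a (Y : E) : 1 + ka x * (- Y - ka a) = ka (1 - a * x) + ka (- x) * Y.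
Proof.
by rewrite mulrBr mulrN rmorphB rmorphM rmorph1 rmorphN mulNr (kaC a) -addrA [- _ - _]addrC.
Qed.

Lemma linear_add x a (Y : E) : 1 + ka x * (Y + ka a) = ka (1 + a * x) + ka x * Y.
Proof. by rewrite mulrDr rmorphD rmorphM rmorph1 (kaC a) addrAC addrA. Qed.

Lemma comm_forms a b c d (X Y : E) : X * Y = Y * X ->
  (ka a + ka b * X) * (ka c + ka d * Y) = (ka c + ka d * Y) * (ka a + ka b * X).
Proof.
move=> XY; have cka k (z : E) : GRing.comm (ka k) z := kaC k z.
have kc k (z : E) : GRing.comm z (ka k) := commr_sym (cka k z).
apply: commrD; first exact: kc; apply: commrM; first exact: kc.
by apply: commr_sym; apply: commrD; [exact: kc | apply: commrM; [exact: kc | exact: esym]].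
Qed.

End LinearForms.

Section TwoVariables.
Variables (C : fieldType) (N : nat) (W : vectType C).
Notation E0 := (endo W).
Notation M1 := 'M[endo W]_N.
Notation M2 := 'M['M[endo W]_N]_N.
Notation left := (@left C N W).
Notation right := (@right C N W).
Notation mscal := (@mscal C W N).

Definition M2series : pzRingType := series (series M2).
(** In [{poly {poly C}}] the outer variable ['X] stands for u^-1 and ['X%:P] for v^-1; the scalar
    conditions of the exchange lemmas become polynomial identities in these. *)
Definition kap : {rmorphism {poly {poly C}} -> M2series} := pser (pser (@scal2 C N W)).
Definition K2 : {rmorphism M2 -> M2series} := @cst (series M2) \o @cst M2.
Definition emb1 : {rmorphism series M1 -> M2series} := smap (@cst M2 \o left).
Definition emb2 : {rmorphism series M1 -> M2series} := @cst (series M2) \o smap right.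

Lemma kapC c x : kap c * x = x * kap c.
Proof. by apply: pserC => d y; apply: pserC; apply: scal2C. Qed.

Lemma kap_K2E p m r s : (kap p * K2 m) r s = scal2 N W p`_r`_s * m.
Proof. by rewrite /K2 /= mul_cstE mul_cstE. Qed.

Lemma kapE p r s : kap p r s = scal2 N W p`_r`_s.
Proof. by []. Qed.

Lemma in1E (T : series M1) : in1 T = emb1 T.
Proof. by apply: funext => r; apply: funext => -[]. Qed.

Lemma in2E (T : series M1) : in2 T = emb2 T.
Proof. by apply: funext => -[|r]; apply: funext => s. Qed.

Lemma coef_x r s : ('X : {poly {poly C}})`_r`_s = ((r == 1%N) && (s == 0%N))%:R.
Proof. by rewrite coefX; case: eqP => _ /=; rewrite ?coef1 ?coef0. Qed.

Lemma coef_y r s : ('X%:P : {poly {poly C}})`_r`_s = ((r == 0%N) && (s == 1%N))%:R.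
Proof. by rewrite coefC; case: eqP => _ /=; rewrite ?coefX ?coef0. Qed.

Lemma coef_xy r s : ('X * 'X%:P : {poly {poly C}})`_r`_s = ((r == 1%N) && (s == 1%N))%:R.
Proof. by rewrite coefMC coefX; case: eqP => _ /=; rewrite ?mul1r ?mul0r ?coefX ?coef0. Qed.

Lemma RserE : Rser N W = kap ('X%:P - 'X) + kap (- ('X * 'X%:P)) * K2 (Pmx N W) :> M2series.
Proof.
apply: funext => r; apply: funext => s; rewrite !series_add kapE kap_K2E.
rewrite coefB coefB coefN coefN coef_x coef_y coef_xy.
have e1 : scal2 N W (0 - 0) = 0 by rewrite subr0 rmorph0.
have e2 : scal2 N W (- 0) = 0 by rewrite oppr0 rmorph0.
have e3 : scal2 N W (1 - 0) = 1 by rewrite subr0 rmorph1.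
have e4 : scal2 N W (0 - 1) = -1 by rewrite sub0r rmorphN1.
have e5 : scal2 N W (- 1) = -1 by rewrite rmorphN1.
by case: r => [|[|r]]; case: s => [|[|s]]; rewrite /= ?e1 ?e2 ?e3 ?e4 ?e5 ?mul0r ?mulN1r ?addr0 ?add0r.
Qed.

Lemma R'serE g : R'ser g W = kap (- ('X%:P + 'X)) + kap (- ('X * 'X%:P)) * K2 (Qmx g W) :> M2series.
Proof.
apply: funext => r; apply: funext => s; rewrite !series_add kapE kap_K2E.
rewrite coefN coefN coefD coefD coefN coefN coef_x coef_y coef_xy.
have e1 : scal2 N W (- (0 + 0)) = 0 by rewrite addr0 oppr0 rmorph0.
have e2 : scal2 N W (- 0) = 0 by rewrite oppr0 rmorph0.
have e3 : scal2 N W (- (1 + 0)) = -1 by rewrite addr0 rmorphN1.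
have e4 : scal2 N W (- (0 + 1)) = -1 by rewrite add0r rmorphN1.
have e5 : scal2 N W (- 1) = -1 by rewrite rmorphN1.
by case: r => [|[|r]]; case: s => [|[|s]]; rewrite /= ?e1 ?e2 ?e3 ?e4 ?e5 ?mul0r ?mulN1r ?addr0 ?add0r.
Qed.

Lemma emb1_lin x : emb1 (lin x) = 1 + kap 'X * K2 (left x).
Proof.
apply: funext => r; apply: funext => s; rewrite !series_add kap_K2E coef_x.
have e0 : scal2 N W 0 = 0 by rewrite rmorph0.
have e1 : scal2 N W 1 = 1 by rewrite rmorph1.
case: r => [|[|r]]; case: s => [|s]; rewrite /= ?e0 ?e1 ?mul0r ?mul1r ?addr0 ?add0r //.
- exact: (rmorph1 left).
- exact: (rmorph0 left).
Qed.

Lemma emb2_lin x : emb2 (lin x) = 1 + kap 'X%:P * K2 (right x).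
Proof.
apply: funext => r; apply: funext => s; rewrite !series_add kap_K2E coef_y.
have e0 : scal2 N W 0 = 0 by rewrite rmorph0.
have e1 : scal2 N W 1 = 1 by rewrite rmorph1.
case: r => [|r]; case: s => [|[|s]]; rewrite /= ?e0 ?e1 ?mul0r ?mul1r ?addr0 ?add0r //.
- exact: (rmorph0 right).
Qed.

Lemma K2_scal a : K2 (scal2 N W a) = kap a%:P%:P.
Proof.
apply: funext => r; apply: funext => s; rewrite kapE coefC.
by case: r => [|r]; rewrite /= ?coef0 ?coefC; case: s => [|s]; rewrite /= ?rmorph0.
Qed.

End TwoVariables.

Lemma conj_mul (E : pzRingType) (a b x y : E) :
  b * a = 1 -> a * (y * x) * b = (a * y * b) * (a * x * b).
Proof. by move=> ba; rewrite -[RHS]mulrA (mulrA b) (mulrA b) ba mul1r !mulrA. Qed.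

Lemma sign_mul (E : pzRingType) m n (x y : E) :
  (-1) ^+ (m + n) * (x * y) = ((-1) ^+ m * x) * ((-1) ^+ n * y).
Proof. by rewrite exprD -!mulrA (mulrA x) (commr_sign x) -!mulrA. Qed.

(** Applied with t = P12: conjugation exchanges the two auxiliary factors and fixes Q12, so each
    relation in one of them yields its mirror image. *)
Lemma conj_rel (E : pzRingType) (t x y z w x' y' z' w' : E) : t * t = 1 ->
  t * x = x' * t -> t * y = y' * t -> t * z = z' * t -> t * w = w' * t ->
  x * y = z * w -> x' * y' = z' * w'.
Proof.
move=> tt tx ty tz tw xy.
have conj u u' : t * u = u' * t -> u' = t * u * t by move=> ->; rewrite -mulrA tt mulr1.
rewrite (conj _ _ tx) (conj _ _ ty) (conj _ _ tz) (conj _ _ tw).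
have -> u v : t * u * t * (t * v * t) = t * (u * v) * t.
  by rewrite !mulrA -(mulrA (t * u)) tt mulr1.
by have -> : t * z * t * (t * w * t) = t * (z * w) * t; rewrite ?xy // !mulrA -(mulrA (t * z)) tt mulr1.
Qed.

Section Transposition.
Variables (C : fieldType) (N : nat) (J : finType) (g : 'M[C]_N).
Hypothesis g_unit : g \in unitmx.
Notation W := (tpow C N J).
Notation E0 := (endo W).
Notation M1 := 'M[endo W]_N.
Notation tr := (tr_t1 (W := W) g).
Implicit Types (X Y : M1) (f h : series M1).

Definition entries_commute X Y := forall i j k l, X i j * Y k l = Y k l * X i j.

Lemma tr_conj X : tr X = map_mx (@escal C W) g * X^T * map_mx (@escal C W) (invmx g).
Proof.
apply/matrixP => a b; rewrite tr_t1E mulM1E; apply: eq_bigr => i _.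
rewrite mulM1E mulr_suml; apply: eq_bigr => j _.
by rewrite [map_mx _ g _ _]mxE [map_mx _ _ i b]mxE [X^T _ _]mxE -escalC mulrA -rmorphM escalE mulrC.
Qed.

Lemma trM X Y : entries_commute X Y -> tr (X * Y) = tr Y * tr X.
Proof.
move=> XY; rewrite !tr_conj.
have -> : (X * Y)^T = Y^T * X^T.
  apply/matrixP => i j; rewrite mxE !mulM1E; apply: eq_bigr => k _.
  by rewrite [Y^T i k]mxE [X^T k j]mxE XY.
have GG : map_mx (@escal C W) (invmx g) * map_mx (@escal C W) g = 1.
  by rewrite -mulmxE -map_mxM mulVmx // map_mx1.
exact: conj_mul.
Qed.

Lemma trD X Y : tr (X + Y) = tr X + tr Y.
Proof. by rewrite !tr_conj linearD mulrDr mulrDl. Qed.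

Lemma tr_sum (I : Type) (r : seq I) (F : I -> M1) :
  tr (\sum_(i <- r) F i) = \sum_(i <- r) tr (F i).
Proof.
elim: r => [|i r IHr]; last by rewrite !big_cons trD IHr.
by rewrite !big_nil tr_conj trmx0 mulr0 mul0r.
Qed.

Lemma tr1 : tr 1 = 1.
Proof.
by rewrite tr_conj trmx1 mulr1 -mulmxE -map_mxM mulmxV // map_mx1.
Qed.

Definition tser f : series M1 := fun k => (-1) ^+ k * tr (f k).

Lemma X_of_YE f : X_of_Y g f = tser f * f. Proof. by []. Qed.

Lemma tserM f h : (forall r s, entries_commute (f r) (h s)) -> tser (f * h) = tser h * tser f.
Proof.
move=> fh; apply: funext => k; rewrite series_mul_rev /tser series_mul tr_sum mulr_sumr.
apply: eq_bigr => i _; rewrite trM //.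
by rewrite -sign_mul subnK // -ltnS.
Qed.

Lemma tser1 : tser 1 = 1.
Proof.
apply: funext => -[|k]; rewrite /tser series_1 /=; first by rewrite expr0 mul1r tr1.
by rewrite tr_conj trmx0 mulr0 mul0r mulr0.
Qed.

End Transposition.

Section YangianModule.
Variables (C : fieldType) (N : nat) (J : finType) (g : 'M[C]_N).
Hypothesis g_unit : g \in unitmx.
Hypothesis g_sym : g^T = g \/ g^T = - g.
Notation W := (tpow C N J).
Notation E0 := (endo W).
Notation M1 := 'M[endo W]_N.
Notation site := (@site C N J).
Notation P0 := (@P0 C N J).
Notation Q0 := (@Q0 C N J g).
Notation mscal := (@mscal C W N).
Notation tser := (@tser C N J g).
Notation M2series := (M2series N W).
Notation kap := (@kap C N W).
Notation K2 := (@K2 C N W).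
Notation emb1 := (@emb1 C N W).
Notation emb2 := (@emb2 C N W).
Notation left := (@left C N W).
Notation right := (@right C N W).
Notation Rc := (@Rcheck0 C N J).
Implicit Types (p q : J) (a : C).

Lemma Rcheck0_succ p a k : Rc p a k.+1 = mscal (a ^+ k) * - P0 p.
Proof. by apply/matrixP => i j; rewrite mscalE !mxE scaleNr scalerN. Qed.

Lemma Rcheck0E p a : Rc p a = geo mscal a * lin (- P0 p - mscal a).
Proof. by apply: geo_lin => // k; rewrite Rcheck0_succ. Qed.

Lemma tr_scal a (X : M1) : tr_t1 (W := W) g (mscal a * X) = mscal a * tr_t1 g X.
Proof.
apply/matrixP => i j; rewrite mscalE !tr_t1E scaler_sumr; apply: eq_bigr => k _.
rewrite scaler_sumr; apply: eq_bigr => l _.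
by rewrite mscalE !scalerA mulrC.
Qed.

(** Transposing and replacing u by - u turns 1 - P/(u - a) into 1 + Q/(u + a), whose factors are (1
    + a/u)^-1 and 1 + (Q + a)/u. *)
Lemma tser_Rcheck0 p a : tser (Rc p a) = geo mscal (- a) * lin (Q0 p - mscal (- a)).
Proof.
apply: geo_lin => [|k]; first by rewrite /tser expr0 mul1r tr1.
have -> : tser (Rc p a) k.+1 = (-1) ^+ k.+1 * tr_t1 g (mscal (- a ^+ k) * P0 p).
  by rewrite -(scal_oppr mscal (a ^+ k) (P0 p)) -Rcheck0_succ.
rewrite (tr_scal (- a ^+ k) (P0 p)).
exact: (scal_sign mscal).
Qed.

Definition on_site p (X : M1) := forall i j, exists A, X i j = site p A.

Lemma on_site_commute p q X Y : p != q -> on_site p X -> on_site q Y -> entries_commute X Y.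
Proof.
by move=> pq sX sY i j k l; have [A ->] := sX i j; have [B ->] := sY k l; rewrite siteC.
Qed.

Lemma on_site_Rcheck0 p a k : on_site p (Rc p a k).
Proof.
move=> i j; case: k => [|k].
  exists ((i == j)%:R *: 1%:M); rewrite linearZ /= site1 mxE.
  by case: eqP; rewrite ?scale1r ?scale0r.
by exists (- a ^+ k *: delta_mx j i); rewrite /= mxE linearZ.
Qed.

Lemma on_site_tser p f k : on_site p (f k) -> on_site p (tser f k).
Proof.
move=> sf i j; rewrite /tser -(rmorphN1 mscal) -rmorphXn mscalE.
suff [A ->] : exists A, tr_t1 g (f k) i j = site p A by exists ((-1) ^+ k *: A); rewrite linearZ.
pose Q (x : E0) := exists A, x = site p A.
have QD x z : Q x -> Q z -> Q (x + z) by move=> [A ->] [B ->]; exists (A + B); rewrite linearD.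
have Q0 : Q 0 by exists 0; rewrite linear0.
rewrite tr_t1E; apply: (big_ind Q) => // u _; apply: (big_ind Q) => // v _.
by have [A ->] := sf u v; exists ((g i v * invmx g u j) *: A); rewrite linearZ.
Qed.

Lemma emb_commute (f h : series M1) : (forall r s, entries_commute (f r) (h s)) ->
  emb1 f * emb2 h = emb2 h * emb1 f.
Proof.
move=> fh; apply: funext => r; apply: funext => s.
have -> : (emb1 f * emb2 h) r s = left (f r) * right (h s).
  transitivity ((cst (left (f r)) * smap right h) s); last exact: cst_mulE.
  exact: (congr1 (fun z : series _ => z s) (mul_cstE (smap right h) (emb1 f) r)).
have -> : (emb2 h * emb1 f) r s = right (h s) * left (f r).
  transitivity ((smap right h * cst (left (f r))) s); last exact: mul_cstE.
  exact: (congr1 (fun z : series _ => z s) (cst_mulE (smap right h) (emb1 f) r)).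
by rewrite mul_leftr mul_rightl; apply: mk4_eq => i j k l; apply: fh.
Qed.

Lemma emb1_geoC a x : emb1 (geo mscal a) * x = x * emb1 (geo mscal a).
Proof.
apply: central_series => r; apply: central_series => -[|k] z; last by rewrite mul0r mulr0.
have -> : emb1 (geo mscal a) r 0%N = scal2 N W (a ^+ r) by exact: (esym (scal2_left N W (a ^+ r))).
exact: scal2C.
Qed.

Lemma emb2_geoC a x : emb2 (geo mscal a) * x = x * emb2 (geo mscal a).
Proof.
apply: central_series => -[|r] z; last exact: etrans (mul0r z) (esym (mulr0 z)).
by apply: central_series => k {}z; apply: scal2C.
Qed.

Lemma emb1_lin_sub a X :
  emb1 (lin (- X - mscal a)) = kap (1 - a%:P%:P * 'X) + kap (- 'X) * K2 (left X).
Proof.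
rewrite emb1_lin -(linear_sub (@kapC _ _ _)); congr (1 + _ * _).
by rewrite -K2_scal scal2_left !(rmorphB, rmorphN).
Qed.

Lemma emb1_lin_add a X :
  emb1 (lin (X - mscal (- a))) = kap (1 + a%:P%:P * 'X) + kap 'X * K2 (left X).
Proof.
rewrite emb1_lin -(linear_add (@kapC _ _ _)); congr (1 + _ * _).
by rewrite -K2_scal scal2_left !(rmorphB, rmorphN) opprK.
Qed.

Lemma emb2_lin_sub a X :
  emb2 (lin (- X - mscal a)) = kap (1 - a%:P%:P * 'X%:P) + kap (- 'X%:P) * K2 (right X).
Proof.
rewrite emb2_lin -(linear_sub (@kapC _ _ _)); congr (1 + _ * _).
by rewrite -K2_scal scal2_right !(rmorphB, rmorphN).
Qed.

Lemma emb2_lin_add a X :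
  emb2 (lin (X - mscal (- a))) = kap (1 + a%:P%:P * 'X%:P) + kap 'X%:P * K2 (right X).
Proof.
rewrite emb2_lin -(linear_add (@kapC _ _ _)); congr (1 + _ * _).
by rewrite -K2_scal scal2_right !(rmorphB, rmorphN) opprK.
Qed.

Variables (a : J -> C) (s : seq J).
Hypothesis us : uniq s.
Notation R12 := (Rser N W : M2series).
Notation R'12 := (R'ser g W : M2series).

Let ct p := tser (Rc p (a p)).

Let K2M X Y X' Y' : X * Y = X' * Y' -> K2 X * K2 Y = K2 X' * K2 Y'.
Proof. by move=> H; rewrite -(rmorphM K2) H rmorphM. Qed.

Let K2_1 X : X * X = 1 -> K2 X * K2 X = 1.
Proof. by move=> H; rewrite -(rmorphM K2) H rmorph1. Qed.

Let left_P0_2 p : left (P0 p) * left (P0 p) = 1.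
Proof. by rewrite -rmorphM P0P0 rmorph1. Qed.

Let right_P0_2 p : right (P0 p) * right (P0 p) = 1.
Proof. by rewrite -rmorphM P0P0 rmorph1. Qed.

Let P12 := Pmx N W.
Let Q12 := Qmx g W.

Let left_P0_Q p : left (P0 p) * Q12 = right (Q0 p) * left (P0 p).
Proof.
refine (conj_rel (Pmx2 N W) (Pmx_right _) _ (Pmx_left _) (Pmx_right _) (right_P0_Q g p)).
exact: Q_sym.
Qed.

Let right_Q0_Q p : right (Q0 p) * Q12 = right (Q0 p) * left (P0 p).
Proof.
apply: (conj_rel (Pmx2 N W) (Pmx_left _) _ (Pmx_left _) (Pmx_right _) (left_Q0_Q g_unit p)).
exact: Q_sym.
Qed.

Let Q_right_Q0 p : Q12 * right (Q0 p) = left (P0 p) * right (Q0 p).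
Proof.
apply: (conj_rel (Pmx2 N W) _ (Pmx_left _) (Pmx_right _) (Pmx_left _) (Q_left_Q0 g_unit p)).
exact: Q_sym.
Qed.

Let Q_left_P0 p : Q12 * left (P0 p) = left (P0 p) * right (Q0 p).
Proof.
refine (conj_rel (Pmx2 N W) _ (Pmx_right _) (Pmx_right _) (Pmx_left _) (Q_right_P0 g p)).
exact: Q_sym.
Qed.

Let Raa p : R12 * (emb1 (Rc p (a p)) * emb2 (Rc p (a p))) =
  emb2 (Rc p (a p)) * (emb1 (Rc p (a p)) * R12).
Proof.
rewrite Rcheck0E !(rmorphM emb1) !(rmorphM emb2).
apply: central_exchange; [exact: emb1_geoC | exact: emb2_geoC |].
rewrite emb1_lin_sub emb2_lin_sub RserE; apply: (exchange_braid (@kapC _ _ _)); last by ring.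
- exact/K2M/Pmx_left.
- exact/K2M/left_P0_right.
- exact/K2M/esym/Pmx_right.
- exact/K2M/right_P0_left.
- exact/K2_1/right_P0_2.
Qed.

Let Rbb p : R12 * (emb1 (ct p) * emb2 (ct p)) = emb2 (ct p) * (emb1 (ct p) * R12).
Proof.
rewrite /ct tser_Rcheck0 !(rmorphM emb1) !(rmorphM emb2).
apply: central_exchange; [exact: emb1_geoC | exact: emb2_geoC |].
rewrite emb1_lin_add emb2_lin_add RserE; apply: (exchange_right (@kapC _ _ _)); last by ring.
- exact/K2M/Pmx_left.
- exact/K2M/right_Q0_left.
- exact/K2M/esym/Pmx_right.
- exact/K2M/left_Q0_right.
- exact/K2_1/Pmx2.
Qed.

Let bRa p : emb1 (ct p) * (R'12 * emb2 (Rc p (a p))) = emb2 (Rc p (a p)) * (R'12 * emb1 (ct p)).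
Proof.
rewrite /ct tser_Rcheck0 Rcheck0E !(rmorphM emb1) !(rmorphM emb2).
apply: central_exchange_mid; [exact: emb1_geoC | exact: emb2_geoC |].
rewrite emb1_lin_add emb2_lin_sub R'serE; apply: (exchange_left (@kapC _ _ _)); last by ring.
- exact/K2M/left_Q0_Q.
- exact/K2M/right_P0_Q.
- exact/K2M/Q_left_Q0.
- exact/K2M/Q_right_P0.
- exact/K2_1/right_P0_2.
Qed.

Let aRb p : emb1 (Rc p (a p)) * (R'12 * emb2 (ct p)) = emb2 (ct p) * (R'12 * emb1 (Rc p (a p))).
Proof.
rewrite /ct tser_Rcheck0 Rcheck0E !(rmorphM emb1) !(rmorphM emb2).
apply: central_exchange_mid; [exact: emb1_geoC | exact: emb2_geoC |].
rewrite emb1_lin_sub emb2_lin_add R'serE; apply: (exchange_right (@kapC _ _ _)); last by ring.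
- exact/K2M/left_P0_Q.
- exact/K2M/right_Q0_Q.
- exact/K2M/Q_left_P0.
- exact/K2M/Q_right_Q0.
- exact/K2_1/left_P0_2.
Qed.

Let RR' : R12 * R'12 = R'12 * R12.
Proof.
rewrite RserE R'serE.
have PQ : K2 P12 * K2 Q12 = K2 Q12 * K2 P12 by apply/K2M/Q_sym.
exact: (comm_forms (@kapC _ _ _) _ _ _ _ PQ).
Qed.

Definition tprod (r : seq J) : series M1 := \prod_(p <- r) (Rc p (a p) : series M1).

Lemma tprod_nil : tprod [::] = 1. Proof. exact: big_nil. Qed.

Lemma tprod_cons p r : tprod (p :: r) = (Rc p (a p) : series M1) * tprod r.
Proof. exact: big_cons. Qed.

Lemma tprod0 r : tprod r 0%N = 1.
Proof.
elim: r => [|p r IHr]; first by rewrite tprod_nil series_1.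
by rewrite tprod_cons series_mul0 IHr mulr1.
Qed.

(** Entries belonging to distinct sites commute, so t reverses the product although the matrix
    entries lie in a noncommutative ring. *)
Lemma tser_tprod : tser (tprod s) = \prod_(p <- rev s) (tser (Rc p (a p)) : series M1).
Proof.
elim: s us => [_|p r IHr /= /andP[pr ur]]; first last.
  have -> : rev (p :: r) = rev r ++ [:: p] by rewrite rev_cons cats1.
  rewrite big_cat.
  rewrite big_seq1 -(IHr ur).
  rewrite tprod_cons.
  apply: (tserM g_unit) => k l.
rewrite /tprod; move: l.
have : forall l, entries_commute (Rc p (a p) k) ((\prod_(q <- r) (Rc q (a q) : series M1)) l).
  rewrite big_seq; apply: (big_ind (fun f : series M1 =>
    forall l, entries_commute (Rc p (a p) k) (f l))).
  - by move=> m i j i' j'; rewrite series_1 -[_%:R](rmorph_nat mscal) mxE mulrnAr mulrnAl escalC.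
  - move=> f h Hf Hh m i j i' j'; rewrite series_mul summxE mulr_sumr mulr_suml.
    apply: eq_bigr => u _; rewrite mulM1E mulr_sumr mulr_suml; apply: eq_bigr => v _.
    by rewrite mulrA Hf -!mulrA Hh.
  move=> q qr m; apply: (@on_site_commute p q); [|exact: on_site_Rcheck0|exact: on_site_Rcheck0].
  by apply: contraNneq pr => ->.
exact.
transitivity (1 : series M1); last by symmetry; apply: big_nil.
rewrite tprod_nil; exact: tser1.
Qed.

Lemma Yangian_rep_tprod : Yangian_rep (tprod s).
Proof.
split; first exact: tprod0.
move=> r u; rewrite !smul2E in1E in2E.
have -> := rmorph_prod emb1 s xpredT (fun p => Rc p (a p)).
have -> := rmorph_prod emb2 s xpredT (fun p => Rc p (a p)).
have aa p q : p != q -> emb1 (Rc p (a p)) * emb2 (Rc q (a q)) = emb2 (Rc q (a q)) * emb1 (Rc p (a p)).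
  by move=> pq; apply: emb_commute => k m; apply: on_site_commute pq _ _; apply: on_site_Rcheck0.
have E := @abstract_rtt M2series J R12 _ _ s us Raa aa.
exact: (congr1 (fun f : M2series => f r u) (etrans E (mulrA _ _ _))).
Qed.

Lemma XYangian_rep_tprod : XYangian_rep g (X_of_Y g (tprod s)).
Proof.
split.
  rewrite X_of_YE series_mul0 /tser tprod0 expr0 mul1r mulr1; exact: tr1.
have sRc p k : on_site p (Rc p (a p) k) by apply: on_site_Rcheck0.
have sct p k : on_site p (ct p k) by apply: on_site_tser.
have com (f h : J -> series M1) : (forall p k, on_site p (f p k)) ->
    (forall p k, on_site p (h p k)) ->
    forall p q, p != q -> emb1 (f p) * emb2 (h q) = emb2 (h q) * emb1 (f p).
  by move=> Hf Hh p q pq; apply: emb_commute => k m; apply: on_site_commute pq _ _.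
have E := @abstract_reflection M2series J R12 R'12 _ _ _ _ s us Raa Rbb bRa aRb RR'
  (com _ _ sRc sRc) (com _ _ sct sct) (com _ _ sct sRc) (com _ _ sRc sct).
have E1 : emb1 (tser (tprod s) * tprod s) =
    \prod_(p <- rev s) emb1 (ct p) * \prod_(p <- s) emb1 (Rc p (a p)).
  rewrite (rmorphM emb1) tser_tprod; congr (_ * _).
    exact: (rmorph_prod emb1 (rev s) xpredT ct).
  exact: (rmorph_prod emb1 s xpredT (fun p => Rc p (a p))).
have E2 : emb2 (tser (tprod s) * tprod s) =
    \prod_(p <- rev s) emb2 (ct p) * \prod_(p <- s) emb2 (Rc p (a p)).
  rewrite (rmorphM emb2) tser_tprod; congr (_ * _).
    exact: (rmorph_prod emb2 (rev s) xpredT ct).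
  exact: (rmorph_prod emb2 s xpredT (fun p => Rc p (a p))).
have E' : R12 * (emb1 (tser (tprod s) * tprod s) * (R'12 * emb2 (tser (tprod s) * tprod s))) =
    emb2 (tser (tprod s) * tprod s) * (R'12 * (emb1 (tser (tprod s) * tprod s) * R12)).
  by rewrite E1 E2; exact: E.
set e1 := emb1 _ in E'; set e2 := emb2 _ in E'.
have F1 := smul2_4E R12 e1 R'12 e2; have F2 := smul2_4E e2 R'12 e1 R12.
move=> r u; rewrite in1E in2E.
exact: (congr1 (fun f : nat -> nat -> 'M['M[E0]_N]_N => f r u) (etrans F1 (etrans E' (esym F2)))).
Qed.

End YangianModule.

(** * Openness of irreducibility *)

Section Spanning.
Variables (C : numFieldType) (W : vectType C) (F : endo W).
Notation E := (endo W).
Notation ka := (@escal C W).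
Implicit Types (G : E -> Prop) (x : E).

(* The rank-one X show that this is stronger than the irreducibility of limg F. *)
Definition corner_full G := forall X : E, exists2 b, alg ka G b & b * F = F * X * F.

(** A relation with y on the other side of F, rather than mere stability of the image, since it can
    be multiplied and interpolated. *)
Definition preserves x := exists y, x * F = F * y.

Lemma preserves_alg G : (forall x, G x -> preserves x) -> forall x, alg ka G x -> preserves x.
Proof.
move=> pG x; elim=> [||a x1 x2 _ [y1 e1] _ [y2 e2]|x1 g _ [y1 e1] /pG[y2 e2]].
- by exists 0; rewrite mul0r mulr0.
- by exists 1; rewrite mul1r mulr1.
- by exists (ka a * y1 + y2); rewrite mulrDl -mulrA e1 e2 mulrDr (scal_mulCA (@escalC _ _)).
- by exists (y1 * y2); rewrite -mulrA e2 mulrA e1 mulrA.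
Qed.

Lemma preserves_limg x : preserves x -> ((x : 'End(W)) @: limg F <= limg F)%VS.
Proof.
move=> [y xF]; apply/subvP => v /memv_imgP[_ /memv_imgP[u _ ->] ->].
have -> : (x : 'End(W)) ((F : 'End(W)) u) = (x * F : 'End(W)) u by rewrite endoM.
by rewrite xF endoM memv_img // memvf.
Qed.

Lemma ginv : F * ((F : 'End(W))^-1%VF : E) * F = F.
Proof.
apply/lfunP => v; rewrite !endoM.
by rewrite (limg_lfunVK (f := F)) // memv_img // memvf.
Qed.

Definition corner_fun (X : 'End(W)) : 'End(W) := (F * (X : E) * F : E).

Lemma corner_linear : linear corner_fun.
Proof.
move=> a X Y; rewrite /corner_fun; transitivity (F * (a *: (X : E) + Y) * F); first by [].
by rewrite mulrDr mulrDl endoZr endoZl.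
Qed.

HB.instance Definition _ := GRing.isLinear.Build C 'End(W) 'End(W) _ corner_fun corner_linear.

Definition corner : 'End('End(W)) := linfun corner_fun.

Lemma cornerE X : corner X = F * (X : E) * F.
Proof. exact: lfunE. Qed.

Lemma corner_full_irreducible G (U : {vspace W}) : corner_full G ->
  (forall x, G x -> ((x : 'End(W)) @: U <= U)%VS) -> (U <= limg F)%VS -> U = 0%VS \/ U = limg F.
Proof.
move=> fG GU UF; have [->|/negPf U0] := eqVneq U 0%VS; [by left | right].
apply/eqP; rewrite eqEsubv UF; apply/subvP => _ /memv_imgP[x _ ->].
have algU b : alg ka G b -> forall v, v \in U -> (b : 'End(W)) v \in U.
  elim=> [||a x1 x2 _ IH1 _ IH2|x1 h _ IH1 /GU/subvP hU] v vU.
  - by rewrite lfunE mem0v.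
  - by rewrite endo1.
  - by rewrite add_lfunE escalE scale_lfunE memvD ?memvZ ?IH1 ?IH2.
  - by rewrite endoM IH1 // hU // memv_img.
set y := vpick U; have yU : y \in U by apply: memv_pick.
have y0 : y != 0 by rewrite vpick0 U0.
have /memv_imgP[v _ yv] : y \in limg F by apply: subvP yU.
have [X Xy] : exists X : 'End(W), X y = x.
  pose k (u : W) : W := (coord [tuple y] ord0 u) *: x.
  have kl : linear k by move=> a u1 u2; rewrite /k linearP scalerDl scalerA.
  pose kL : {linear W -> W} := HB.pack k (GRing.isLinear.Build C W W _ k kl).
  exists (linfun kL); rewrite (lfunE kL) /= /k.
  have fy : free [tuple y] by rewrite (free_cons y [::]) nil_free span_nil memv0 y0.
  by have := coord_free ord0 ord0 fy; rewrite /= => ->; rewrite scale1r.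
have [b ab bF] := fG X.
(* With y = F v and X y = x, one has b y = b F v = F X F v = F x, and b y lies in U. *)
have -> : (F : 'End(W)) x = (b : 'End(W)) y by rewrite yv -endoM bF !endoM -yv Xy.
exact: algU.
Qed.

End Spanning.

Section Families.
Variables (C : numFieldType) (W : vectType C) (P : Type) (reg : (P -> C) -> Prop).
Notation E := (endo W).
Notation ka := (@escal C W).
Hypothesis reg_const : forall a, reg (fun=> a).
Hypothesis reg_add : forall f h, reg f -> reg h -> reg (fun p => f p + h p).
Hypothesis reg_mul : forall f h, reg f -> reg h -> reg (fun p => f p * h p).
Implicit Types (f h : P -> E) (p : P).

Lemma reg_sum (I : Type) (r : seq I) (q : I -> P -> C) :
  (forall i, reg (q i)) -> reg (fun p => \sum_(i <- r) q i p).
Proof.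
move=> rq; elim: r => [|i r IHr].
  by have -> : (fun p => \sum_(i <- [::]) q i p) = (fun=> 0) by apply: funext => p; rewrite big_nil.
have -> : (fun p => \sum_(j <- i :: r) q j p) = (fun p => q i p + \sum_(j <- r) q j p).
  by apply: funext => p; rewrite big_cons.
exact: reg_add.
Qed.

Lemma reg_prod (I : Type) (r : seq I) (q : I -> P -> C) :
  (forall i, reg (q i)) -> reg (fun p => \prod_(i <- r) q i p).
Proof.
move=> rq; elim: r => [|i r IHr].
  by have -> : (fun p => \prod_(i <- [::]) q i p) = (fun=> 1) by apply: funext => p; rewrite big_nil.
have -> : (fun p => \prod_(j <- i :: r) q j p) = (fun p => q i p * \prod_(j <- r) q j p).
  by apply: funext => p; rewrite big_cons.
exact: reg_mul.
Qed.

Lemma reg_det n (A : P -> 'M[C]_n) : (forall i j, reg (fun p => A p i j)) -> reg (fun p => \det (A p)).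
Proof.
by move=> rA; apply: reg_sum => s; apply: reg_mul => //; apply: reg_prod.
Qed.

Notation bas := (vbasis {:'End(W)}).

(** Here [reg] is any class of scalar functions that contains the constants and is closed under sums
    and products. It is used for the polynomials in e and for the polynomials in z. *)
Definition regE f := forall i, reg (fun p => coord bas i (f p)).

Lemma coord_bas (x : 'End(W)) : x = \sum_i coord bas i x *: bas`_i.
Proof. by apply: coord_vbasis; rewrite memvf. Qed.

Lemma regE_scalar (phi : 'End(W) -> C) f : scalar phi -> regE f -> reg (fun p => phi (f p)).
Proof.
move=> lphi rf; pose phiL : {scalar 'End(W)} := HB.pack phi (GRing.isLinear.Build C 'End(W) C _ phi lphi).
have -> : (fun p => phi (f p)) = (fun p => \sum_i coord bas i (f p) * phi bas`_i).
  apply: funext => p; rewrite {1}(coord_bas (f p)).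
  transitivity (\sum_i phiL (coord bas i (f p) *: bas`_i)); first exact: (linear_sum phiL).
  by apply: eq_bigr => i _; exact: (linearZ_LR phiL).
by apply: reg_sum => i; apply: reg_mul.
Qed.

Lemma regE_const x : regE (fun=> x).
Proof. by move=> i; apply: reg_const. Qed.

Lemma regE_add f h : regE f -> regE h -> regE (fun p => f p + h p).
Proof.
move=> rf rh i; have -> : (fun p => coord bas i (f p + h p)) =
  (fun p => coord bas i (f p) + coord bas i (h p)) by apply: funext => p; exact: linearD.
exact: reg_add.
Qed.

Lemma regE_scale q f : reg q -> regE f -> regE (fun p => ka (q p) * f p).
Proof.
move=> rq rf i; have -> : (fun p => coord bas i (ka (q p) * f p)) =
  (fun p => q p * coord bas i (f p)) by apply: funext => p; rewrite escalE; exact: linearZ.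
exact: reg_mul.
Qed.

Lemma regE_sum (I : Type) (r : seq I) (f : I -> P -> E) :
  (forall i, regE (f i)) -> regE (fun p => \sum_(i <- r) f i p).
Proof.
move=> rf; elim: r => [|i r IHr].
  have -> : (fun p => \sum_(i <- [::]) f i p) = (fun=> 0) by apply: funext => p; rewrite big_nil.
  exact: regE_const.
have -> : (fun p => \sum_(j <- i :: r) f j p) = (fun p => f i p + \sum_(j <- r) f j p).
  by apply: funext => p; rewrite big_cons.
exact: regE_add.
Qed.

Lemma regE_mul f h : regE f -> regE h -> regE (fun p => f p * h p).
Proof.
move=> rf rh.
have -> : (fun p => f p * h p) = (fun p => \sum_i \sum_j
    ka (coord bas i (f p)) * (ka (coord bas j (h p)) * ((bas`_i : E) * (bas`_j : E)))).
  apply: funext => p; rewrite {1}(coord_bas (f p)) {1}(coord_bas (h p)).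
  rewrite mulr_suml; apply: eq_bigr => i _; rewrite mulr_sumr; apply: eq_bigr => j _.
  by rewrite endoZl endoZr !escalE.
apply: regE_sum => i; apply: regE_sum => j.
by apply: regE_scale => //; apply: regE_scale => //; apply: regE_const.
Qed.

Variables (K : Type) (gen : K -> P -> E).
Hypothesis reg_gen : forall k, regE (gen k).

Definition gens p x := exists k, x = gen k p.

(** The word in the generators that produces b at p0 makes sense at every p, with the same
    coefficients. *)
Lemma alg_family p0 b : alg ka (gens p0) b ->
  exists2 f, regE f & f p0 = b /\ forall p, alg ka (gens p) (f p).
Proof.
elim=> [||a x1 x2 _ [f1 r1 [<- a1]] _ [f2 r2 [<- a2]]|x1 _ _ [f1 r1 [<- a1]] [k ->]].
- by exists (fun=> 0); [exact: regE_const | split=> // p; apply: alg_0].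
- by exists (fun=> 1); [exact: regE_const | split=> // p; apply: alg_1].
- exists (fun p => ka a * f1 p + f2 p); first by apply: regE_add => //; apply: regE_scale.
  by split=> // p; apply: alg_lin.
- exists (fun p => f1 p * gen k p); first exact: regE_mul.
  by split=> // p; apply: alg_gen => //; exists k.
Qed.

(** Let H be the space of all F X F. At p0 a basis of H is attained by elements b_i F; the words
    defining the b_i are continued to all p, and d is the determinant of the coordinates of these
    continuations in that basis. It equals 1 at p0, and where it is nonzero the continuations still
    span H. *)
Lemma corner_full_open (F : E) p0 : corner_full F (gens p0) ->
  exists2 d, reg d & d p0 != 0 /\
    forall p, d p != 0 -> (forall k, preserves F (gen k p)) -> corner_full F (gens p).
Proof.
move=> full0; pose H := limg (corner F); pose hb := vbasis H.
have hF (X : E) : F * X * F \in H by rewrite -cornerE memv_img // memvf.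
have /fin_all_exists[f Hf] : forall i : 'I_(\dim H), exists f,
    [/\ regE f, f p0 * F = hb`_i & forall p, alg ka (gens p) (f p)].
  move=> i; have /memv_imgP[X _ eX] : hb`_i \in H by rewrite vbasis_mem // mem_nth // size_tuple.
  have [b ab bF] := full0 X; have [f rf [fb af]] := alg_family ab.
  by exists f; split=> //; rewrite fb bF -cornerE.
pose A p : 'M[C]_(\dim H) := \matrix_(i, j) coord hb j (f i p * F).
exists (fun p => \det (A p)); last split.
- apply: reg_det => i j.
  have -> : (fun p => A p i j) = (fun p => coord hb j (f i p * F)) by apply: funext => p; rewrite mxE.
  apply: (regE_scalar (phi := fun x : 'End(W) => coord hb j ((x : E) * F))); last by case: (Hf i).
  move=> a x z; transitivity (coord hb j (a *: ((x : E) * F) + (z : E) * F)).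
    by rewrite -endoZl -mulrDl.
  exact: linearP.
- have -> : A p0 = 1%:M.
    apply/matrixP => i j; rewrite !mxE; have [_ -> _] := Hf i.
    by rewrite coord_free ?(basis_free (vbasisP _)) // eq_sym.
  by rewrite det1 oner_neq0.
move=> p dp pF X; have Au : A p \in unitmx by rewrite unitmxE unitfE.
have fH i : f i p * F \in H.
  have [_ _ /(_ p) af] := Hf i.
  have [y fy] : preserves F (f i p) by apply: preserves_alg af => _ [k ->].
  (* With the generalized inverse F' of F, f F = f F F' F = F (y F') F, so that the family stays in
     H. *)
  by rewrite -(ginv F) !mulrA fy -(mulrA F) hF.
pose Q x := exists2 b, alg ka (gens p) b & b * F = x.
have [Q0 QL] : lin_closed ka Q := lin_closed_lmul F (alg_closed _ _).
have QZ a x : Q x -> Q (a *: x) by move=> Qx; rewrite -escalE -[_ * _]addr0; apply: QL.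
have Qsum (n : nat) (x : 'I_n -> E) : (forall i, Q (x i)) -> Q (\sum_i x i).
  move=> Qx; apply: (big_ind Q) => // x1 x2 Q1 Q2.
  by rewrite -[x1]mul1r -(rmorph1 ka); apply: QL.
have Qf i : Q (f i p * F) by exists (f i p) => //; case: (Hf i).
have Qb (k : 'I_(\dim H)) : Q hb`_k.
  have -> : hb`_k = \sum_i invmx (A p) k i *: (f i p * F : E).
    transitivity (\sum_i \sum_j (invmx (A p) k i * A p i j) *: (hb`_j : E)); last first.
      apply: eq_bigr => i _; rewrite (coord_vbasis (fH i)) scaler_sumr.
      by apply: eq_bigr => j _; rewrite mxE scalerA.
    rewrite exchange_big /=; transitivity (\sum_j (k == j)%:R *: (hb`_j : E)).
      rewrite (bigD1 k) //= eqxx scale1r big1 ?addr0 // => j jk.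
      by rewrite eq_sym (negPf jk) scale0r.
    apply: eq_bigr => j _; rewrite -scaler_suml; congr (_ *: _).
    by have := congr1 (fun M : 'M_(\dim H) => M k j) (mulVmx Au); rewrite !mxE.
  by apply: Qsum => i; apply: QZ.
rewrite -/(Q _) (coord_vbasis (hF X)); apply: Qsum => i; exact: QZ.
Qed.

End Families.

(** * Tensor products of skew diagrams *)

Section GoodMap.
Variables (C : numFieldType) (J J' : eqType) (T : J -> J') (c' y' : J' -> C).
Hypothesis T_inj : injective T.
Notation c := (fun p => c' (T p)).
Notation y := (fun p => y' (T p)).

Lemma top_map b : top c' (map T b) = top c b.
Proof. by case: b. Qed.

Lemma tops_map bs : tops c bs -> tops c' (map (map T) bs).
Proof.
elim: bs => //= b bs IHbs [H1 /IHbs H2]; split=> // _ _ /mapP[p pb ->] /mapP[b' b'bs ->].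
by rewrite top_map; apply: H1.
Qed.

Lemma column_map b : column c b -> column c' (map T b).
Proof. by rewrite /column sorted_map. Qed.

Lemma good_map bs : good c y bs -> good c' y' (map (map T) bs).
Proof.
case=> u col const sep top; split.
- by rewrite -map_flatten map_inj_uniq.
- by move=> _ /mapP[b bbs ->]; apply/column_map/col.
- move=> _ /mapP[b bbs ->] _ _ /mapP[p pb ->] /mapP[q qb ->]; exact: const bbs _ _ pb qb.
- rewrite -map_flatten => _ _ /mapP[p pb ->] /mapP[q qb ->] pq.
  by apply: sep => //; apply: contraNneq pq => ->.
- exact: tops_map.
Qed.

End GoodMap.

Section Embedding.
Variables (C : fieldType) (N l : nat) (n : 'I_l -> nat).
Notation J := {j : 'I_l & 'I_(n j)}.
Notation tag j p := (Tagged (fun j => 'I_(n j)) (i := j) p).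
Notation W := (tpow C N J).
Notation V j := (tpow C N 'I_(n j)).
Implicit Types (j k : 'I_l) (f : {ffun J -> 'I_N}).

Lemma tag_inj j : injective (fun p : 'I_(n j) => tag j p).
Proof. by move=> p q /eqP; rewrite eq_Tagged => /eqP. Qed.

Definition restr j f : {ffun 'I_(n j) -> 'I_N} := [ffun p => f (tag j p)].

Definition repl j f (h : {ffun 'I_(n j) -> 'I_N}) : {ffun J -> 'I_N} :=
  [ffun q => if [pick p | tag j p == q] is Some p then h p else f q].

Arguments repl : clear implicits.

Lemma repl_in j f h p : repl j f h (tag j p) = h p.
Proof.
by rewrite ffunE; case: pickP => [q /eqP/tag_inj -> //|/(_ p)]; rewrite eqxx.
Qed.

Lemma repl_out j k f h (p : 'I_(n k)) : k != j -> repl j f h (tag k p) = f (tag k p).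
Proof.
move=> kj; rewrite ffunE; case: pickP => // q /eqP/(congr1 (fun r : J => projT1 r)) /= e.
by rewrite e eqxx in kj.
Qed.

Lemma block_ext (f f' : {ffun J -> 'I_N}) : (forall k, restr k f = restr k f') -> f = f'.
Proof.
move=> H; apply/ffunP => -[k p].
by have := congr1 (fun h : {ffun _ -> _} => h p) (H k); rewrite !ffunE.
Qed.

Lemma restr_repl j f h : restr j (repl j f h) = h.
Proof. by apply/ffunP => p; rewrite ffunE repl_in. Qed.

Lemma restr_repl_out j k f h : k != j -> restr k (repl j f h) = restr k f.
Proof. by move=> kj; apply/ffunP => p; rewrite [LHS]ffunE [RHS]ffunE repl_out. Qed.

Lemma repl_repl j f h h' : repl j (repl j f h) h' = repl j f h'.
Proof.
apply: block_ext => k; have [->|kj] := eqVneq k j; first by rewrite !restr_repl.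
by rewrite !restr_repl_out.
Qed.

Lemma repl_restr j f : repl j f (restr j f) = f.
Proof.
apply: block_ext => k; have [->|kj] := eqVneq k j; first by rewrite !restr_repl.
by rewrite !restr_repl_out.
Qed.

(** The coordinates of phi as a function of the indices in the block j, all others being frozen to
    those of f; an operator on the block acts on these slices. *)
Definition slice j f (phi : {ffun {ffun J -> 'I_N} -> C^o}) : V j := [ffun h => phi (repl j f h)].

Lemma slice_linear j f : linear (fun phi : W => slice j f phi).
Proof. by move=> a x z; apply/ffunP => h; rewrite !ffunE. Qed.

Definition block_op j (A : endo (V j)) : endo W :=
  linfun (fun phi : {ffun {ffun J -> 'I_N} -> C^o} =>
    [ffun f => (A (slice j f phi) : {ffun _ -> C^o}) (restr j f)] : W).

Lemma block_opE j (A : endo (V j)) (phi : W) f :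
  (block_op A phi : {ffun _ -> C^o}) f = (A (slice j f phi) : {ffun _ -> C^o}) (restr j f).
Proof.
pose L (phi : {ffun {ffun J -> 'I_N} -> C^o}) : W :=
  [ffun f => (A (slice j f phi) : {ffun _ -> C^o}) (restr j f)].
have lL : linear L.
  by move=> a x z; apply/ffunP => g; rewrite !ffunE slice_linear linearP !ffunE.
pose LL : {linear W -> W} := HB.pack L (GRing.isLinear.Build _ _ _ _ _ lL).
by rewrite /block_op (lfunE LL) /= ffunE.
Qed.

Lemma slice_block_op j (A : endo (V j)) f (phi : W) :
  slice j f (block_op A phi) = A (slice j f phi).
Proof.
apply/ffunP => h; rewrite ffunE block_opE restr_repl; congr ((A _ : {ffun _ -> _}) _).
by apply/ffunP => h'; rewrite !ffunE repl_repl.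
Qed.

Lemma block_op_additive j : zmod_morphism (@block_op j).
Proof.
move=> A B; apply: endoP => phi f.
by rewrite !(block_opE, add_lfunE, opp_lfunE, ffunE).
Qed.

Lemma block_op_multiplicative j : monoid_morphism (@block_op j).
Proof.
split=> [|A B]; apply: endoP => phi f; first by rewrite block_opE !endo1 ffunE repl_restr.
by rewrite endoM !block_opE slice_block_op endoM.
Qed.

HB.instance Definition _ j := GRing.isZmodMorphism.Build (endo (V j)) (endo W)
  (@block_op j) (@block_op_additive j).
HB.instance Definition _ j := GRing.isMonoidMorphism.Build (endo (V j)) (endo W)
  (@block_op j) (@block_op_multiplicative j).
Definition block j : {rmorphism endo (V j) -> endo W} := @block_op j.

Lemma block_escal j a : block j (escal (V j) a) = escal W a.
Proof.
apply: endoP => phi f; rewrite block_opE -[escal _ a]mulr1 -[escal W a]mulr1 !escalE.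
by rewrite !scale_lfunE !endo1 !ffunE repl_restr.
Qed.

Lemma block_flip j p q : block j (flip C N p q) = flip C N (tag j p) (tag j q).
Proof.
apply: endoP => phi f; rewrite block_opE !flipE ffunE; congr (phi _).
apply/ffunP => -[k r]; rewrite [RHS]ffunE; have [kj|kj] := eqVneq k j.
  by subst k; rewrite repl_in !ffunE (inj_tperm _ _ _ (@tag_inj j)).
rewrite repl_out // tpermD //; apply: contraNneq kj.
  by move/(congr1 (fun r : J => projT1 r)) => /= ->.
by move/(congr1 (fun r : J => projT1 r)) => /= ->.
Qed.

Lemma block_ptensor j (A : endo (V j)) (x z : forall k, V k) :
  z j = A (x j) -> (forall k, k != j -> z k = x k) ->
  block j A (ptensor x) = ptensor z.
Proof.
move=> zj zk; apply/ffunP => f; rewrite block_opE [RHS]ffunE (bigD1 j) //= zj.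
have -> : slice j f (ptensor x) = (\prod_(k | k != j) (x k : {ffun _ -> C^o}) (restr k f)) *: x j.
  apply/ffunP => h; rewrite !ffunE (bigD1 j) //= mulrC [_ *: _]/GRing.scale /=; congr (_ * _).
    by apply: eq_bigr => k kj; rewrite -/(restr k _) restr_repl_out.
  by rewrite -/(restr j _) restr_repl.
rewrite linearZ ffunE [_ *: _]/GRing.scale /= mulrC; congr (_ * _).
by apply: eq_bigr => k kj; rewrite zk.
Qed.

Lemma block_prod_ptensor (A : forall j, endo (V j)) (r : seq 'I_l) (x : forall k, V k) : uniq r ->
  (\prod_(j <- r) block j (A j) : endo W) (ptensor x) =
  ptensor (fun k => if k \in r then A k (x k) else x k).
Proof.
elim: r x => [|j r IHr] x; first by rewrite big_nil endo1.
rewrite big_cons endoM => /andP[jr ur]; rewrite (IHr x ur); apply: block_ptensor => [|k kj].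
  by rewrite mem_head (negPf jr).
by rewrite in_cons (negPf kj).
Qed.

Lemma ptensor_tbasis f : ptensor (fun k => tbasis C (restr k f)) = tbasis C f.
Proof.
apply/ffunP => f'; rewrite !ffunE; have [->|ff'] := eqVneq f' f.
  by apply: big1 => k _; rewrite ffunE -/(restr k _) eqxx.
have [k kf] : exists k, restr k f' != restr k f.
  apply: contrapT => H; case/eqP: ff'; apply: block_ext => k; apply/eqP/contraT => Hk.
  by case: H; exists k.
by rewrite (bigD1 k) //= ffunE -/(restr k _) (negPf kf) mul0r.
Qed.

Variable U : forall j, {vspace V j}.

Lemma ptensor_basis_mem (x : forall k, V k) : (forall k, x k \in (vbasis (U k) : seq _)) ->
  ptensor x \in vtensor U.
Proof.
move=> xb; have /fin_all_exists[s0 s0P] k : exists i : 'I_(\dim (U k)), (vbasis (U k))`_i = x k.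
  have ik : (index (x k) (vbasis (U k)) < \dim (U k))%N.
    by rewrite -[X in (_ < X)%N](size_tuple (vbasis (U k))) index_mem; exact: xb.
  by exists (Ordinal ik); rewrite /= nth_index //; exact: xb.
pose s : {dffun forall k, 'I_(\dim (U k))} := [ffun k => s0 k].
have <- : ptensor (fun k => (vbasis (U k))`_(s k)) = ptensor x.
  apply/ffunP => f; rewrite !ffunE; apply: eq_bigr => k _.
  by rewrite ffunE s0P.
exact: (subvP (sumv_sup s _ (subvv _))) (memv_line _).
Qed.

Lemma ptensor_sum j (x : forall k, V k) m (a : 'I_m -> C) (b : 'I_m -> V j) :
  x j = \sum_i a i *: b i -> ptensor x = \sum_i a i *: ptensor (dfwith x (b i)).
Proof.
move=> xj; apply/ffunP => f; rewrite sum_ffunE ffunE (bigD1 j) //= xj sum_ffunE mulr_suml.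
apply: eq_bigr => i _; rewrite !ffunE [_ *: _]/GRing.scale /= [_ *: _]/GRing.scale /= -mulrA.
congr (_ * _); rewrite [RHS](bigD1 j) //= dfwith_in; congr (_ * _).
by apply: eq_bigr => k kj; rewrite dfwith_out // eq_sym.
Qed.

Lemma ptensor_mem (x : forall k, V k) : (forall k, x k \in U k) -> ptensor x \in vtensor U.
Proof.
have: forall k, k \notin enum 'I_l -> x k \in (vbasis (U k) : seq _) by move=> k; rewrite mem_enum.
elim: (enum 'I_l) x => [|j r IHr] x xb xU; first by apply: ptensor_basis_mem => k; apply: xb.
rewrite (ptensor_sum (coord_vbasis (xU j))); apply: memv_suml => i _; apply: memvZ.
have bi : (vbasis (U j))`_i \in (vbasis (U j) : seq _) by rewrite mem_nth // size_tuple.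
apply: IHr => k; case: dfwithP => [|k' jk'] //; last by rewrite vbasis_mem.
by move=> kr; apply: xb; rewrite in_cons negb_or eq_sym jk'.
Qed.

End Embedding.

(** The product of the block operators maps pure tensors to pure tensors of images. The basis
    vectors are pure tensors, which gives one inclusion; lifting basis vectors of the images gives
    the other. *)
Lemma vtensor_limg (C : numFieldType) (N l : nat) (n : 'I_l -> nat)
    (F : forall j, endo (tpow C N 'I_(n j))) :
  vtensor (fun j => limg (F j)) = limg (\prod_(j <- enum 'I_l) @block C N l n j (F j) : endo _).
Proof.
have Fpt (x : forall k, tpow C N 'I_(n k)) :
    (\prod_(j <- enum 'I_l) @block C N l n j (F j) : endo _) (ptensor x) = ptensor (fun k => F k (x k)).
  rewrite block_prod_ptensor ?enum_uniq //; apply/ffunP => f; rewrite !ffunE.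
  by apply: eq_bigr => k _; rewrite mem_enum.
apply/eqP; rewrite eqEsubv; apply/andP; split.
  apply/subv_sumP => s _; rewrite -memvE.
  have /fin_all_exists[z zF] : forall j, exists z, F j z = (vbasis (limg (F j)))`_(s j).
    move=> j; have /memv_imgP[z _ ->] : (vbasis (limg (F j)))`_(s j) \in limg (F j).
      by rewrite vbasis_mem // mem_nth // size_tuple.
    by exists z.
  have -> : ptensor (fun j => (vbasis (limg (F j)))`_(s j)) = ptensor (fun j => F j (z j)).
    by apply/ffunP => f; rewrite !ffunE; apply: eq_bigr => j _; rewrite zF.
  by rewrite -Fpt memv_img // memvf.
apply/subvP => _ /memv_imgP[x _ ->]; rewrite (tbasis_decomp x) linear_sum.
apply: memv_suml => f _; rewrite linearZ; apply: memvZ; have := Fpt (fun k => tbasis C (restr k f)).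
rewrite ptensor_tbasis /= => ->; apply: ptensor_mem => k; exact: memv_img (memvf _).
Qed.

Lemma prod_split (A : pzRingType) (I : eqType) (r : seq I) (e x : I -> A) : uniq r ->
  (forall i k, i \in r -> k \in r -> i != k -> x i * e k = e k * x i) ->
  \prod_(i <- r) (e i * x i) = \prod_(i <- r) e i * \prod_(i <- r) x i.
Proof.
elim: r => [|i r IHr] /=; first by rewrite !big_nil mulr1.
move=> /andP[ir ur] xe; rewrite !big_cons IHr => // [|i' k i'r kr]; last first.
  by apply: xe; rewrite in_cons ?i'r ?kr orbT.
have xE : x i * \prod_(k <- r) e k = \prod_(k <- r) e k * x i.
  apply: comm_prod => k kr; apply: xe; rewrite ?in_cons ?eqxx ?kr ?orbT //.
  by apply: contraNneq ir => ->.
by rewrite -mulrA (mulrA (x i)) xE -!mulrA.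
Qed.

Lemma prod_central (A : pzRingType) (I : eqType) (r : seq I) (e x : I -> A) :
  (forall i z, e i * z = z * e i) ->
  \prod_(i <- r) (e i * x i) = \prod_(i <- r) e i * \prod_(i <- r) x i.
Proof.
move=> eC; elim: r => [|i r IHr]; first by rewrite !big_nil mulr1.
rewrite !big_cons IHr -[LHS]mulrA (mulrA (x i)) (comm_prod (x := x i)) => [|k _]; last by rewrite eC.
by rewrite -!mulrA.
Qed.

Lemma exchange_one (A : pzRingType) (I : eqType) (r : seq I) (f : I -> A) (j : I) (x x' : A) :
  uniq r -> j \in r -> x * f j = f j * x' ->
  (forall k, k != j -> x * f k = f k * x) -> (forall k, k != j -> x' * f k = f k * x') ->
  x * \prod_(k <- r) f k = \prod_(k <- r) f k * x'.
Proof.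
move=> ur jr xj xk xk'; case/splitPr: jr ur => r1 r2.
rewrite cat_uniq /= negb_or => /and3P[_ /andP[jr1 _] /andP[jr2 _]].
rewrite big_cat big_cons /= mulrA (comm_prod (x := x)) => [|k kr]; last first.
  by apply: xk; apply: contraNneq jr1 => <-.
rewrite -!mulrA; congr (_ * _); rewrite mulrA xj -mulrA; congr (_ * _).
by apply: comm_prod => k kr; apply: xk'; apply: contraNneq jr2 => <-.
Qed.

(** * Coefficients of a product of linear factors and its values *)

Section CoefficientsValues.
Variables (C : numFieldType) (A : pzRingType) (ka : {rmorphism C -> A}).
Hypothesis kaC : forall c x, ka c * x = x * ka c.
Notation lin := (@lin A).
Implicit Types (f : series A) (r : seq A) (Q : A -> Prop).

Lemma prod_lin_deg r k : (size r < k)%N -> (\prod_(x <- r) lin x) k = 0.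
Proof.
elim: r k => [|x r IHr] [|k] //=; first by rewrite big_nil.
by rewrite ltnS big_cons lin_mulE => rk; rewrite !IHr ?mulr0 ?addr0 // ltnW.
Qed.

Lemma prod_lin_value r u : \prod_(x <- r) (ka u + x) =
  \sum_(k < (size r).+1) ka (u ^+ (size r - k)) * (\prod_(x <- r) lin x) k.
Proof.
elim: r => [|x r IHr]; first by rewrite !big_nil big_ord1 series_1 mulr1 subnn expr0 rmorph1.
rewrite !big_cons /= IHr; set f := \prod_(x <- r) lin x; set m := size r.
have f0 : (lin x * f) 0%N = f 0%N by rewrite series_mul0 mul1r.
rewrite [RHS]big_ord_recl /= f0 subn0 mulrDl.
have -> : \sum_(i < m.+1) ka (u ^+ (m.+1 - lift ord0 i)) * (lin x * f) (lift ord0 i) =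
    \sum_(i < m.+1) ka (u ^+ (m - i)) * f i.+1 + x * \sum_(k < m.+1) ka (u ^+ (m - k)) * f k.
  rewrite mulr_sumr -big_split; apply: eq_bigr => i _.
  by rewrite lift0 lin_mulE mulrDr subSS (scal_mulCA kaC).
rewrite addrA; congr (_ + _); have fm : f m.+1 = 0 by apply: prod_lin_deg.
rewrite [in RHS]big_ord_recr /= fm mulr0 addr0.
rewrite big_ord_recl subn0 mulrDr mulrA -rmorphM -exprS; congr (_ + _).
rewrite mulr_sumr; apply: eq_bigr => i _; rewrite mulrA -rmorphM -exprS lift0.
by rewrite subnSK.
Qed.

Lemma coefficients_closed Q n (x : nat -> A) : lin_closed ka Q ->
  (forall u, Q (\sum_(k < n) ka (u ^+ k) * x k)) -> forall k, (k < n)%N -> Q (x k).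
Proof.
move=> QL; have [Q0 QD] := QL.
have QZ a z : Q z -> Q (ka a * z) by move=> Qz; rewrite -[_ * _]addr0; apply: QD.
elim: n x => // n IHn x Qx.
have Qx0 : Q (x 0%N).
  have := Qx 0; rewrite big_ord_recl expr0 rmorph1 mul1r big1 ?addr0 // => i _.
  by rewrite exprS mul0r rmorph0 mul0r.
case=> // k; rewrite ltnS => kn; apply: (IHn (fun k => x k.+1)) kn => {k} u.
apply: (@polyf_interp _ _ ka kaC (fun u => \sum_(k < n) ka (u ^+ k) * x k.+1) Q 'X) => //.
- by rewrite polyX_eq0.
- elim: n {IHn Qx} => [|n IHn].
    by apply: polyf_ext (polyf_const ka 0) => v; rewrite big_ord0.
  apply: (@polyf_ext _ _ _ (fun v => \sum_(k < n) ka (v ^+ k) * x k.+1 + ka (v ^+ n) * x n.+1)).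
    by move=> v; rewrite big_ord_recr.
  apply: polyf_add => //; apply: polyf_mul => //; last exact: polyf_const.
  by apply: polyf_ext (polyf_scal kaC 'X^n) => v; rewrite hornerXn.
move=> v; rewrite hornerX => v0.
have -> : \sum_(k < n) ka (v ^+ k) * x k.+1 =
    ka v^-1 * (\sum_(k < n.+1) ka (v ^+ k) * x k) + ka (- v^-1) * x 0%N.
  rewrite big_ord_recl expr0 rmorph1 mul1r mulrDr rmorphN mulNr addrAC addrN add0r.
  rewrite mulr_sumr; apply: eq_bigr => i _.
  by rewrite lift0 mulrA -rmorphM exprS mulKf.
by apply: QD => //; apply: QZ.
Qed.

(** The generators of the module are coefficients of series, whereas the R-matrix arguments use
    values at u. Multiplied by a power of u, a product of factors 1 + x/u is a polynomial in u, and
    a subspace that contains all its values contains its coefficients. *)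
Lemma values_coefficients Q r : lin_closed ka Q ->
  (forall u, Q (\prod_(x <- r) (ka u + x))) -> forall k, Q ((\prod_(x <- r) lin x) k).
Proof.
move=> QL Qr k; have [kr|] := ltnP k (size r).+1; last by move/prod_lin_deg->; case: QL.
pose x i := (\prod_(x <- r) lin x) (size r - i)%N.
have -> : (\prod_(x <- r) lin x) k = x (size r - k)%N by rewrite /x subKn.
apply: (@coefficients_closed Q (size r).+1 x QL) => [u|]; last by rewrite ltnS leq_subr.
have := Qr u; rewrite prod_lin_value (reindex_inj rev_ord_inj) /=; congr (Q _).
by apply: eq_bigr => i _; rewrite subSS subKn // -ltnS.
Qed.

Lemma coefficients_values Q r u : lin_closed ka Q ->
  (forall k, Q ((\prod_(x <- r) lin x) k)) -> Q (\prod_(x <- r) (ka u + x)).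
Proof.
move=> [Q0 QD] Qr; rewrite prod_lin_value.
apply: (big_rec Q) => // i z _ Qz; exact: QD.
Qed.

Definition series_closed Q f := forall k, Q (f k).

Lemma geo_closed Q a f : lin_closed ka Q -> series_closed Q f -> series_closed Q (geo ka a * f).
Proof.
move=> [Q0 QD] Qf k; rewrite series_mul.
by apply: (big_rec Q) => // i z _ Qz; apply: QD.
Qed.

Lemma lin_scal_closed Q a f : lin_closed ka Q -> series_closed Q f ->
  series_closed Q (lin (ka a) * f).
Proof.
move=> [Q0 QD] Qf [|k]; first by rewrite series_mul0 mul1r.
by rewrite lin_mulE addrC; apply: QD.
Qed.

Lemma lin_geo a : lin (- ka a) * geo ka a = 1.
Proof.
rewrite -geoC //; symmetry; rewrite -[- _]add0r; apply: geo_lin => // k.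
by rewrite mulr0.
Qed.

Lemma prod_geo_closed Q (I : Type) (s : seq I) (a : I -> C) f :
  lin_closed ka Q -> series_closed Q f -> series_closed Q (\prod_(i <- s) geo ka (a i) * f).
Proof.
move=> QL Qf; elim: s => [|i s IHs]; first by rewrite big_nil mul1r.
by rewrite big_cons -mulrA; apply: geo_closed.
Qed.

(** Each [geo a] has the scalar inverse 1 - a/u, so dividing by it only forms linear combinations of
    coefficients. *)
Lemma prod_geo_cancel Q (I : Type) (s : seq I) (a : I -> C) f : lin_closed ka Q ->
  series_closed Q (\prod_(i <- s) geo ka (a i) * f) -> series_closed Q f.
Proof.
move=> QL; elim: s => [|i s IHs]; first by rewrite big_nil mul1r.
rewrite big_cons -mulrA => Qf; apply: IHs; set h := _ * f in Qf *.
rewrite -[h]mul1r -(lin_geo (a i)) -mulrA -(rmorphN ka).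
exact: lin_scal_closed.
Qed.

End CoefficientsValues.

Lemma entries_closed (C : numFieldType) (N : nat) (W : vectType C) (Q : endo W -> Prop) :
  lin_closed (escal W) Q ->
  lin_closed (mscal W N) (fun X : 'M[endo W]_N => forall i j, Q (X i j)).
Proof.
move=> [Q0 QD]; split=> [i j|a X Y QX QY i j]; first by rewrite mxE.
by rewrite mxE mscalE -escalE; apply: QD.
Qed.

(** * The modules T(u) and S(u) on a product of blocks *)

Section Blocks.
Variables (C : numFieldType) (N : nat) (J : finType) (c y : J -> C).
Variables (l : nat) (bs : 'I_l -> seq (seq J)) (blk : J -> 'I_l).
Hypothesis gb : forall j, good c y (bs j).
Hypothesis blk_bs : forall j p, p \in flatten (bs j) -> blk p = j.
Notation W := (tpow C N J).
Notation E0 := (endo W).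
Notation M1 := 'M[endo W]_N.
Notation site := (@site C N J).
Notation flip := (@flip C N J).
Notation P0 := (@P0 C N J).
Notation escal := (@escal C W).
Notation mscal := (@mscal C W N).
Notation smx := (@smx C W N).
Notation fusion_op := (@fusion_op C N J c).
Notation Lop := (@Lop C N J c).
Implicit Types (p q : J) (u v : C).

Definition sites := flatten [seq flatten (bs j) | j <- enum 'I_l].
Hypothesis us : uniq sites.

Definition fusion_all : E0 := \prod_(j <- enum 'I_l) fusion_op (bs j).

Lemma off_block j k p : j != k -> p \in flatten (bs j) -> p \notin flatten (bs k).
Proof. by move=> jk pj; apply/negP => /blk_bs; rewrite (blk_bs pj) => /eqP; rewrite (negPf jk). Qed.

Lemma site_fusion_op j k p A : j != k -> p \in flatten (bs j) ->
  site p A * fusion_op (bs k) = fusion_op (bs k) * site p A.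
Proof. by move=> jk pj; apply: fusion_op_comm; apply: off_block jk pj. Qed.

Lemma fusion_op_fusion_op j k : j != k -> fusion_op (bs j) * fusion_op (bs k) = fusion_op (bs k) * fusion_op (bs j).
Proof.
move=> jk; symmetry; apply: fusion_op_centralizer => p q pj qj.
symmetry; apply: fusion_op_centralizer => p' q' pk qk.
have ne r r' : r \in flatten (bs j) -> r' \in flatten (bs k) -> r != r'.
  by move=> rj rk; apply: contraTneq rk => <-; apply: off_block jk rj.
by apply: flip_comm; apply: ne.
Qed.

Lemma Lop_fusion_op j k t u : j != k -> {subset t <= flatten (bs j)} ->
  Lop t u * smx (fusion_op (bs k)) = smx (fusion_op (bs k)) * Lop t u.
Proof.
move=> jk tj; symmetry; apply: comm_prod => p pt.
have commB (A : pzRingType) (x x1 x2 : A) : x * x1 = x1 * x -> x * x2 = x2 * x ->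
    x * (x1 - x2) = (x1 - x2) * x.
  by move=> e1 e2; rewrite mulrBr mulrBl e1 e2.
apply: (commB M1); first by symmetry; apply: mscalC.
symmetry; apply/matrixP => i i'.
by rewrite smxE mul_mx_scalarE mul_scalar_mxE mxE (site_fusion_op _ jk) ?tj.
Qed.

Lemma Lop_fusion_all j u :
  Lop (flatten (bs j)) u * smx fusion_all = smx fusion_all * Lop (rev (flatten (bs j))) u.
Proof.
rewrite /fusion_all (rmorph_prod smx); apply: (@exchange_one _ _ _ _ j).
- exact: enum_uniq.
- by rewrite mem_enum.
- exact: (rtt_fusion_op N u (gb j)).
- by move=> k kj; apply: (@Lop_fusion_op j) => //; rewrite eq_sym.
- by move=> k kj; apply: (@Lop_fusion_op j) => [|p]; rewrite ?mem_rev // eq_sym.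
Qed.

Variables (z : 'I_l -> C).
Notation a := (fun p => z (blk p) + c p).

Lemma prod_sites (A : pzRingType) (f : J -> A) :
  \prod_(p <- sites) f p = \prod_(j <- enum 'I_l) \prod_(p <- flatten (bs j)) f p.
Proof. by rewrite /sites big_flatten big_map. Qed.

Definition Mop p : M1 := - P0 p - mscal (a p).

Lemma Mop_value u j :
  \prod_(p <- flatten (bs j)) (mscal u + Mop p) = Lop (flatten (bs j)) (u - z j).
Proof.
apply: eq_big_seq => p pj; rewrite /Mop (blk_bs pj).
have e (A : zmodType) (x1 x2 x3 : A) : x1 + (- x2 - x3) = x1 - x3 - x2 by rewrite addrA addrAC.
rewrite e; congr (_ - _); rewrite -(rmorphB mscal); congr (mscal _).
by rewrite opprD addrA.
Qed.

Lemma value_preserves u (i k : 'I_N) : preserves fusion_all ((\prod_(p <- sites) (mscal u + Mop p)) i k).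
Proof.
suff [Y HY] : exists Y : M1, \prod_(p <- sites) (mscal u + Mop p) * smx fusion_all = smx fusion_all * Y.
  exists (Y i k); have := congr1 (fun M : M1 => M i k) HY.
  by rewrite smxE mul_mx_scalarE mul_scalar_mxE.
rewrite prod_sites; elim: (enum 'I_l) => [|j r [Y HY]].
  by exists 1; rewrite big_nil; exact: (etrans (mul1r _) (esym (mulr1 _))).
exists (Lop (rev (flatten (bs j))) (u - z j) * Y).
by rewrite big_cons Mop_value -mulrA HY mulrA Lop_fusion_all mulrA.
Qed.

Lemma preserves_closed (F : E0) : lin_closed escal (preserves F).
Proof.
split=> [|b x1 x2 [y1 e1] [y2 e2]]; first by exists 0; rewrite mul0r mulr0.
by exists (escal b * y1 + y2); rewrite mulrDl -mulrA e1 e2 mulrDr (scal_mulCA (@escalC _ _)).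
Qed.

Notation T := (@tprod C N J a sites).

Lemma tprodE : T = \prod_(p <- sites) geo mscal (a p) * \prod_(p <- sites) lin (Mop p).
Proof.
rewrite -(prod_central _ _ (fun p => geoC (@mscalC C W N) (a p))).
by apply: eq_bigr => p _; rewrite Rcheck0E.
Qed.

(** For values of the polynomial numerator the relation is block by block that of T(u) with F;
    central factors and interpolation carry it to the coefficients. *)
Lemma tprod_preserves m (i i' : 'I_N) : preserves fusion_all (T m i i').
Proof.
rewrite tprodE; apply: (prod_geo_closed sites (fun p => a p) (entries_closed N (preserves_closed fusion_all))).
move=> {m i i'}m; have := @values_coefficients _ _ mscal (@mscalC C W N) _ [seq Mop p | p <- sites]
  (entries_closed N (preserves_closed fusion_all)).
rewrite big_map; apply => u; rewrite big_map; exact: value_preserves.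
Qed.

Variable g : 'M[C]_N.
Hypothesis g_unit : g \in unitmx.
Notation Q0 := (@Q0 C N J g).
Notation tser := (@tser C N J g).

Definition entries (f : series M1) (x : E0) := exists k i j, x = f k i j.

Lemma X_of_Y_alg (f : series M1) k i j : alg escal (entries f) (X_of_Y g f k i j).
Proof.
have algS (I : Type) (r : seq I) (x : I -> E0) : (forall i, alg escal (entries f) (x i)) ->
    alg escal (entries f) (\sum_(i <- r) x i).
  by move=> ax; apply: big_ind => //; [exact: alg_0 | exact: algD].
rewrite X_of_YE series_mul summxE; apply: (algS) => m; rewrite mulM1E; apply: (algS) => h.
apply: alg_gen; last by exists (k - m)%N, h, j.
rewrite /tser -(rmorphN1 mscal) -rmorphXn mscalE -escalE; apply: algZ.
rewrite tr_t1E; apply: (algS) => i1; apply: (algS) => i2; rewrite -escalE; apply: algZ.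
by apply: alg_mem; exists m, i1, i2.
Qed.

Notation S := (X_of_Y g T).

Lemma S_preserves m (i i' : 'I_N) : preserves fusion_all (S m i i').
Proof.
by apply: preserves_alg (X_of_Y_alg T m i i') => _ [k [h [h' ->]]]; apply: tprod_preserves.
Qed.

Definition Mop' p : M1 := Q0 p - mscal (- a p).

Lemma SE : S = \prod_(p <- rev sites) geo mscal (- a p) * (\prod_(p <- sites) geo mscal (a p) *
  (\prod_(p <- rev sites) lin (Mop' p) * \prod_(p <- sites) lin (Mop p))).
Proof.
have -> : S = tser T * T by [].
rewrite tser_tprod // [X in _ * X]tprodE.
have -> : \prod_(p <- rev sites) (tser (Rcheck0 N p (a p)) : series M1) =
    \prod_(p <- rev sites) geo mscal (- a p) * \prod_(p <- rev sites) lin (Mop' p).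
  rewrite -(prod_central _ _ (fun p => geoC (@mscalC C W N) (- a p))).
  by apply: eq_bigr => p _; rewrite tser_Rcheck0.
have e (A : pzRingType) (x1 x2 x3 x4 : A) : x2 * x3 = x3 * x2 ->
    (x1 * x2) * (x3 * x4) = x1 * (x3 * (x2 * x4)).
  by move=> H; rewrite !mulrA -(mulrA x1) H !mulrA.
refine (e (series M1) _ _ _ _ _); apply: comm_prod => p _; rewrite geoC //; apply: mscalC.
Qed.

(** S(u) times the product of the u^2 - a_p^2, where a_p is the evaluation parameter of the site p;
    it is polynomial both in u and in the parameters. *)
Definition numerator u : M1 :=
  \prod_(p <- rev sites) (mscal u + Mop' p) * \prod_(p <- sites) (mscal u + Mop p).

Lemma numerator_closed (Q : E0 -> Prop) u : lin_closed escal Q ->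
  (forall k (i j : 'I_N), Q (S k i j)) -> forall i j, Q (numerator u i j).
Proof.
move=> QL QS; have QM := entries_closed N QL.
have := @coefficients_values _ _ mscal (@mscalC C W N) _
  ([seq Mop' p | p <- rev sites] ++ [seq Mop p | p <- sites]) u QM.
rewrite !big_cat !big_map; apply.
have := @prod_geo_cancel _ _ mscal (@mscalC C W N) _ _ sites (fun p => a p) _ QM; apply.
have := @prod_geo_cancel _ _ mscal (@mscalC C W N) _ _ (rev sites) (fun p => - a p) _ QM; apply.
by rewrite -SE.
Qed.

End Blocks.

Section MatrixUnits.
Variables (C : numFieldType) (N : nat) (J : finType).
Notation W := (tpow C N J).
Notation E0 := (endo W).
Notation site := (@site C N J).
Notation flatf := {ffun J -> 'I_N}.
Implicit Types (f h : {ffun J -> 'I_N}) (p : J).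

Lemma site_delta_tbasis p a b h :
  site p (delta_mx a b) (tbasis C h) = (h p == b)%:R *: tbasis C (upd h p a).
Proof.
apply/ffunP => f; rewrite site_deltaE !ffunE [_ *: _]/GRing.scale /= -!natrM !mulnb.
congr (_%:R : C); congr nat_of_bool; apply/andP/andP => -[/eqP e1 /eqP e2].
  rewrite -e2 ffunE !eqxx; split=> //; apply/eqP/ffunP => q; rewrite !ffunE.
  by case: eqP => // ->.
rewrite e2 ffunE eqxx; split=> //; apply/eqP/ffunP => q; rewrite !ffunE.
by case: eqP => // ->.
Qed.

Definition mix (r : seq J) f h : flatf := [ffun p => if p \in r then f p else h p].

Lemma site_prod_tbasis r f f' h : uniq r ->
  (\prod_(p <- r) site p (delta_mx (f p) (f' p)) : E0) (tbasis C h) =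
  (all (fun p => h p == f' p) r)%:R *: tbasis C (mix r f h).
Proof.
elim: r => [_|p r IHr /= /andP[pr ur]].
  by rewrite big_nil endo1 scale1r; congr (tbasis C _); apply/ffunP => q; rewrite ffunE.
rewrite big_cons endoM IHr // linearZ /= site_delta_tbasis ffunE (negPf pr) scalerA -natrM mulnb andbC.
congr (_ *: tbasis C _); apply/ffunP => q; rewrite !ffunE in_cons.
by case: eqP => // ->.
Qed.

Lemma matrix_units (X : E0) r : uniq r -> (forall p, p \in r) ->
  X = \sum_f \sum_f' escal W ((X (tbasis C f') : {ffun _ -> C^o}) f) *
    \prod_(p <- r) site p (delta_mx (f p) (f' p)).
Proof.
move=> ur rJ; apply: tbasis_eq => a b; rewrite endo_sumE.
have unit f f' : ((\prod_(p <- r) site p (delta_mx (f p) (f' p)) : E0) (tbasis C b) : {ffun _ -> C^o}) a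
    = (b == f')%:R * (a == f)%:R.
  rewrite site_prod_tbasis // !ffunE [_ *: _]/GRing.scale /=; congr (_%:R * _%:R).
    congr nat_of_bool; apply/allP/eqP => [H|-> //].
    by apply/ffunP => p; apply/eqP; apply: H; apply: rJ.
  by congr (nat_of_bool (_ == _)); apply/ffunP => p; rewrite ffunE rJ.
transitivity (\sum_f \sum_f' (X (tbasis C f') : {ffun _ -> C^o}) f * ((b == f')%:R * (a == f)%:R)).
  rewrite (sum_only (i := a)) => [|f fa]; last first.
    by apply: big1 => f' _; rewrite [a == _]eq_sym (negPf fa) !mulr0.
  rewrite (sum_only (i := b)) => [|f fb]; first by rewrite !eqxx !mulr1.
  by rewrite [b == _]eq_sym (negPf fb) mul0r mulr0.
apply: eq_bigr => f _; rewrite endo_sumE; apply: eq_bigr => f' _.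
by rewrite escalE scale_lfunE ffunE unit.
Qed.

End MatrixUnits.

Section RegularProducts.
Variables (C : numFieldType) (W : vectType C) (N : nat) (P : Type) (reg : (P -> C) -> Prop).
Notation E0 := (endo W).
Notation M1 := 'M[endo W]_N.
Hypothesis reg_const : forall a, reg (fun=> a).
Hypothesis reg_add : forall f h, reg f -> reg h -> reg (fun p => f p + h p).
Hypothesis reg_mul : forall f h, reg f -> reg h -> reg (fun p => f p * h p).

Definition regM (X : P -> M1) := forall i j, regE reg (fun p => X p i j).

Lemma regM_mul X Y : regM X -> regM Y -> regM (fun p => X p * Y p).
Proof.
move=> rX rY i j.
have -> : (fun p => (X p * Y p) i j) = (fun p => \sum_k X p i k * Y p k j).
  by apply: funext => p; rewrite mulM1E.
by apply: regE_sum => // k; apply: regE_mul.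
Qed.

Lemma regM_prod (I : Type) (r : seq I) (X : I -> P -> M1) :
  (forall i, regM (X i)) -> regM (fun p => \prod_(i <- r) X i p).
Proof.
move=> rX; elim: r => [|i r IHr].
  have -> : (fun p => \prod_(i <- [::]) X i p) = (fun=> 1) by apply: funext => p; rewrite big_nil.
  by move=> i j; apply: regE_const.
have -> : (fun p => \prod_(j <- i :: r) X j p) = (fun p => X i p * \prod_(j <- r) X j p).
  by apply: funext => p; rewrite big_cons.
exact: regM_mul.
Qed.

Lemma regM_affine (al be : P -> C) (X : M1) : reg al -> reg be ->
  regM (fun p => mscal W N (al p) + mscal W N (be p) * X).
Proof.
move=> ra rb i j.
have -> : (fun p => (mscal W N (al p) + mscal W N (be p) * X) i j) =
    (fun p => escal W (al p) * (1 : M1) i j + escal W (be p) * X i j).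
  by apply: funext => p; rewrite mxE -[mscal W N (al p)]mulr1 !mscalE !escalE.
by apply: regE_add => //; apply: regE_scale => //; apply: regE_const.
Qed.

End RegularProducts.

Lemma prod_only (A : pzRingType) (I : eqType) (r : seq I) (j : I) (x : A) : uniq r -> j \in r ->
  \prod_(k <- r) (if k == j then x else 1) = x.
Proof.
move=> ur jr; case/splitPr: jr ur => r1 r2.
rewrite cat_uniq /= negb_or => /and3P[_ /andP[jr1 _] /andP[jr2 _]].
have one s : j \notin s -> \prod_(k <- s) (if k == j then x else 1) = 1.
  by move=> js; rewrite big_seq; apply: big1 => k ks; case: eqP ks js => // -> ->.
by rewrite big_cat big_cons /= eqxx !one // mul1r mulr1.
Qed.

(** * Decoupling of the blocks in S(u) *)

Section Decoupling.
Variables (C : numFieldType) (N : nat) (J : finType) (c y : J -> C).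
Variables (l : nat) (bs : 'I_l -> seq (seq J)) (blk : J -> 'I_l).
Hypothesis gb : forall j, good c y (bs j).
Hypothesis blk_bs : forall j p, p \in flatten (bs j) -> blk p = j.
Notation W := (tpow C N J).
Notation E0 := (endo W).
Notation M1 := 'M[endo W]_N.
Notation site := (@site C N J).
Notation P0 := (@P0 C N J).
Notation escal := (@escal C W).
Notation mscal := (@mscal C W N).
Notation fusion_op := (@fusion_op C N J c).
Notation Lop := (@Lop C N J c).
Notation sites := (sites bs).
Notation fusion_all := (@fusion_all C N J c l bs).
Implicit Types (p q : J) (u v w : C).
Hypothesis us : uniq sites.
Hypothesis sitesJ : forall p, p \in sites.

Lemma alg_fusion_op j k x : j != k -> alg escal (@Lgen C N J c (flatten (bs j))) x ->
  x * fusion_op (bs k) = fusion_op (bs k) * x.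
Proof.
move=> jk; elim=> [||a x1 x2 _ IH1 _ IH2|x1 _ _ IH1 [u [i [i' ->]]]].
- by rewrite mulr0 mul0r.
- by rewrite mulr1 mul1r.
- by rewrite mulrDr mulrDl mulrA -escalC -!mulrA IH1 IH2.
have : Lop (flatten (bs j)) u * smx _ _ (fusion_op (bs k)) = smx _ _ (fusion_op (bs k)) * Lop (flatten (bs j)) u.
  by apply: (Lop_fusion_op N c blk_bs u jk).
move/(congr1 (fun M : M1 => M i i')); rewrite smxE mul_mx_scalarE mul_scalar_mxE => e.
by rewrite -mulrA e mulrA IH1 -mulrA.
Qed.

Definition attains (G : E0 -> Prop) (F X : E0) := exists2 b, alg escal G b & b * F = F * X * F.

(** Operators attached to distinct blocks commute, so the relations x_j F_j = F_j X_j F_j of the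
    single diagrams can be multiplied together and regrouped. *)
Lemma density_blocks (G : E0 -> Prop) (A : J -> 'M[C]_N) :
  (forall j x, @Lgen C N J c (flatten (bs j)) x -> alg escal G x) ->
  attains G fusion_all (\prod_(p <- sites) site p (A p)).
Proof.
move=> LG; have /fin_all_exists2[x ax xF] : forall j, exists2 x,
    alg escal (@Lgen C N J c (flatten (bs j))) x &
    x * fusion_op (bs j) = fusion_op (bs j) * \prod_(p <- flatten (bs j)) site p (A p) * fusion_op (bs j).
  by move=> j; exact: density (gb j).
pose X j := \prod_(p <- flatten (bs j)) site p (A p).
have XF j k : j != k -> X j * fusion_op (bs k) = fusion_op (bs k) * X j.
  by move=> jk; rewrite [RHS]comm_prod // => p pj; rewrite (site_fusion_op c blk_bs _ jk).
exists (\prod_(j <- enum 'I_l) x j).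
  by apply: alg_prod => [|j]; [exact: escalC | apply: alg_sub (ax j) => //; [exact: escalC | exact: LG]].
have eu := enum_uniq 'I_l.
have e1 : \prod_(j <- enum 'I_l) (x j * fusion_op (bs j)) =
    \prod_(j <- enum 'I_l) x j * \prod_(j <- enum 'I_l) fusion_op (bs j).
  by apply: prod_split => // j k _ _ jk; symmetry; apply: alg_fusion_op (ax k); rewrite eq_sym.
have e2 : \prod_(j <- enum 'I_l) (fusion_op (bs j) * X j) =
    \prod_(j <- enum 'I_l) fusion_op (bs j) * \prod_(j <- enum 'I_l) X j.
  by apply: prod_split => // j k _ _ jk; apply: XF.
have e3 : \prod_(j <- enum 'I_l) (fusion_op (bs j) * X j * fusion_op (bs j)) =
    \prod_(j <- enum 'I_l) (fusion_op (bs j) * X j) * \prod_(j <- enum 'I_l) fusion_op (bs j).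
  apply: prod_split => // j k _ _ jk.
  by rewrite mulrA (fusion_op_fusion_op N c blk_bs jk) -!mulrA; congr (_ * _); rewrite -XF // eq_sym.
rewrite /fusion_all prod_sites -/X -e1 -e2 -e3.
by apply: eq_bigr => j _; rewrite xF.
Qed.

Lemma corner_full_blocks (G : E0 -> Prop) :
  (forall j x, @Lgen C N J c (flatten (bs j)) x -> alg escal G x) -> corner_full fusion_all G.
Proof.
move=> LG X; rewrite (matrix_units X us sitesJ).
pose Q x := exists2 b, alg escal G b & b * fusion_all = x.
have [Q0 QL] : lin_closed escal Q := lin_closed_lmul fusion_all (alg_closed _ _).
have QZ a x : Q x -> Q (escal a * x) by move=> Qx; rewrite -[_ * _]addr0; apply: QL.
have QD x1 x2 : Q x1 -> Q x2 -> Q (x1 + x2).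
  by move=> Q1 Q2; rewrite -[x1]mul1r -(rmorph1 escal); apply: QL.
rewrite -/(Q _) mulr_sumr mulr_suml; apply: (big_ind Q) => // f _.
rewrite mulr_sumr mulr_suml; apply: (big_ind Q) => // f' _.
rewrite (scal_mulCA (@escalC _ _)) -mulrA; apply: QZ.
exact: density_blocks.
Qed.

Variable g : 'M[C]_N.
Notation Q0 := (@Q0 C N J g).

(** Independent coefficients at each site let one expression cover the numerator of S(u), its
    rescalings and its degeneration at e = 0. *)
Definition Nop (al be al' be' : J -> C) : M1 :=
  \prod_(p <- rev sites) (mscal (al p) + mscal (be p) * Q0 p) *
  \prod_(p <- sites) (mscal (al' p) + mscal (be' p) * P0 p).

Lemma Nop_ext al be al' be' al2 be2 al2' be2' :
  al =1 al2 -> be =1 be2 -> al' =1 al2' -> be' =1 be2' -> Nop al be al' be' = Nop al2 be2 al2' be2'.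
Proof. by move=> /funext-> /funext-> /funext-> /funext->. Qed.

Lemma Nop_scale e e' al be al' be' :
  Nop (fun p => e p * al p) (fun p => e p * be p) (fun p => e' p * al' p) (fun p => e' p * be' p) =
  mscal (\prod_(p <- rev sites) e p * \prod_(p <- sites) e' p) * Nop al be al' be'.
Proof.
have sc (x x1 x2 : C) (X : M1) : mscal (x * x1) + mscal (x * x2) * X =
    mscal x * (mscal x1 + mscal x2 * X).
  by rewrite !rmorphM mulrDr mulrA.
have pull (r : seq J) (e0 a0 b0 : J -> C) (X : J -> M1) :
    \prod_(p <- r) (mscal (e0 p * a0 p) + mscal (e0 p * b0 p) * X p) =
    mscal (\prod_(p <- r) e0 p) * \prod_(p <- r) (mscal (a0 p) + mscal (b0 p) * X p).
  rewrite (rmorph_prod mscal) -(prod_central r _ (fun p => @mscalC C W N (e0 p))).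
  by apply: eq_bigr => p _; apply: sc.
have r4 (A : pzRingType) (x1 x2 x3 x4 z1 z2 : A) : z1 = x1 * x2 -> z2 = x3 * x4 ->
    x2 * x3 = x3 * x2 -> z1 * z2 = x1 * x3 * (x2 * x4).
  by move=> -> -> H; rewrite !mulrA -(mulrA x1) H !mulrA.
rewrite (rmorphM mscal).
apply: (r4 M1 _ _ _ _ _ _ (pull _ e al be _) (pull _ e' al' be' _)).
by symmetry; apply: mscalC.
Qed.

Lemma numeratorE z u : numerator c bs blk z g u =
  Nop (fun p => u + (z (blk p) + c p)) (fun=> 1) (fun p => u - (z (blk p) + c p)) (fun=> -1).
Proof.
have h1 (A : pzRingType) (ka : {rmorphism C -> A}) (x a : C) (q : A) : ka x + (q - ka (- a)) = ka (x + a) + ka 1 * q.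
  by rewrite rmorph1 mul1r rmorphD rmorphN opprK addrA addrAC.
have h2 (A : pzRingType) (ka : {rmorphism C -> A}) (x a : C) (q : A) : ka x + (- q - ka a) = ka (x - a) + ka (-1) * q.
  by rewrite rmorphN1 mulN1r rmorphB addrA addrAC.
rewrite /numerator /Nop.
have E1 : \prod_(p <- rev sites) (mscal u + Mop' c blk z g p) =
    \prod_(p <- rev sites) (mscal (u + (z (blk p) + c p)) + mscal 1 * Q0 p).
  by apply: eq_bigr => p _; apply: (h1 M1 mscal).
have E2 : \prod_(p <- sites) (mscal u + Mop N c blk z p) =
    \prod_(p <- sites) (mscal (u - (z (blk p) + c p)) + mscal (-1) * P0 p).
  by apply: eq_bigr => p _; apply: (h2 M1 mscal).
exact: (congr2 *%R E1 E2).
Qed.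

Variables (P : Type) (reg : (P -> C) -> Prop).
Hypothesis reg_const : forall a, reg (fun=> a).
Hypothesis reg_add : forall f h, reg f -> reg h -> reg (fun t => f t + h t).
Hypothesis reg_mul : forall f h, reg f -> reg h -> reg (fun t => f t * h t).

Lemma Nop_reg (al be al' be' : P -> J -> C) :
  (forall p, reg (al^~ p)) -> (forall p, reg (be^~ p)) ->
  (forall p, reg (al'^~ p)) -> (forall p, reg (be'^~ p)) ->
  regM reg (fun t => Nop (al t) (be t) (al' t) (be' t)).
Proof.
move=> r1 r2 r3 r4; apply: regM_mul => //; apply: regM_prod => // p; exact: regM_affine.
Qed.

End Decoupling.

Section DecouplingLimit.
Variables (C : numFieldType) (N : nat) (J : finType) (c : J -> C).
Variables (l : nat) (bs : 'I_l -> seq (seq J)) (blk : J -> 'I_l).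
Hypothesis blk_bs : forall j p, p \in flatten (bs j) -> blk p = j.
Notation W := (tpow C N J).
Notation E0 := (endo W).
Notation M1 := 'M[endo W]_N.
Notation P0 := (@P0 C N J).
Notation escal := (@escal C W).
Notation mscal := (@mscal C W N).
Notation sites := (sites bs).
Notation fusion_all := (@fusion_all C N J c l bs).
Notation Lop := (@Lop C N J c).
Implicit Types (p q : J) (u v w : C).
Variable g : 'M[C]_N.
Notation Q0 := (@Q0 C N J g).
Notation Nop := (@Nop C N J l bs g).

Let zeta (j : 'I_l) : C := j.+1%:R.

(* Up to a scalar, the numerator of S(u) for z_k = zeta_k / e and u = w + zeta_j / e, each *)
(* factor other than those of T(u) in the block j being multiplied by e; at e = 0 these    *)
(* other factors become nonzero scalars.                                                   *)
Definition limit_op (j : 'I_l) w (e : C) : M1 :=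
  Nop (fun p => e * (w + c p) + (zeta j + zeta (blk p))) (fun=> e)
    (fun p => if blk p == j then w - c p else e * (w - c p) + (zeta j - zeta (blk p)))
    (fun p => if blk p == j then -1 else - e).

Lemma limit_op_numerator j w e : e != 0 ->
  exists k, limit_op j w e = mscal k * numerator c bs blk (fun j => zeta j / e) g (w + zeta j / e).
Proof.
move=> e0; exists (\prod_(p <- rev sites) e * \prod_(p <- sites) (if blk p == j then 1 else e)).
rewrite numeratorE -(@Nop_scale C N J l bs g (fun=> e) (fun p => if blk p == j then 1 else e)).
apply: Nop_ext => p.
- by field.
- by rewrite mulr1.
- by case: eqP => [->|_]; field.
- by case: eqP => _; rewrite ?mulrN1.
Qed.

Lemma prod_block (A : pzRingType) (f : J -> A) j :
  \prod_(p <- sites) (if blk p == j then f p else 1) = \prod_(p <- flatten (bs j)) f p.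
Proof.
rewrite prod_sites.
rewrite -[RHS](@prod_only _ _ (enum 'I_l) j) ?enum_uniq ?mem_enum //.
apply: eq_bigr => k _; rewrite big_seq; case: eqP => [->|kj].
  by rewrite [RHS]big_seq; apply: eq_bigr => p /blk_bs ->; rewrite eqxx.
by apply: big1 => p /blk_bs ->; case: eqP.
Qed.

(** At e = 0 a transposed factor at a site of the block k becomes zeta_j + zeta_k, nonzero by
    positivity even for k = j, and a factor of T(u) with k <> j becomes zeta_j - zeta_k, nonzero
    because the zeta are distinct. The factors of T(u) in the block j are left untouched. *)
Lemma limit_op0 j w : exists2 k, k != 0 & limit_op j w 0 = mscal k * Lop (flatten (bs j)) w.
Proof.
pose e' p := if blk p == j then 1 else zeta j - zeta (blk p).
exists (\prod_(p <- rev sites) (zeta j + zeta (blk p)) * \prod_(p <- sites) e' p).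
  rewrite mulf_neq0 // prodf_seq_neq0; apply/allP => p _ /=.
    by rewrite -natrD pnatr_eq0.
  rewrite /e'; case: (blk p =P j) => [_|/eqP pj]; first by rewrite oner_neq0.
  by rewrite subr_eq0 eqr_nat eqSS eq_sym.
have -> : limit_op j w 0 = Nop (fun p => (zeta j + zeta (blk p)) * 1) (fun p => (zeta j + zeta (blk p)) * 0)
    (fun p => e' p * (if blk p == j then w - c p else 1)) (fun p => e' p * (if blk p == j then -1 else 0)).
  apply: Nop_ext => p.
  - by rewrite mul0r add0r mulr1.
  - by rewrite mulr0.
  - by rewrite /e'; case: eqP; rewrite ?mul0r ?add0r ?mul1r ?mulr1.
  - by rewrite /e'; case: eqP; rewrite ?oppr0 ?mulr0 ?mul1r.
rewrite Nop_scale; congr (_ * _).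
have one (A : pzRingType) (ka : {rmorphism C -> A}) (x : A) : ka 1 + ka 0 * x = 1.
  by rewrite rmorph1 rmorph0 mul0r addr0.
have two (A : pzRingType) (ka : {rmorphism C -> A}) u (x : A) : ka u + ka (-1) * x = ka u - x.
  by rewrite rmorphN1 mulN1r.
have E1 : \prod_(p <- rev sites) (mscal 1 + mscal 0 * Q0 p) = 1.
  by apply: big1 => p _; apply: (one M1 mscal).
have E2 : \prod_(p <- sites) (mscal (if blk p == j then w - c p else 1) +
    mscal (if blk p == j then -1 else 0) * P0 p) = Lop (flatten (bs j)) w.
  apply: etrans (prod_block (lop mscal P0 c w) j); apply: eq_bigr => p _.
  by case: eqP => _; [exact: (two M1 mscal) | exact: (one M1 mscal)].
exact: (etrans (congr2 *%R E1 E2) (mul1r _)).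
Qed.

End DecouplingLimit.

(** * Fullness for generic parameters *)

Section Generic.
Variables (C : numFieldType) (N : nat) (J : finType) (c y : J -> C).
Variables (l : nat) (bs : 'I_l -> seq (seq J)) (blk : J -> 'I_l).
Hypothesis gb : forall j, good c y (bs j).
Hypothesis blk_bs : forall j p, p \in flatten (bs j) -> blk p = j.
Notation W := (tpow C N J).
Notation E0 := (endo W).
Notation escal := (@escal C W).
Notation sites := (sites bs).
Notation fusion_all := (@fusion_all C N J c l bs).
Hypothesis us : uniq sites.
Hypothesis sitesJ : forall p, p \in sites.
Variable g : 'M[C]_N.
Hypothesis g_unit : g \in unitmx.
Notation T z := (@tprod C N J (fun p => z (blk p) + c p) sites).
Notation S z := (X_of_Y g (T z)).

Definition univariate (f : C -> C) := exists q : {poly C}, forall e, f e = q.[e].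
Definition multivariate (f : ('I_l -> C) -> C) := exists q : {mpoly C[l]}, forall z, f z = q.@[z].

Lemma univariate_const a : univariate (fun=> a).
Proof. by exists a%:P => e; rewrite hornerC. Qed.

Lemma univariate_add f h : univariate f -> univariate h -> univariate (fun e => f e + h e).
Proof. by move=> [q fq] [r hr]; exists (q + r) => e; rewrite hornerD fq hr. Qed.

Lemma univariate_mul f h : univariate f -> univariate h -> univariate (fun e => f e * h e).
Proof. by move=> [q fq] [r hr]; exists (q * r) => e; rewrite hornerM fq hr. Qed.

Lemma multivariate_const a : multivariate (fun=> a).
Proof. by exists a%:MP => z; rewrite mevalC. Qed.

Lemma multivariate_add f h : multivariate f -> multivariate h -> multivariate (fun z => f z + h z).
Proof. by move=> [q fq] [r hr]; exists (q + r) => z; rewrite mevalD fq hr. Qed.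

Lemma multivariate_mul f h : multivariate f -> multivariate h -> multivariate (fun z => f z * h z).
Proof. by move=> [q fq] [r hr]; exists (q * r) => z; rewrite mevalM fq hr. Qed.

Definition limit_gen (k : 'I_l * C * 'I_N * 'I_N) (e : C) : E0 :=
  limit_op c bs blk g k.1.1.1 k.1.1.2 e k.1.2 k.2.

Definition numerator_gen (k : C * 'I_N * 'I_N) (z : 'I_l -> C) : E0 :=
  numerator c bs blk z g k.1.1 k.1.2 k.2.

Lemma limit_gen_reg k : regE univariate (limit_gen k).
Proof.
have uc := univariate_const; have ua := univariate_add; have um := univariate_mul.
have uid : univariate id by exists 'X => e; rewrite hornerX.
have uN : univariate -%R by exists (- 'X) => e; rewrite hornerN hornerX.
apply: Nop_reg => // p; first by apply: (ua) => //; apply: um.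
  by case: (blk p == k.1.1.1) => //; apply: (ua) => //; apply: um.
by case: (blk p == k.1.1.1).
Qed.

Lemma numerator_gen_reg k : regE multivariate (numerator_gen k).
Proof.
have mc := multivariate_const; have ma := multivariate_add; have mm := multivariate_mul.
have mz j (a : C) : multivariate (fun z => z j + a).
  by apply: (ma) => //; exists 'X_j => z; rewrite mevalXU.
have H : regM multivariate (fun z => Nop bs g
  (fun p => k.1.1 + (z (blk p) + c p)) (fun=> 1) (fun p => k.1.1 - (z (blk p) + c p)) (fun=> -1)).
  apply: Nop_reg => // p; apply: (ma) => //.
  have -> : (fun z : 'I_l -> C => - (z (blk p) + c p)) = (fun z => -1 * (z (blk p) + c p)).
    by apply: funext => z; rewrite mulN1r.
  exact: mm.
have -> : numerator_gen k = (fun z => Nop bs g (fun p => k.1.1 + (z (blk p) + c p)) (fun=> 1)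
    (fun p => k.1.1 - (z (blk p) + c p)) (fun=> -1) k.1.2 k.2).
  by apply: funext => z; rewrite /numerator_gen numeratorE.
exact: H.
Qed.

Lemma numerator_gen_alg z k : alg escal (entries (S z)) (numerator_gen k z).
Proof.
refine (numerator_closed us g_unit _ (alg_closed escal (entries (S z))) _ _ _) => m i i'.
by apply: alg_mem; exists m, i, i'.
Qed.

Lemma numerator_gen_preserves z k : preserves fusion_all (numerator_gen k z).
Proof.
refine (numerator_closed us g_unit _ (preserves_closed fusion_all) _ _ _) => m i i'.
exact: S_preserves.
Qed.

Lemma corner_full_generic : exists2 q : {mpoly C[l]}, exists z, q.@[z] != 0 &
  forall z, q.@[z] != 0 -> corner_full fusion_all (entries (S z)).
Proof.
have full0 : corner_full fusion_all (gens limit_gen 0).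
  apply: (corner_full_blocks gb blk_bs us sitesJ) => j _ [u [i [i' ->]]].
  have [k k0 e] := limit_op0 c blk_bs g j u.
  have -> : Lop N c (flatten (bs j)) u i i' = escal k^-1 * limit_gen (j, u, i, i') 0.
    rewrite /limit_gen /= e mscalE escalE scalerA mulVf ?scale1r //.
  by apply: algZ; apply: alg_mem; exists (j, u, i, i').
have [d [q dq] [d0 open1]] := corner_full_open univariate_const univariate_add univariate_mul
  limit_gen_reg full0.
have [e] : exists e, (q * 'X).[e] != 0.
  (* The extra factor ['X] forces e <> 0, which is needed for z0 and for relating the scaled family
     to S(u). *)
  apply: poly_nonroot; rewrite mulf_neq0 ?polyX_eq0 //.
  by apply: contraNneq d0 => q0; rewrite dq q0 horner0.
rewrite hornerM hornerX mulf_eq0 negb_or -dq => /andP[de e0].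
pose z0 (j : 'I_l) : C := j.+1%:R / e.
have limE k : exists a, limit_gen k e = escal a * numerator_gen (k.1.1.2 + z0 k.1.1.1, k.1.2, k.2) z0.
  have [a ea] := limit_op_numerator c bs blk g k.1.1.1 k.1.1.2 e0.
  by exists a; rewrite /limit_gen ea mscalE escalE.
have full1 : corner_full fusion_all (gens numerator_gen z0).
  have full_e : corner_full fusion_all (gens limit_gen e).
    apply: open1 de _ => k; have [a ->] := limE k.
    have [y' ey] := numerator_gen_preserves z0 (k.1.1.2 + z0 k.1.1.1, k.1.2, k.2).
    by exists (escal a * y'); rewrite -mulrA ey (scal_mulCA (@escalC _ _)).
  move=> X; have [b ab bF] := full_e X; exists b => //.
  apply: alg_sub ab; first exact: escalC.
  move=> _ [k ->]; have [a ->] := limE k; apply: algZ; apply: alg_mem; by eexists.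
have [d2 [q2 dq2] [d20 open2]] := corner_full_open multivariate_const multivariate_add
  multivariate_mul numerator_gen_reg full1.
exists q2; first by exists z0; rewrite -dq2.
move=> z qz X; have [||b ab bF] := open2 z _ _ X; rewrite ?dq2 //.
  by move=> k; apply: numerator_gen_preserves.
exists b => //; apply: alg_sub ab; first exact: escalC.
by move=> _ [k ->]; apply: numerator_gen_alg.
Qed.

End Generic.

Lemma uniq_flatten_disjoint (I : eqType) (T : eqType) (r : seq I) (s : I -> seq T) (k : T -> I) :
  uniq r -> (forall i, uniq (s i)) -> (forall i x, x \in s i -> k x = i) ->
  uniq (flatten [seq s i | i <- r]).
Proof.
move=> + us ks; elim: r => //= i r IHr /andP[ir ur]; rewrite cat_uniq us (IHr ur) andbT /=.
apply/hasPn => x /flattenP[_ /mapP[i' i'r ->]] /ks e'; apply/negP => /ks e.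
by move: ir; rewrite -e e' i'r.
Qed.

Lemma Rfused_map (C : fieldType) (E : pzRingType) (ka : {rmorphism C -> E}) (J J' : eqType)
    (T : J -> J') (t : J' -> J' -> E) (v : J' -> C) bs :
  Rfused ka t v (map (map T) bs) = Rfused ka (fun p q => t (T p) (T q)) (fun p => v (T p)) bs.
Proof.
have fm u (a : J' -> E) b : fused ka v a u (map T b) = fused ka (fun p => v (T p)) (fun p => a (T p)) u b.
  by rewrite /fused big_map; case: b.
elim: bs => //= b bs IHbs; elim: b => //= p b IHb; rewrite IHb !big_map; congr (_ * _ * _).
by apply: eq_bigr => b' _; rewrite fm.
Qed.

(** * The fusion modules as products of blocks *)

Section FusionModules.
Variables (C : numFieldType) (N l : nat) (w : 'I_l -> skew_diagram).
Notation J := {j : 'I_l & 'I_(nbox (w j))}.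
Notation tag j p := (Tagged (fun j => 'I_(nbox (w j))) (i := j) p).
Notation blk := (fun p : J => projT1 p).

Definition all_content (p : J) : C := content C (projT2 p).
Definition all_colidx (p : J) : C := colidx C (projT2 p).
Definition block_columns j : seq (seq J) := [seq [seq tag j p | p <- b] | b <- columns (w j)].

Lemma flatten_block_columns j : flatten (block_columns j) = [seq tag j p | p <- enum 'I_(nbox (w j))].
Proof. by rewrite /block_columns -map_flatten flatten_columns. Qed.

Lemma block_columns_blk j p : p \in flatten (block_columns j) -> blk p = j.
Proof. by rewrite flatten_block_columns => /mapP[q _ ->]. Qed.

Lemma good_block_columns j : good all_content all_colidx (block_columns j).
Proof.
apply: (@good_map _ _ _ (fun p => tag j p)); first exact: tag_inj.
exact: good_columns.
Qed.

Lemma uniq_sites : uniq (sites block_columns).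
Proof.
apply: (@uniq_flatten_disjoint _ _ _ _ blk); first exact: enum_uniq.
  move=> j; rewrite flatten_block_columns map_inj_uniq ?enum_uniq //; exact: tag_inj.
exact: block_columns_blk.
Qed.

Lemma mem_sites p : p \in sites block_columns.
Proof.
case: p => j p; apply/flattenP; exists (flatten (block_columns j)).
  by apply: map_f; rewrite mem_enum.
by rewrite flatten_block_columns map_f // mem_enum.
Qed.

Lemma index_enum_ord n : index_enum 'I_n = enum 'I_n.
Proof. by rewrite enumT; reflexivity. Qed.

Lemma fusion_TE (z : 'I_l -> C) :
  fusion_T N w z = tprod N (fun p => z (blk p) + all_content p) (sites block_columns).
Proof.
rewrite /fusion_T /tprod prod_sites index_enum_ord; apply: eq_bigr => j _.
by rewrite flatten_block_columns big_map index_enum_ord.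
Qed.

Variable F : forall j, endo (tpow C N 'I_(nbox (w j))).
Hypothesis F_val : forall j, fusion_value (F j).

Lemma vtensor_fusion :
  vtensor (fun j => limg (F j)) = limg (fusion_all N all_content block_columns).
Proof.
rewrite vtensor_limg; congr (limg _); apply: eq_bigr => j _.
rewrite (fusion_value_unique (@F_val j)) /fusion_op.
rewrite /block_columns Rfused_map.
exact: (Rfused_morph (phi := @block C N l (fun j => nbox (w j)) j) (@block_escal _ _ _ _ j) (@block_flip _ _ _ _ j)).
Qed.

Hypothesis N_gt0 : (0 < N)%N.
Hypothesis w_col : forall j k, (column_length (w j) k <= N)%N.

(** Columns of length at most N admit the standard labels. The pure tensor of the images of the
    basis vectors so labelled has, at the combined labels, a coefficient that is a product of
    nonzero ones. *)
Lemma vtensor_fusion_neq0 : vtensor (fun j => limg (F j)) != 0%VS.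
Proof.
have /fin_all_exists[f Hf] : forall j, exists f : {ffun 'I_(nbox (w j)) -> 'I_N},
    (F j (tbasis C f) : {ffun _ -> C^o}) f != 0.
  move=> j; rewrite (fusion_value_unique (@F_val j)).
  have gc := good_columns (w j) C.
  have [||f Hf] := @std_labels_exist N 'I_(nbox (w j)) N_gt0 (columns (w j)).
  - by rewrite flatten_columns enum_uniq.
  - by move=> b /size_columns[k bk]; apply: leq_trans bk (w_col j k).
  by exists f; apply: fusion_op_coef gc Hf.
pose v := ptensor (fun j => F j (tbasis C (f j))).
have vV : v \in vtensor (fun j => limg (F j)).
  by apply: ptensor_mem => j; exact: memv_img (memvf _).
apply: contraTneq vV => ->; rewrite memv0; apply/eqP => v0.
have := congr1 (fun u : {ffun _ -> C^o} => u [ffun q : J => f (projT1 q) (projT2 q)]) v0.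
rewrite /v [LHS]ffunE [RHS]ffunE => /eqP/prodf_eq0[j _].
have -> : [ffun p => [ffun q : J => f (projT1 q) (projT2 q)] (tag j p)] = f j.
  by apply/ffunP => p; rewrite !ffunE.
by rewrite (negPf (Hf j)).
Qed.

Lemma generically_irreducible (g : 'M[C]_N) :
  g \in unitmx -> g^T = g \/ g^T = - g ->
  exists2 q : {mpoly C[l]}, exists z, q.@[z] != 0 & forall z, q.@[z] != 0 ->
    let V := vtensor (fun j => limg (F j)) in
    let T := fusion_T N w z in
    [/\ Yangian_rep T, stable T V & X_irreducible g (X_of_Y g T) V].
Proof.
move=> g_unit g_sym.
have [q q0 Hq] := corner_full_generic good_block_columns block_columns_blk uniq_sites mem_sites g_unit.
exists q; first exact: q0.
move=> z /Hq full V T.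
have V0 : V != 0%VS := vtensor_fusion_neq0.
have TE : T = _ := fusion_TE z; have VE : V = _ := vtensor_fusion.
clearbody V T; subst V T.
split.
- exact: Yangian_rep_tprod uniq_sites.
- by move=> k i j; apply: preserves_limg; exact: (tprod_preserves good_block_columns block_columns_blk).
split.
- exact: XYangian_rep_tprod g_unit g_sym _ _ uniq_sites.
- by move=> k i j; apply: preserves_limg; exact: (S_preserves good_block_columns block_columns_blk).
- exact: V0.
move=> U UV sU; apply: (corner_full_irreducible full) => // _ [k [i [j ->]]]; exact: sU.
Qed.

End FusionModules.

Theorem theorem6 (R : realType) (N : nat) (N_gt1 : (1 < N)%N)
  (g : 'M[R[i]]_N) (g_unit : g \in unitmx)
  (g_sym : g^T = g \/ g^T = - g)
  (l : nat) (w : 'I_l -> skew_diagram)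
  (w_col : forall (j : 'I_l) (k : nat), (column_length (w j) k <= N)%N)
  (F : forall j : 'I_l, endo (tpow R[i] N 'I_(nbox (w j))))
  (F_val : forall j : 'I_l, fusion_value (F j)) :
  exists D : ('I_l -> R[i]) -> Prop,
    [/\ algebraic_set D,
        exists z : 'I_l -> R[i], ~ D z &
        forall z : 'I_l -> R[i], ~ D z ->
          let V := vtensor (fun j : 'I_l => limg (F j)) in
          let T := fusion_T N w z in
          [/\ Yangian_rep T, stable T V & X_irreducible g (X_of_Y g T) V]].
Proof.
have [q [z0 q0] Hq] := generically_irreducible F_val (ltnW N_gt1) w_col g_unit g_sym.
(* D is the hypersurface q = 0; it is proper because q does not vanish at z0. *)
exists (fun z => q.@[z] = 0); split.
- exists (eq q) => z; split=> [qz _ <- //|]; exact.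
- by exists z0; apply/eqP.
- by move=> z /eqP; apply: Hq.
Qed.
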